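(* Let $\Gamma$ be the exchange graph of the cluster structure for $\mathrm{Fl}(\mathbb{C}^4)$, and for each seed $\mathbf{s}$ (vertex of $\Gamma$) let $\Delta_{\mathbf{s}}=\Delta(\mathrm{Fl}(\mathbb{C}^4),\mathcal{L}_\lambda,v_{\mathbf{s}},\tau_\lambda)$ be the associated Newton--Okounkov body, where $\mathcal{L}_\lambda$ is the anticanonical line bundle of $\mathrm{Fl}(\mathbb{C}^4)$. There exist two distinct involutions (graph automorphisms of order two) $\iota$ and $\iota'$ of $\Gamma$, generating a group isomorphic to $\mathbb{Z}_2\times\mathbb{Z}_2$, such that for every seed $\mathbf{s}$ $$\Delta_{\mathbf{s}}\cong\Delta_{\iota(\mathbf{s})}\quad\text{and}\quad\Delta_{\mathbf{s}}\cong\Delta_{\iota'(\mathbf{s})}.$$ Moreover, there are no other symmetries of $\Gamma$ preserving the unimodular equivalence classes: every graph automorphism $\varphi$ of $\Gamma$ with $\Delta_{\mathbf{s}}\cong\Delta_{\varphi(\mathbf{s})}$ for all seeds $\mathbf{s}$ belongs to the group generated by $\iota$ and $\iota'$. Here $\cong$ denotes unimodular equivalence.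
   Context: **Unimodular equivalence.** Rational convex polytopes $P,Q\subset\mathbb{R}^N$ are unimodularly equivalent, $P\cong Q$, if there is an affine map $f(\mathbf{x})=A\mathbf{x}+\mathbf{b}$ with $A\in\mathrm{GL}_N(\mathbb{Z})$, $\mathbf{b}\in\mathbb{Z}^N$ and $f(P)=Q$. **Flag variety.** $G=\mathrm{SL}_4(\mathbb{C})$, $B$ is the upper triangular Borel subgroup, $U^-$ is the group of lower unitriangular matrices, $G/B=\mathrm{Fl}(\mathbb{C}^4)$, and $U^-\hookrightarrow G/B$ is the open embedding $u\mapsto uB$. $U^-_{w_0}=U^-\cap B\widetilde{w}_0B$, with $\widetilde{w}_0$ a lift of the longest element $w_0$ of $\mathfrak{S}_4$, is open in $U^-$, so $\mathbb{C}(G/B)=\mathbb{C}(U^-_{w_0})$. For a matrix $x$, $D_{I,K}(x)$ is the minor with rows $I$ and columns $K$; $[i]=\{1,\dots,i\}$; $\varpi_i$ are the fundamental weights. **Line bundle and section.** $\lambda=2\varpi_1+2\varpi_2+2\varpi_3$, and $\mathcal{L}_\lambda$ is the anticanonical line bundle of $G/B$; $H^0(G/B,\mathcal{L}_\lambda^{\otimes k})$ is identified with the regular functions $f$ on $G$ satisfying $f(gb)=(k\lambda)(b)f(g)$ for $b\in B$ (with $k\lambda$ extended to $B$ trivially on its unipotent radical). The section $\tau_\lambda$ is $\prod_{i=1}^3D_{[i],[i]}^2$, nowhere vanishing on $U^-$. **Newton--Okounkov body.** For a valuation $v$ on $\mathbb{C}(G/B)\setminus\{0\}$ with values in $\mathbb{Z}^6$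 and one-dimensional leaves, $\Delta(G/B,\mathcal{L}_\lambda,v,\tau_\lambda)$ is the closure of $\bigcup_{k\ge1}\{\frac1k v(\sigma/\tau_\lambda^k)\mid \sigma\in H^0(G/B,\mathcal{L}_\lambda^{\otimes k})\setminus\{0\}\}$. **Seeds and mutations.** $J=\{1,\dots,6\}$, $J_{\mathrm{uf}}=\{1,2,3\}$. A seed $\mathbf{s}=(\mathbf{A},\varepsilon)$ of $\mathbb{C}(U^-_{w_0})$ consists of a free generating set $\mathbf{A}=(A_j)_{j\in J}$ of this field and an integer matrix $\varepsilon=(\varepsilon_{i,j})_{i\in J_{\mathrm{uf}},j\in J}$ with skew-symmetrizable $J_{\mathrm{uf}}\times J_{\mathrm{uf}}$-part. With $[a]_+=\max\{a,0\}$, the mutation $\mu_k(\mathbf{s})=(\mathbf{A}',\varepsilon')$, $k\in J_{\mathrm{uf}}$, is given by $A_i'=A_i$ for $i\ne k$, $A_k'=A_k^{-1}(\prod_jA_j^{[\varepsilon_{k,j}]_+}+\prod_jA_j^{[-\varepsilon_{k,j}]_+})$, $\varepsilon'_{i,j}=-\varepsilon_{i,j}$ if $i=k$ or $j=k$, and $\varepsilon'_{i,j}=\varepsilon_{i,j}+\mathrm{sgn}(\varepsilon_{i,k})[\varepsilon_{i,k}\varepsilon_{k,j}]_+$ otherwise. Two seeds are equivalent if they differ by a permutation of the indices fixing $J\setminus J_{\mathrm{uf}}$ pointwise. **The cluster structure and exchange graph.** The initial seed $\mathbf{s}_{t_0}$ comes from the reduced word $(1,2,1,3,2,1)$ of $w_0$: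 its cluster variables are the restrictions to $U^-_{w_0}$ of $A_1=D_{\{2\},\{1\}}$, $A_2=D_{\{2,3\},\{1,2\}}$, $A_3=D_{\{3\},\{1\}}$, $A_4=D_{\{2,3,4\},\{1,2,3\}}$, $A_5=D_{\{3,4\},\{1,2\}}$, $A_6=D_{\{4\},\{1\}}$, and the rows of its exchange matrix are $(0,-1,1,0,0,0)$, $(1,0,-1,-1,1,0)$, $(-1,1,0,0,-1,1)$. The seeds of the cluster structure are all those obtained from $\mathbf{s}_{t_0}$ by iterated mutation, taken up to equivalence; there are exactly $14$. The exchange graph $\Gamma$ has these $14$ seeds as vertices, two being adjacent iff they are related by a single mutation (up to equivalence). Equivalent seeds give polytopes differing by a permutation of coordinates, so the unimodular equivalence class of $\Delta_{\mathbf{s}}$ depends only on the vertex of $\Gamma$. **The valuation $v_{\mathbf{s}}$.** For a seed $\mathbf{s}=(\mathbf{A},\varepsilon)$, order $\mathbb{Z}^J$ (row vectors) by $a\preceq_\varepsilon a'$ iff $a=a'+u\varepsilon$ for some $u\in\mathbb{Z}_{\ge0}^{J_{\mathrm{uf}}}$. Fix a total order on $\mathbb{Z}^J$ compatible with addition refining the opposite order of $\preceq_\varepsilon$. Then $v_{\mathbf{s}}$ sends a nonzero polynomial in the $A_j$ to the exponent vector of its lowest monomial, extended to quotients by $v_{\mathbf{s}}(f/g)=v_{\mathbf{s}}(f)-v_{\mathbf{s}}(g)$. **Known description (Fujita--Oya).** Each $\Delta_{\mathbf{s}}$ is a rational convex polytope. $\Delta_{\mathbf{s}_{t_0}}$ is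 the set of $g\in\mathbb{R}^6$ with $g_1+g_2+g_4\ge0$, $g_2+g_4\ge0$, $g_3+g_5\ge0$, $g_4,g_5,g_6\ge0$, $g_1+g_3+g_6\le2$, $g_2+g_5\le2$, $g_3+g_6\le2$, $g_4,g_5,g_6\le2$. If $\mathbf{s}'=\mu_k(\mathbf{s})$, then $\Delta_{\mathbf{s}'}=\mu_k^T(\Delta_{\mathbf{s}})$, where $\mu_k^T(g)=g'$ with $g'_k=-g_k$ and $g'_j=g_j+[-\varepsilon_{k,j}]_+g_k+\varepsilon_{k,j}[g_k]_+$ for $j\ne k$, with $\varepsilon$ the exchange matrix of $\mathbf{s}$. *)

(* Defs.v *)
From HB Require Import structures.
From mathcomp Require Import all_boot all_order all_algebra perm.
From mathcomp Require Import complex.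
(* The notations of mpoly clash with those of mathcomp-analysis, hence
   [mpoly n R] instead of the braces notation. *)
From mathcomp Require Import -(notations) mpoly.
From mathcomp Require Import boolp classical_sets reals topology.

Set Implicit Arguments.
Unset Strict Implicit.
Unset Printing Implicit Defensive.

Import Order.TTheory GRing.Theory Num.Theory.
Import numFieldTopology.Exports.

Local Open Scope classical_set_scope.
Local Open Scope ring_scope.

(* Points of R^n are row vectors, so affine maps act by x |-> x A + b; as A
   ranges over GL_n(Z) this gives the same relation as x |-> A x + b. *)
Definition unimodular_equiv (R : realType) (n : nat) (P Q : set 'rV[R]_n) :
    Prop :=
  exists (A : 'M[int]_n) (b : 'rV[int]_n),
    A \in unitmx /\
    Q = (fun x => x *m map_mx intr A + map_mx intr b) @` P.

(* D_{I,K}(x): rows I and columns K, listed increasingly and numbered from 1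
   as in the usual matrix notation (used with |I| = |K|). *)
Definition minor (S : comNzRingType) (x : 'M[S]_4) (I K : seq nat) : S :=
  \det (\matrix_(r < size I, c < size I)
          x (inord (nth 0%N I r).-1) (inord (nth 0%N K c).-1)).

Section FlagVariety.
Variable R : realType.

(* C(U^-): rational functions in the 6 entries below the diagonal. *)
Definition function_field : fieldType := {fraction mpoly 6 R[i]}.

Definition scalarK (c : R[i]) : function_field := tofrac (mpolyC 6 c).

(* The generic element of U^-.  The entry (i, j) with j < i (numbered from 0)
   is the variable of index i(i-1)/2 + j. *)
Definition generic_unipotent : 'M[function_field]_4 :=
  \matrix_(i < 4, j < 4)
    if (j < i)%N then tofrac (mpolyX R[i] (mnm1 (inord ('C(i, 2) + j) : 'I_6)))
    else (i == j)%:R.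

(* A regular function on G = SL_4(C) is given by a polynomial in the 16 matrix
   entries; it is evaluated at complex matrices, or at the generic element of
   U^- to obtain its restriction to U^-. *)
Definition evalG (F : mpoly (4 * 4) R[i]) (g : 'M[R[i]]_4) : R[i] :=
  meval (fun l => mxvec g 0 l) F.

Definition restrictU (F : mpoly (4 * 4) R[i]) : function_field :=
  mmap scalarK (fun l => mxvec generic_unipotent 0 l) F.

Definition borel (b : 'M[R[i]]_4) : Prop :=
  \det b = 1 /\ forall i j : 'I_4, (j < i)%N -> b i j = 0.

Definition fundamental_weight (i : nat) (b : 'M[R[i]]_4) : R[i] :=
  \prod_(j < 4 | (j < i)%N) b j j.

(* lambda = 2 varpi_1 + 2 varpi_2 + 2 varpi_3, as a character of B. *)
Definition lambda (b : 'M[R[i]]_4) : R[i] :=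
  \prod_(1 <= i < 4) fundamental_weight i b ^+ 2.

(* F represents an element of H^0(G/B, L_lambda^k). *)
Definition is_section (k : nat) (F : mpoly (4 * 4) R[i]) : Prop :=
  forall g b : 'M[R[i]]_4, \det g = 1 -> borel b ->
    evalG F (g *m b) = lambda b ^+ k * evalG F g.

Definition nonzero_on_G (F : mpoly (4 * 4) R[i]) : Prop :=
  exists2 g : 'M[R[i]]_4, \det g = 1 & evalG F g != 0.

Definition tau_lambda : function_field :=
  \prod_(1 <= i < 4) minor generic_unipotent (iota 1 i) (iota 1 i) ^+ 2.

(* A valuation on C(G/B) \ {0} is given by its graph: [v f a] means v(f) = a. *)
Definition Newton_Okounkov_body
    (v : function_field -> 'rV[int]_6 -> Prop) : set 'rV[R]_6 :=
  closure [set x : 'rV[R]_6 | exists (k : nat) (F : mpoly (4 * 4) R[i]) (a : 'rV[int]_6),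
    [/\ (0 < k)%N, is_section k F, nonzero_on_G F,
        v (restrictU F / tau_lambda ^+ k) a
      & x = k%:R^-1 *: map_mx (intr : int -> R) a]].

(* J = 'I_6 and J_uf = 'I_3, the latter embedded as the first three indices. *)
Definition uf (k : 'I_3) : 'I_6 := lshift 3 k.

(* The algebraic independence of the cluster variables and the
   skew-symmetrizability of the exchange matrix are not recorded: they hold
   for the initial seed and are preserved by mutation. *)
Record seed := Seed {
  cluster : {ffun 'I_6 -> function_field};
  exchange : 'M[int]_(3, 6)
}.

Definition mutate_exchange (k : 'I_3) (e : 'M[int]_(3, 6)) : 'M[int]_(3, 6) :=
  \matrix_(i < 3, j < 6)
    if (i == k) || (j == uf k) then - e i j
    else e i j + sgz (e i (uf k)) * Num.max (e i (uf k) * e k j) 0.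

Definition mutate (k : 'I_3) (s : seed) : seed :=
  let A := cluster s in let e := exchange s in
  Seed
    [ffun i => if i == uf k then
       (A (uf k))^-1 * (\prod_j A j ^ Num.max (e k j) 0
                        + \prod_j A j ^ Num.max (- e k j) 0)
     else A i]
    (mutate_exchange k e).

Definition seed_equiv (s s' : seed) : Prop :=
  exists sigma : {perm 'I_6},
    [/\ forall j : 'I_6, (3 <= j)%N -> sigma j = j,
        forall j, cluster s' (sigma j) = cluster s j
      & forall (i i' : 'I_3) (j : 'I_6), uf i' = sigma (uf i) ->
          exchange s' i' (sigma j) = exchange s i j].

Definition initial_cluster : seq function_field :=
  let D := minor generic_unipotent in
  [:: D [:: 2] [:: 1]; D [:: 2; 3] [:: 1; 2]; D [:: 3] [:: 1];
      D [:: 2; 3; 4] [:: 1; 2; 3]; D [:: 3; 4] [:: 1; 2]; D [:: 4] [:: 1]]%N.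

Definition initial_exchange : seq (seq int) :=
  [:: [:: 0; -1; 1; 0; 0; 0];
      [:: 1; 0; -1; -1; 1; 0];
      [:: -1; 1; 0; 0; -1; 1]].

Definition initial_seed : seed :=
  Seed [ffun j : 'I_6 => initial_cluster`_j]
       (\matrix_(i < 3, j < 6) (nth [::] initial_exchange i)`_j).

Inductive reachable : seed -> Prop :=
| reachable_initial : reachable initial_seed
| reachable_mutate k s : reachable s -> reachable (mutate k s).

(* The vertices of the exchange graph: equivalence classes of seeds. *)
Definition vertex : Type :=
  {X : set seed | exists2 s, reachable s &
                    X = [set s' | reachable s' /\ seed_equiv s s']}.

Definition seed_of (X : vertex) (s : seed) : Prop := sval X s.

Definition adjacent (X Y : vertex) : Prop :=
  exists s k, seed_of X s /\ seed_of Y (mutate k s).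

Definition graph_automorphism (phi : vertex -> vertex) : Prop :=
  bijective phi /\ forall X Y, adjacent (phi X) (phi Y) <-> adjacent X Y.

Definition graph_involution (phi : vertex -> vertex) : Prop :=
  [/\ graph_automorphism phi, involutive phi & phi <> id].

Definition dominance_le (e : 'M[int]_(3, 6)) (a a' : 'rV[int]_6) : Prop :=
  exists u : 'rV[int]_3, (forall i, 0 <= u 0 i) /\ a = a' + u *m e.

(* Total orders on Z^6 compatible with addition and refining the opposite of
   the order [dominance_le]. *)
Definition refining_order (e : 'M[int]_(3, 6)) (le : rel 'rV[int]_6) : Prop :=
  [/\ [/\ reflexive le, antisymmetric le, transitive le & total le],
      forall a a' c, le a a' -> le (a + c) (a' + c)
    & forall a a', dominance_le e a a' -> le a' a].

Definition exponent (m : multinom 6) : 'rV[int]_6 := \row_j (m j)%:Z.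

Definition lowest_exponent (le : rel 'rV[int]_6) (P : mpoly 6 R[i])
    (a : 'rV[int]_6) : Prop :=
  (exists2 m, m \in msupp P & a = exponent m) /\
  (forall m, m \in msupp P -> le a (exponent m)).

(* The graph of v_s: f = P(A) / Q(A) with P and Q nonzero polynomials in the
   cluster variables, and v_s(f) is the difference of the lowest exponents of
   P and Q. *)
Definition seed_valuation (le : rel 'rV[int]_6) (s : seed)
    (f : function_field) (a : 'rV[int]_6) : Prop :=
  exists (P Q : mpoly 6 R[i]) (p q : 'rV[int]_6),
    [/\ P != 0 /\ Q != 0,
        f = mmap scalarK (cluster s) P / mmap scalarK (cluster s) Q,
        lowest_exponent le P p, lowest_exponent le Q q & a = p - q].

(* The total order defining v_s is chosen seed by seed. *)
Definition Delta (ord : seed -> rel 'rV[int]_6) (s : seed) : set 'rV[R]_6 :=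
  Newton_Okounkov_body (seed_valuation (ord s) s).

Definition preserves_Delta (ord : seed -> rel 'rV[int]_6)
    (phi : vertex -> vertex) : Prop :=
  forall (X : vertex) (s s' : seed), seed_of X s -> seed_of (phi X) s' ->
    unimodular_equiv (Delta ord s) (Delta ord s').

End FlagVariety.

(* The group of bijections of T generated by f and g. *)
Inductive generated (T : Type) (f g : T -> T) : (T -> T) -> Prop :=
| generated_id : generated f g id
| generated_l : generated f g f
| generated_r : generated f g g
| generated_comp h h' :
    generated f g h -> generated f g h' -> generated f g (h \o h')
| generated_inv h h' :
    generated f g h -> cancel h h' -> cancel h' h -> generated f g h'.

(* The group generated by f and g, with composition as product, is isomorphic
   to Z/2 x Z/2. *)
Definition generates_Klein_four (T : Type) (f g : T -> T) : Prop :=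
  exists theta : 'Z_2 * 'Z_2 -> (T -> T),
    [/\ injective theta,
        forall a b, theta (a + b) = theta a \o theta b
      & forall h, generated f g h <-> exists a, h = theta a].

(* Main.v *)
From HB Require Import structures.
From mathcomp Require Import all_boot all_order all_algebra perm.
From mathcomp Require Import complex.
From mathcomp Require Import -(notations) mpoly.
From mathcomp Require Import boolp classical_sets reals topology.
From mathcomp Require Import ring lra zify.
Require Import Defs.

Set Implicit Arguments.
Unset Strict Implicit.
Unset Printing Implicit Defensive.

Import Order.TTheory GRing.Theory Num.Theory.

Local Open Scope ring_scope.

(* Assign to D_I the degree e_|I|.  A section of L_lambda^k restricts to U^- as
   a combination of cluster monomials of degree (2k, 2k, 2k): its highest
   exponent satisfies the Gelfand-Tsetlin inequalities, by the behaviour of the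
   section along the three simple root directions, and every exponent that
   satisfies them is the highest exponent of such a monomial.  The g-vectors of
   these monomials at a seed s are pairwise different, hence they are the values
   of v_s on the sections.  As a cluster monomial of degree (2k, 2k, 2k) is a
   product of 2k cluster monomials of degree (1, 1, 1), of which there are 64,
   Delta_s is the closure of the set of the sums of 2k of the 64 g-vectors,
   divided by k.

   The required equivalences are affine maps that permute the 64 g-vectors.
   Conversely, for the cluster {D_23, D_24, D_14} the only integral functionals
   of width at most 2 on Delta_s are the three frozen coordinates up to sign,
   and one of the eight faces on which these are extremal is a point; this
   happens for no other cluster but the image of this one under an involution.
   A symmetry that preserves the equivalence classes thus permutes these two
   clusters, and only four automorphisms of the exchange graph do. *)

(** Two things have to be brought down to finite data. The total order behind v_s is arbitrary; but
    at every seed one of the two monomials of each exchange relation dominates the other, so all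
    refining orders give a variable the same value, its g-vector. The sections for all k are
    infinitely many; here lambda = 2 rho, and 64 = 2^6 is the dimension of the representation of
    highest weight rho. No dimension formula is used: leading terms are subtracted one after the
    other, which only requires a bound on leading exponents and one monomial for each admissible
    exponent. The bound comes from the root subgroups of SL_2 type: along each of them a section is
    a polynomial of degree at most 2k, the pairing of k lambda with the simple coroot. Equivalences
    and obstructions are then checked on 64 points. The graph is that of the triangulations of a
    hexagon, with the dihedral symmetry group of order 12; the two involutions found are a half-turn
    and a reflection in an axis through opposite vertices. *)

(** * Labelled seeds *)

(* The numbers 0, ..., 8 stand for the cluster variables D_2, D_23, D_3, D_13,
   X = D_3 D_124 - D_4 D_123, D_24, D_134, D_14, D_124, where D_I = D_{I,[|I|]};
   9, 10, 11 for the frozen variables D_234, D_34, D_4; and 12, 13, 14 for D_1,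
   D_12, D_123, which are equal to 1 on U^-.  The entry (x, y, m, m') is the
   relation x y = prod m + prod m'. *)
Definition exchange_relations : seq (nat * nat * seq nat * seq nat) := [::
  (0, 3, [:: 2; 13], [:: 1; 12]); (0, 6, [:: 9; 12], [:: 4]);
  (0, 7, [:: 11; 13], [:: 5; 12]); (1, 4, [:: 2; 9; 13], [:: 0; 10; 14]);
  (1, 6, [:: 10; 14], [:: 3; 9]); (1, 8, [:: 9; 13], [:: 5; 14]);
  (2, 5, [:: 1; 11], [:: 0; 10]); (2, 7, [:: 10; 12], [:: 3; 11]);
  (2, 8, [:: 11; 14], [:: 4]); (3, 4, [:: 10; 12; 14], [:: 2; 6; 13]);
  (3, 5, [:: 10; 13], [:: 1; 7]); (3, 8, [:: 7; 14], [:: 6; 13]);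
  (4, 5, [:: 9; 11; 13], [:: 0; 8; 10]); (4, 7, [:: 8; 10; 12], [:: 6; 11; 13]);
  (5, 6, [:: 8; 10], [:: 7; 9])]%N.

(** The variables 0 to 8 correspond to the nine diagonals of a hexagon. Two crossing diagonals are
    those of a quadrilateral, so every incompatible pair is an exchange pair, and the fifteen
    relations list all of them. *)
Definition incompatible (x y : nat) : bool :=
  has (fun r => (r.1.1.1 == x) && (r.1.1.2 == y)
             || (r.1.1.1 == y) && (r.1.1.2 == x)) exchange_relations.

(* A labelled seed: the numbers of its six variables, its exchange matrix, and
   the g-vectors at this seed of the variables 0, ..., 11. *)
Definition state : Type := (seq nat * seq (seq int) * seq (seq int))%type.

Definition label (s : state) (j : nat) : nat := nth 0%N s.1.1 j.
Definition entry (M : seq (seq int)) (i j : nat) : int := nth 0 (nth [::] M i) j.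
Definition eps (s : state) : nat -> nat -> int := entry s.1.2.
(** The variables 12 to 14 have no row: reading past the end gives zero, the right value for
    functions equal to 1 on U^-. *)
Definition gvec (s : state) : nat -> nat -> int := entry s.2.

(** [posz] and [signz] are forms of [Num.max n 0] and [sgz n] suited to evaluation; see [poszE] and
    [signzE]. *)
Definition posz (n : int) : int := if n is Posz _ then n else 0.
Definition signz (n : int) : int :=
  match n with Posz 0 => 0 | Posz _ => 1 | Negz _ => -1 end.

(** In a triangulation of a hexagon exactly one diagonal crosses the k-th one and neither of the
    other two. *)
Definition flip (s : state) (k : nat) : nat :=
  head 0%N [seq y <- iota 0 9 | incompatible (label s k) y &&
    all (fun i => (i == k) || ~~ incompatible (label s i) y) (iota 0 3)].

Definition mutate_eps (k : nat) (e : nat -> nat -> int) : seq (seq int) :=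
  mkseq (fun i => mkseq (fun j =>
    if (i == k) || (j == k) then - e i j
    else e i j + signz (e i k) * posz (e i k * e k j)) 6) 3.

(* The piecewise linear map mu_k^T of Fujita and Oya. *)
Definition trop (k : nat) (e : nat -> nat -> int) (g : nat -> int) (j : nat) : int :=
  if j == k then - g k else g j + posz (- e k j) * g k + e k j * posz (g k).

Definition mut (s : state) (k : nat) : state :=
  (set_nth 0%N s.1.1 k (flip s k), mutate_eps k (eps s),
   [seq mkseq (trop k (eps s) (nth 0 g)) 6 | g <- s.2]).

Definition initial_state : state :=
  ([:: 0; 1; 2; 9; 10; 11]%N, initial_exchange,
   [:: [:: 1; 0; 0; 0; 0; 0]; [:: 0; 1; 0; 0; 0; 0]; [:: 0; 0; 1; 0; 0; 0];
       [:: -1; 1; 0; 0; 0; 0]; [:: 0; -1; 1; 1; 0; 0]; [:: 1; 0; -1; 0; 1; 0];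
       [:: -1; 0; 0; 1; 0; 0]; [:: 0; 0; -1; 0; 1; 0]; [:: 0; -1; 0; 1; 0; 0];
       [:: 0; 0; 0; 1; 0; 0]; [:: 0; 0; 0; 0; 1; 0]; [:: 0; 0; 0; 0; 0; 1]]).

Fixpoint search (n : nat) (seen front : seq state) : seq state :=
  if n is n'.+1 then
    let new := undup [seq t <- flatten [seq [seq mut s k | k <- iota 0 3] | s <- front]
                     | t \notin seen] in
    search n' (seen ++ new) new
  else seen.

(** Only finitely many labelled triangulations exist, and [states_closed] confirms that nine rounds
    of the search exhaust them. The list is stored in evaluated form, so that later checks do not
    repeat the search. *)
Definition states : seq state :=
  Eval vm_compute in search 9 [:: initial_state] [:: initial_state].

Lemma statesE : states = search 9 [:: initial_state] [:: initial_state].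
Proof. by vm_compute. Qed.

Lemma states_closed :
  all (fun s => all (fun k => mut s k \in states) (iota 0 3)) states.
Proof. by vm_compute. Qed.

Lemma initial_in_states : initial_state \in states.
Proof. by vm_compute. Qed.

Opaque states.

Lemma mut_in_states st k : st \in states -> (k < 3)%N -> mut st k \in states.
Proof.
by move=> /(allP states_closed) /allP h hk; apply: h; rewrite mem_iota.
Qed.

Lemma all_iota (n : nat) (P : pred nat) : reflect (forall i, (i < n)%N -> P i) (all P (iota 0 n)).
Proof.
by apply: (iffP allP) => h i; [move=> hi; apply: h|rewrite mem_iota; apply: h]; rewrite ?mem_iota.
Qed.

(** Closure under mutation alone gives no induction principle; the search does, since it reaches
    each entry by mutations from the initial state. *)
Lemma states_ind (P : state -> Prop) :
  P initial_state -> (forall st k, st \in states -> (k < 3)%N -> P st -> P (mut st k)) ->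
  forall st, st \in states -> P st.
Proof.
move=> P0 Pm.
have search_ind n (seen front : seq state) :
    (forall t, t \in seen ++ front -> t \in states /\ P t) ->
    forall t, t \in search n seen front -> t \in states /\ P t.
  elim: n seen front => [|n IH] seen front h /= t.
    by move=> ht; apply: h; rewrite mem_cat ht.
  apply: IH => {}t; rewrite !mem_cat -orbA orbb => /orP [ht|].
    by apply: h; rewrite mem_cat ht.
  rewrite mem_undup mem_filter => /andP [_ /flattenP [l /mapP [s hs ->] ht]].
  have [k hk ->] : exists2 k, (k < 3)%N & t = mut s k.
    by move: ht; rewrite !inE => /or3P [] /eqP ->; [exists 0%N|exists 1%N|exists 2%N].
  have [hs' rs] : s \in states /\ P s by apply: h; rewrite mem_cat hs orbT.
  by split; [exact: mut_in_states|exact: Pm].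
move=> st; rewrite {1}statesE => /search_ind h; case: h => // t.
by rewrite mem_cat mem_seq1 orbb => /eqP ->; split; first exact: initial_in_states.
Qed.

Definition weight (s : state) (m : seq nat) (j : nat) : int :=
  foldr (fun x a => gvec s x j + a) 0 m.

Definition shift (s : state) (u : seq nat) (j : nat) : int :=
  foldr (fun i a => eps s i j + a) 0 u.

(* The monomial m' dominates m: its g-vector differs from that of m by a sum of
   rows of the exchange matrix, so that m has the lowest value. *)
Definition relation_oriented (s : state) (x y : nat) (m m' : seq nat) : bool :=
  [&& all (fun j => gvec s x j + gvec s y j == weight s m j) (iota 0 6),
      ~~ all (fun j => weight s m j == weight s m' j) (iota 0 6)
    & has (fun u => all (fun j => weight s m' j == weight s m j + shift s u j) (iota 0 6))
        [:: [:: 0]; [:: 1]; [:: 2]; [:: 0; 1]; [:: 0; 2]; [:: 1; 2]; [:: 0; 1; 2]]%N].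

Definition relation_valued (s : state) (r : nat * nat * seq nat * seq nat) : bool :=
  let: (x, y, m, m') := r in
  relation_oriented s x y m m' || relation_oriented s x y m' m.

Lemma states_relation_valued :
  all (fun s => all (relation_valued s) exchange_relations) states.
Proof. by vm_compute. Qed.

(* The variables whose value follows from those of the known ones through an
   exchange relation. *)
Definition determined (s : state) (known : seq nat) : seq nat :=
  known ++ flatten [seq (let: (x, y, m, m') := r in
    if all (fun z => (z \in known) || (12 <= z)%N) (m ++ m') then
      if x \in known then [:: y] else if y \in known then [:: x] else [::]
    else [::]) | r <- exchange_relations].

Definition all_determined (s : state) : bool :=
  all (fun x => x \in iter 3 (determined s) s.1.1) (iota 0 12).

Lemma states_determined : all all_determined states.
Proof. by vm_compute. Qed.

Definition labels_ok (s : state) : bool :=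
  [&& uniq s.1.1, size s.1.1 == 6,
      all (fun j => (label s j < 9)%N) (iota 0 3),
      all (fun j => label s j == (j + 6)%N) (iota 3 3)
    & all (fun i => all (fun j => gvec s (label s i) j == (i == j)%:Z) (iota 0 6)) (iota 0 6)].

Lemma states_labels : all labels_ok states.
Proof. by vm_compute. Qed.

Definition sign_coherent (s : state) : bool :=
  all (fun x => all (fun y => incompatible x y ||
    all (fun i => 0 <= gvec s x i * gvec s y i) (iota 0 3)) (iota 0 12)) (iota 0 12).

Lemma states_sign_coherent : all sign_coherent states.
Proof. by vm_compute. Qed.

Definition negative_outside (s : state) : bool :=
  all (fun x => (x \in s.1.1) || has (fun i => gvec s x i < 0) (iota 0 3)) (iota 0 9).

Lemma states_negative_outside : all negative_outside states.
Proof. by vm_compute. Qed.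

Definition eps_pos s k := [seq label s j | j <- iota 0 6 & eps s k j == 1].
Definition eps_neg s k := [seq label s j | j <- iota 0 6 & eps s k j == -1].

(** Compares the listed relations with the exchange matrix. The variables 12 to 14 are dropped
    because they are 1 on U^-, and either monomial may belong to the positive entries. *)
Definition exchange_ok (s : state) (k : nat) : bool :=
  [&& all (fun j => eps s k j \in [:: -1; 0; 1]) (iota 0 6), eps s k k == 0
    & has (fun r => let: (x, y, m, m') := r in
        if (x == label s k) && (y == flip s k) || (y == label s k) && (x == flip s k)
        then let m1 := [seq z <- m | (z < 12)%N] in
             let m2 := [seq z <- m' | (z < 12)%N] in
             if perm_eq (eps_pos s k) m1 then perm_eq (eps_neg s k) m2
             else perm_eq (eps_pos s k) m2 && perm_eq (eps_neg s k) m1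
        else false)
      exchange_relations].

Lemma states_exchange_ok : all (fun s => all (exchange_ok s) (iota 0 3)) states.
Proof. by vm_compute. Qed.

(** * Valuations *)

Section Lowest.
Variables (R : realType) (le : rel 'rV[int]_6).
Hypotheses (le_refl : reflexive le) (le_anti : antisymmetric le)
  (le_trans : transitive le) (le_total : total le)
  (le_add : forall a b c, le a b -> le (a + c) (b + c)).
Local Notation MP := (mpoly 6 R[i]).
Local Notation lowest := (@lowest_exponent R le).

Lemma exponentD (m m' : multinom 6) : exponent (mnm_add m m') = exponent m + exponent m'.
Proof. by apply/rowP => j; rewrite !mxE mnmDE PoszD. Qed.

Lemma exponent_inj : injective (@exponent).
Proof. by move=> m m' /rowP e; apply/mnmP => j; have := e j; rewrite !mxE => -[]. Qed.

Lemma le_add2 a b c d : le a b -> le c d -> le (a + c) (b + d).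
Proof.
move=> ab cd; apply: (le_trans (le_add c ab)).
by rewrite ![b + _]addrC; apply: le_add.
Qed.

(** This is why the lowest term of a product arises from a single pair of terms and cannot
    cancel. *)
Lemma le_add2_anti a b c d : le a b -> le c d -> a + c = b + d -> a = b /\ c = d.
Proof.
move=> ab cd e; have ba : a = b.
  apply: le_anti; rewrite ab /=; have := le_add (- c) (le_add b cd).
  by rewrite [d + b]addrC -e addrK [c + b]addrC addrK.
by split => //; apply: (addrI a); rewrite e ba.
Qed.

Lemma lowest_coef (P : MP) a : lowest P a ->
  exists m, [/\ a = exponent m, mcoeff m P != 0 &
    forall m', mcoeff m' P != 0 -> le a (exponent m')].
Proof.
case=> -[m mP ->] h; exists m; split=> //; first by rewrite -mcoeff_msupp.
by move=> m'; rewrite -mcoeff_msupp => /h.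
Qed.

Lemma lowest_uniq (P : MP) a b : lowest P a -> lowest P b -> a = b.
Proof.
case=> -[m mP ->] h [[m' mP' ->] h'].
by apply: le_anti; rewrite h ?h'.
Qed.

Lemma lowest_exists (P : MP) : P != 0 -> exists a, lowest P a.
Proof.
rewrite -msupp_eq0 /lowest_exponent; elim: (msupp P) => // m s IH _.
case: (eqVneq s [::]) => [->|/IH [a [[m1 m1s ->] h]]].
  exists (exponent m); split; first by exists m; rewrite ?inE.
  by move=> m'; rewrite inE => /eqP ->.
case: (orP (le_total (exponent m) (exponent m1))) => l.
  exists (exponent m); split; first by exists m; rewrite ?inE ?eqxx.
  move=> m'; rewrite inE => /orP [/eqP -> //|/h]; exact: le_trans.
exists (exponent m1); split; first by exists m1; rewrite ?inE ?m1s ?orbT.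
by move=> m'; rewrite inE => /orP [/eqP -> //|/h].
Qed.

Lemma lowest_mul (P Q : MP) a b : lowest P a -> lowest Q b -> lowest (P * Q) (a + b).
Proof.
move=> /lowest_coef [m [-> mP hP]] /lowest_coef [n [-> nQ hQ]].
have c : mcoeff (mnm_add m n) (P * Q) != 0.
  have -> : mcoeff (mnm_add m n) (P * Q) = mcoeff m P * mcoeff n Q; last by rewrite mulf_neq0.
  rewrite mpolyME big_allpairs raddf_sum /= (bigD1_seq m) ?msupp_uniq ?mcoeff_msupp //=.
  rewrite raddf_sum /= (bigD1_seq n) ?msupp_uniq ?mcoeff_msupp //=.
  rewrite mcoeffZ mcoeffX eqxx mulr1 big1_seq; last first.
    move=> n' /andP [ne n'Q]; rewrite mcoeffZ mcoeffX.
    case: eqP => [e|]; last by rewrite mulr0.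
    have e' : n' = n by apply: exponent_inj; apply: (addrI (exponent m)); rewrite -!exponentD e.
    by rewrite e' eqxx in ne.
  rewrite addr0 big1_seq ?addr0 // => m' /andP [ne m'P]; rewrite raddf_sum big1_seq //= => n' n'Q.
  rewrite mcoeffZ mcoeffX; case: eqP => [e|]; last by rewrite mulr0.
  have [|||e' _] := @le_add2_anti (exponent m) (exponent m') (exponent n) (exponent n').
  - by apply: hP; rewrite -mcoeff_msupp.
  - by apply: hQ; rewrite -mcoeff_msupp.
  - by rewrite -!exponentD e.
  by move: ne; rewrite (exponent_inj e') eqxx.
split; first by exists (mnm_add m n); rewrite ?exponentD ?mcoeff_msupp.
move=> k /msuppM_le /allpairsP [[m' n'] /= [m'P n'Q ->]].
by rewrite exponentD; apply: le_add2; [apply: hP|apply: hQ]; rewrite -mcoeff_msupp.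
Qed.

Lemma lowest_add (P Q : MP) a b :
  lowest P a -> lowest Q b -> le a b -> a <> b -> lowest (P + Q) a.
Proof.
move=> /lowest_coef [m [-> mP hP]] /lowest_coef [n [-> nQ hQ]] ab nab.
split.
  exists m => //; rewrite mcoeff_msupp mcoeffD.
  suff -> : mcoeff m Q = 0 by rewrite addr0.
  apply/eqP/negbNE/negP => /hQ h; apply: nab; apply: le_anti.
  by rewrite ab h.
move=> k /msuppD_le; rewrite mem_cat !mcoeff_msupp => /orP [/hP //|/hQ].
exact: le_trans.
Qed.

End Lowest.

Section ScalarK.
Variable R : realType.

Lemma scalarK_is_additive : additive (@scalarK R).
Proof. by move=> a b; rewrite /scalarK mpolyCB rmorphB. Qed.

Lemma scalarK_is_multiplicative : multiplicative (@scalarK R).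
Proof.
split=> [a b|]; last by rewrite /scalarK mpolyC1 rmorph1.
by rewrite /scalarK mpolyCM rmorphM.
Qed.

HB.instance Definition _ :=
  GRing.isAdditive.Build R[i] (function_field R) (@scalarK R) scalarK_is_additive.
HB.instance Definition _ :=
  GRing.isMultiplicative.Build R[i] (function_field R) (@scalarK R)
    scalarK_is_multiplicative.
End ScalarK.

Definition algebraically_free (R : realType) (A : 'I_6 -> function_field R) : Prop :=
  forall P : mpoly 6 R[i], P != 0 -> mmap (@scalarK R) A P != 0.

Lemma cross_multiply (F : fieldType) (p q p' q' : F) :
  q != 0 -> q' != 0 -> p / q = p' / q' -> p * q' = p' * q.
Proof. by move=> q0 q0' e; apply/eqP; rewrite -eqr_div // e. Qed.

Section Valuation.
Variables (R : realType) (le : rel 'rV[int]_6) (s : seed R).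
Hypotheses (hle : refining_order (exchange s) le)
  (hfree : algebraically_free (cluster s)).
Local Notation V := (seed_valuation le s).
Local Notation ev := (mmap (@scalarK R) (cluster s)).

Let le_refl : reflexive le. Proof. by case: hle => -[]. Qed.
Let le_anti : antisymmetric le. Proof. by case: hle => -[]. Qed.
Let le_trans : transitive le. Proof. by case: hle => -[]. Qed.
Let le_total : total le. Proof. by case: hle => -[]. Qed.
Let le_add a b c : le a b -> le (a + c) (b + c).
Proof. by case: hle => _ h _; apply: h. Qed.

Lemma val_neq0 f a : V f a -> f != 0.
Proof.
move=> [P [Q [p [q [[P0 Q0] -> _ _ _]]]]].
by rewrite mulf_neq0 ?invr_eq0 ?hfree.
Qed.

(** A function has many representations as P(A) / Q(A). Algebraic independence turns equality of two
    of them into the polynomial identity P Q' = P' Q, whose lowest exponents can be compared. *)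
Lemma val_uniq f a b : V f a -> V f b -> a = b.
Proof.
move=> [P [Q [p [q [[P0 Q0] -> hP hQ ->]]]]] [P' [Q' [p' [q' [[P0' Q0'] e hP' hQ' ->]]]]].
have e' : P * Q' = P' * Q.
  apply/eqP; rewrite -subr_eq0; apply/negP => /negP /hfree /negP; apply.
  rewrite rmorphB !rmorphM /= subr_eq0; apply/eqP.
  exact: (cross_multiply (hfree Q0) (hfree Q0') e).
have h1 : lowest_exponent le (P * Q') (p + q') by exact: lowest_mul.
have h2 : lowest_exponent le (P * Q') (p' + q) by rewrite e'; exact: lowest_mul.
have e2 := lowest_uniq le_anti h1 h2.
by apply: (addIr q); rewrite subrK addrAC -e2 addrK.
Qed.

Lemma val_mul f g a b : V f a -> V g b -> V (f * g) (a + b).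
Proof.
move=> [P [Q [p [q [[P0 Q0] -> hP hQ ->]]]]] [P' [Q' [p' [q' [[P0' Q0'] -> hP' hQ' ->]]]]].
exists (P * P'), (Q * Q'), (p + p'), (q + q'); split.
- by rewrite !mulf_neq0.
- by rewrite !rmorphM /= mulf_div.
- exact: lowest_mul.
- exact: lowest_mul.
- by rewrite opprD addrACA.
Qed.

Lemma val_inv f a : V f a -> V f^-1 (- a).
Proof.
move=> [P [Q [p [q [[P0 Q0] -> hP hQ ->]]]]].
by exists Q, P, q, p; split; rewrite ?invf_div ?opprB.
Qed.

Lemma val_add f g a b : V f a -> V g b -> le a b -> a <> b -> V (f + g) a.
Proof.
move=> [P [Q [p [q [[P0 Q0] -> hP hQ ->]]]]] [P' [Q' [p' [q' [[P0' Q0'] -> hP' hQ' ->]]]]].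
move=> l ne.
have low : lowest_exponent le (P * Q' + P' * Q) (p + q').
  apply: (@lowest_add _ _ le_anti le_trans _ _ _ (p' + q)); try exact: lowest_mul.
    have := le_add (q + q') l; rewrite addrA subrK.
    by rewrite [q + q']addrC addrA subrK.
  move=> e; apply: ne; apply: (addIr q); rewrite subrK addrAC -e.
  by rewrite addrK.
exists (P * Q' + P' * Q), (Q * Q'), (p + q'), (q + q'); split.
- rewrite mulf_neq0 //; split=> //; apply/eqP => z; case: low => -[m].
  by rewrite z mcoeff_msupp mcoeff0 eqxx.
- rewrite rmorphD !rmorphM /= addf_div ?hfree //.
- exact: low.
- exact: lowest_mul.
- by rewrite [q + q']addrC addrKA.
Qed.

Lemma val_poly P a : P != 0 -> lowest_exponent le P a -> V (ev P) a.
Proof.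
move=> P0 hP; exists P, 1, a, 0; split=> //; rewrite ?oner_neq0 ?rmorph1 ?divr1 ?subr0 //.
have e0 : exponent (@mnm0 6) = 0 by apply/rowP => j; rewrite !mxE mnm0E.
split=> [|m]; rewrite msupp1; first by exists (@mnm0 6); rewrite ?inE ?e0.
by rewrite inE => /eqP ->; rewrite e0.
Qed.
End Valuation.

(** * Cluster variables on the unipotent group *)

Section Variables.
Variable R : realType.
Local Notation MP := (mpoly 6 R[i]).

Definition ucoord (n : nat) : MP := mpolyX R[i] (mnm1 (inord n : 'I_6)).

Definition varP (n : nat) : MP :=
  match n with
  | 0 => ucoord 0
  | 1 => ucoord 0 * ucoord 2 - ucoord 1
  | 2 => ucoord 1
  | 3 => ucoord 2
  | 4 => ucoord 1 * ucoord 5 - ucoord 3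
  | 5 => ucoord 0 * ucoord 4 - ucoord 3
  | 6 => ucoord 2 * ucoord 5 - ucoord 4
  | 7 => ucoord 4
  | 8 => ucoord 5
  | 9 => ucoord 0 * (ucoord 2 * ucoord 5 - ucoord 4) - (ucoord 1 * ucoord 5 - ucoord 3)
  | 10 => ucoord 1 * ucoord 4 - ucoord 2 * ucoord 3
  | 11 => ucoord 3
  | _ => 1
  end.

Definition var (n : nat) : function_field R := tofrac (varP n).

Lemma varP_relation r : r \in exchange_relations ->
  varP r.1.1.1 * varP r.1.1.2 =
    \prod_(z <- r.1.2) varP z + \prod_(z <- r.2) varP z.
Proof.
rewrite !inE; do 14? [case/orP]; move=> /eqP ->; rewrite /= !big_cons !big_nil /=; ring.
Qed.

Lemma var_relation r : r \in exchange_relations ->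
  var r.1.1.1 * var r.1.1.2 = \prod_(z <- r.1.2) var z + \prod_(z <- r.2) var z.
Proof.
by move/varP_relation => h; rewrite /var -!rmorph_prod -rmorphD -rmorphM /= h.
Qed.

End Variables.

Lemma base_expansion_inj (N n : nat) (m m' : 'I_n -> nat) :
  (forall i, m i < N)%N -> (forall i, m' i < N)%N ->
  (\sum_i m i * N ^ i = \sum_i m' i * N ^ i)%N -> m =1 m'.
Proof.
elim: n m m' => [|n IH] m m' hm hm'; first by move=> _ [].
have split_low k : (\sum_(i < n.+1) k i * N ^ i
    = (\sum_(i < n) k (lift ord0 i) * N ^ i) * N + k ord0)%N.
  rewrite big_ord_recl /= expn0 muln1 addnC big_distrl /=; congr addn.
  by apply: eq_bigr => i _; rewrite expnSr mulnA.
rewrite !split_low => e; have N0 : (0 < N)%N by apply: leq_trans (hm ord0).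
have e0 : m ord0 = m' ord0.
  by have := congr1 (modn^~ N) e; rewrite !modnMDl !modn_small.
have e1 := IH (fun i => m (lift ord0 i)) (fun i => m' (lift ord0 i)).
move=> i; case: (unliftP ord0 i) => [j ->|-> //].
apply: e1 => // {i j}; move: e; rewrite e0 => /addIn /eqP.
by rewrite eqn_pmul2r // => /eqP.
Qed.

(** Kronecker substitution: with N above all exponents, sending the i-th variable to t^(N^i)
    separates the monomials by uniqueness of base N expansions, which leaves a nonzero polynomial in
    t. *)
Lemma mpoly_nonvanishing (F : numFieldType) (n : nat) (P : mpoly n F) :
  P != 0 -> exists v : 'I_n -> F, meval v P != 0.
Proof.
move=> P0; pose N := msize P.
pose e (m : multinom n) := (\sum_i m i * N ^ i)%N.
have lt_exp m : m \in msupp P -> forall i, (m i < N)%N.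
  move=> /msize_mdeg_lt h i; apply: leq_ltn_trans h.
  by rewrite mdegE (bigD1 i) //= leq_addr.
have e_inj m m' : m \in msupp P -> m' \in msupp P -> e m = e m' -> m = m'.
  move=> mP m'P /base_expansion_inj h; apply/mnmP => i.
  by apply: h => j; apply: lt_exp.
pose Q : {poly F} := \sum_(m <- msupp P) mcoeff m P *: 'X^(e m).
have Q0 : Q != 0.
  have [m mP] : exists m, m \in msupp P.
    move: P0; rewrite -msupp_eq0; case: (msupp P) => // m s _.
    by exists m; rewrite inE eqxx.
  apply/eqP => /polyP /(_ (e m)); rewrite coef0 coef_sum (bigD1_seq m) //=.
  rewrite coefZ coefXn eqxx mulr1 big1_seq => [|m' /andP [ne m'P]].
    by rewrite addr0; apply/eqP; rewrite -mcoeff_msupp.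
  rewrite coefZ coefXn; case: eqP => [/e_inj h|]; last by rewrite mulr0.
  by rewrite h ?eqxx in ne.
(* In characteristic zero the integers below [size Q] are distinct, too many to be all roots. *)
have [t tQ] : exists t : F, Q.[t] != 0.
  apply: contrapT => h; pose rs : seq F := [seq k%:R | k <- iota 0 (size Q)].
  have : (size rs < size Q)%N.
    apply: max_poly_roots => //.
      apply/allP => x _; apply/negbNE/negP => /= hx; apply: h; exists x.
      exact: hx.
    by rewrite map_inj_uniq ?iota_uniq // => a b /eqP; rewrite eqr_nat => /eqP.
  by rewrite size_map size_iota ltnn.
exists (fun i => t ^+ (N ^ i)%N); apply: contra tQ => /eqP h; apply/eqP.
rewrite -h mevalE /Q horner_sum; apply: eq_bigr => m _.
rewrite hornerZ hornerXn /e; congr (_ * _).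
rewrite (big_morph (fun k => t ^+ k) (exprD t) (expr0 t)).
by apply: eq_bigr => i _; rewrite -exprM mulnC.
Qed.

(** * Algebraic independence under mutation *)

Section FreeMutation.
Variable R : realType.
Local Notation MP := (mpoly 6 R[i]).
Local Notation ev := (mmap (@scalarK R)).

Lemma mmap_meval (h : 'I_6 -> MP) (P : MP) :
  mmap (@scalarK R) (fun j => tofrac (h j)) P = tofrac (mmap (@mpolyC 6 R[i]) h P).
Proof.
rewrite /mmap rmorph_sum /=; apply: eq_bigr => m _; rewrite rmorphM /=.
by congr (_ * _); rewrite /mmap1 rmorph_prod; apply: eq_bigr => j _; rewrite rmorphXn.
Qed.

Lemma meval_mmap (h : 'I_6 -> MP) (u : 'I_6 -> R[i]) (P : MP) :
  meval u (mmap (@mpolyC 6 R[i]) h P) = meval (fun j => meval u (h j)) P.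
Proof.
rewrite [RHS]mevalE /mmap rmorph_sum /=; apply: eq_bigr => m _; rewrite rmorphM /= mevalC.
by congr (_ * _); rewrite /mmap1 rmorph_prod; apply: eq_bigr => j _; rewrite rmorphXn.
Qed.

(** P with its k-th variable x_k replaced by M / x_k, times the power of x_k of exponent [msize P],
    which suffices to clear all denominators. *)
Definition clear_denominators (k : 'I_6) (M P : MP) : MP :=
  \sum_(m <- msupp P) mcoeff m P *: (M ^+ m k
    * mpolyX _ (Multinom [tuple if j == k then 0%N else m j | j < 6])
    * mpolyX _ (mnm1 k) ^+ (msize P - m k)).

Lemma mmap_clear_denominators (S : comNzRingType) (f : {rmorphism R[i] -> S})
    (h h' : 'I_6 -> S) (k : 'I_6) (M P : MP) :
  (forall j, j != k -> h' j = h j) -> h k * h' k = mmap f h M ->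
  mmap f h (clear_denominators k M P) = h k ^+ msize P * mmap f h' P.
Proof.
move=> hh' hk; rewrite /clear_denominators rmorph_sum /= {2}/mmap big_distrr /= !big_seq.
apply: eq_bigr => m /msize_mdeg_lt /ltnW md.
have {}md : (m k <= msize P)%N.
  by apply: leq_trans md; rewrite mdegE (bigD1 k) //= leq_addr.
rewrite mmapZ !rmorphM !rmorphXn /= !mmapX mmap1U -hk /mmap1.
rewrite (bigD1 k) //= mnmE eqxx expr0 mul1r [in RHS](bigD1 k) //=.
rewrite (eq_bigr (fun j => h' j ^+ m j)) => [|j jk]; last by rewrite mnmE (negPf jk) hh'.
rewrite -{2}(subnK md) exprD exprMn.
set x := _ ^+ _; set y := _ ^+ _; set z := _ ^+ _; set w := \prod_(_ | _) _.
by ring.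
Qed.

(* P(A') = 0 would make the polynomial obtained by clearing the powers of A_k
   vanish; at a generic point b its value, at the point with k-th coordinate
   M(b) / b_k, is a nonzero multiple of P(b). *)
Lemma free_mutation (A A' : 'I_6 -> function_field R) (k : 'I_6) (M : MP) :
  M != 0 ->
  (forall v v' : 'I_6 -> R[i], (forall j, j != k -> v j = v' j) -> meval v M = meval v' M) ->
  (forall j, j != k -> A' j = A j) -> A k * A' k = ev A M ->
  algebraically_free A -> algebraically_free A'.
Proof.
move=> M0 Mk A'A Ak fA P P0; apply/eqP => z.
have [b] : exists b : 'I_6 -> R[i], meval b (P * mpolyX _ (mnm1 k) * M) != 0.
  by apply: mpoly_nonvanishing; rewrite !mulf_neq0 // -msupp_eq0 msuppX.
rewrite !mevalM mevalXU !mulf_eq0 !negb_or => /andP [/andP [Pb bk] Mb].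
pose a j := if j == k then meval b M / b k else b j.
have ab j : j != k -> b j = a j by rewrite /a => /negPf ->.
have : meval a (clear_denominators k M P) = a k ^+ msize P * meval b P.
  apply: mmap_clear_denominators => //.
  by rewrite -[RHS](Mk b) // /a eqxx divfK.
suff -> : clear_denominators k M P = 0.
  rewrite meval0 => /esym /eqP; rewrite mulf_eq0 (negPf Pb) orbF expf_eq0.
  by rewrite /a eqxx mulf_eq0 invr_eq0 (negPf Mb) (negPf bk) andbF.
apply/eqP/negbNE/negP => /fA; rewrite (mmap_clear_denominators P A'A Ak).
by rewrite z mulr0 eqxx.
Qed.
End FreeMutation.

Section Minors.
Variables (S : comNzRingType) (x : 'M[S]_4).
Local Notation X a c := (x (inord a.-1) (inord c.-1)).

Lemma minor1 a c : minor x [:: a] [:: c] = X a c.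
Proof. by rewrite /minor det_mx11 mxE. Qed.

Lemma minor2 a b c d :
  minor x [:: a; b] [:: c; d] = X a c * X b d - X a d * X b c.
Proof.
rewrite /minor (expand_det_row _ ord0) !big_ord_recl big_ord0 /cofactor !det_mx11 !mxE /=.
by ring.
Qed.

Lemma minor3 a b c d e f : minor x [:: a; b; c] [:: d; e; f] =
  X a d * (X b e * X c f - X b f * X c e) - X a e * (X b d * X c f - X b f * X c d)
  + X a f * (X b d * X c e - X b e * X c d).
Proof.
rewrite /minor; do 3! rewrite !(expand_det_row _ ord0) !big_ord_recl !big_ord0 /cofactor.
rewrite !det_mx00 !mxE /=.
by ring.
Qed.

Lemma minor234 : X 2 2 = 1 -> X 3 3 = 1 -> X 2 3 = 0 ->
  minor x [:: 2; 3; 4] [:: 1; 2; 3]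
  = X 2 1 * (X 3 2 * X 4 3 - X 4 2) - (X 3 1 * X 4 3 - X 4 1).
Proof. by move=> h2 h3 h23; rewrite minor3 h2 h3 h23; ring. Qed.
End Minors.

Section Realization.
Variable R : realType.

Lemma generic_unipotentE i j : (i < 4)%N -> (j < 4)%N ->
  generic_unipotent R (inord i) (inord j)
  = if (j < i)%N then tofrac (ucoord R ('C(i, 2) + j)) else (i == j)%:R.
Proof. by move=> hi hj; rewrite mxE -val_eqE /= !inordK. Qed.

Definition realize (st : state) : seed R :=
  Seed [ffun j : 'I_6 => var R (label st j)] (\matrix_(i < 3, j < 6) eps st i j).

Lemma initial_seedE : initial_seed R = realize initial_state.
Proof.
rewrite /initial_seed /realize;
    have -> : (\matrix_(i < 3, j < 6) (nth [::] initial_exchange i)`_j : 'M[int]_(3, 6)) = \matrix_(i,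
        j) eps initial_state i j by apply/matrixP => i j; rewrite !mxE.
congr (Seed _ _).
apply/ffunP => -[j hj]; rewrite !ffunE /=.
have [b12 b22 b32] : [/\ 'C(1, 2) = 0, 'C(2, 2) = 1 & 'C(3, 2) = 3]%N by [].
have idx : (0 + 0 = 0)%N * (1 + 0 = 1)%N * (1 + 1 = 2)%N
  * (3 + 0 = 3)%N * (3 + 1 = 4)%N * (3 + 2 = 5)%N by [].
have fracE := (rmorphB, rmorphM).
have frac9 (S T : comNzRingType) (f : {rmorphism S -> T}) a b c d e g :
  f (a * (b * c - d) - (e * c - g)) = f a * (f b * f c - f d) - (f e * f c - f g).
  by rewrite !fracE.
case: j hj => [|[|[|[|[|[|j]]]]]] hj; rewrite ?[nth _ _ _]/= ?[label _ _]/=.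
- by rewrite minor1 generic_unipotentE // b12 idx.
- by rewrite minor2 !generic_unipotentE //= b12 b22 !idx mul1r /var !fracE.
- by rewrite minor1 generic_unipotentE // b22 idx.
- by rewrite minor234 !generic_unipotentE //= b12 b22 b32 !idx /var frac9.
- by rewrite minor2 !generic_unipotentE //= b22 b32 !idx /var !fracE.
- by rewrite minor1 generic_unipotentE // b32 idx.
by [].
Qed.

(** The entries below the diagonal of the 4 x 4 Pascal matrix, at which all the variables are
    positive integers. *)
Definition totally_positive_point : 'I_6 -> R[i] :=
  fun j => nth 0 [:: 1; 1; 2; 1; 3; 3] j.

Lemma varP_totally_positive n : meval totally_positive_point (varP R n) != 0.
Proof.
have pos (k : nat) : k.+1%:R != 0 :> R[i] by rewrite pnatr_eq0.
have e j : (j < 6)%N -> meval totally_positive_point (ucoord R j) = nth 0 [:: 1; 1; 2; 1; 3; 3] j.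
  by move=> hj; rewrite mevalXU /totally_positive_point inordK.
do 12? [case: n => [|n]]; rewrite /varP ?(mevalB, mevalM, meval1) ?e //= ?oner_neq0 //.
- by rewrite (_ : 1 * 2 - 1 = 1%:R) ?pos //; ring.
- by rewrite (_ : 1 * 3 - 1 = 2%:R) ?pos //; ring.
- by rewrite (_ : 1 * 3 - 1 = 2%:R) ?pos //; ring.
- by rewrite (_ : 2 * 3 - 3 = 3%:R) ?pos //; ring.
- by rewrite (_ : 1 * (2 * 3 - 3) - (1 * 3 - 1) = 1%:R) ?pos //; ring.
- by rewrite (_ : 1 * 3 - 2 * 1 = 1%:R) ?pos //; ring.
Qed.

Lemma varP_neq0 n : varP R n != 0.
Proof.
by apply: contra (varP_totally_positive n) => /eqP ->; rewrite meval0.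
Qed.

Lemma var_neq0 n : var R n != 0.
Proof. by rewrite /var tofrac_eq0 varP_neq0. Qed.

Lemma prod_var_mutable m :
  \prod_(z <- [seq z <- m | (z < 12)%N]) var R z = \prod_(z <- m) var R z.
Proof.
rewrite big_filter big_mkcond; apply: eq_bigr => z _; case: ltnP => // h.
by rewrite /var -(subnKC h) /= rmorph1.
Qed.

Lemma poszE n : posz n = Num.max n 0.
Proof. by case: n. Qed.

Lemma signzE n : signz n = sgz n.
Proof. by case: n => [[|n]|n]. Qed.

Lemma eps_mutE st k i j : (i < 3)%N -> (j < 6)%N ->
  eps (mut st k) i j = if (i == k) || (j == k) then - eps st i j
    else eps st i j + sgz (eps st i k) * Num.max (eps st i k * eps st k j) 0.
Proof.
by move=> hi hj; rewrite /eps /entry /= !nth_mkseq // signzE poszE.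
Qed.

Lemma prod_var_pow st (e : 'I_6 -> int) :
  \prod_(j < 6) var R (label st j) ^ (if e j == 1 then 1 else 0 : int)
  = \prod_(z <- [seq label st j | j <- iota 0 6 & (e (inord j) == 1)]) var R z.
Proof.
rewrite big_map big_filter -[iota 0 6]val_enum_ord big_map big_enum_cond /=.
rewrite [RHS]big_mkcond; apply: eq_bigr => j _ /=; rewrite inord_val.
by case: ifP => _; rewrite ?expr1z ?expr0z.
Qed.

Lemma states_label st j : st \in states -> (3 <= j < 6)%N -> label st j = (j + 6)%N.
Proof.
move=> /(allP states_labels) /and5P [_ _ _ /allP h _] hj.
by apply/eqP/h; rewrite mem_iota.
Qed.

Lemma states_size st : st \in states -> size st.1.1 = 6%N.
Proof. by move=> /(allP states_labels) /and5P [_ /eqP]. Qed.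

Lemma label_mut st k j : label (mut st k) j = if j == k then flip st k else label st j.
Proof. by rewrite /label /= nth_set_nth. Qed.

Lemma exchange_product st k : st \in states -> (k < 3)%N ->
  var R (label st k) * var R (flip st k)
  = \prod_(z <- eps_pos st k) var R z + \prod_(z <- eps_neg st k) var R z.
Proof.
move=> hst hk; have /allP/(_ k) := allP states_exchange_ok _ hst.
rewrite mem_iota => /(_ hk) /and3P [_ _ /hasP [[[[x y] m] m'] hr]].
case: ifP => // hxy hm; have /= := var_relation R hr.
have -> : var R x * var R y = var R (label st k) * var R (flip st k).
  by case/orP: hxy => /andP [/eqP -> /eqP ->]; rewrite 1?mulrC.
move=> ->; rewrite -(prod_var_mutable m) -(prod_var_mutable m').
move: hm => /=; case: ifP => [h h'|_ /andP [h h']]; rewrite (perm_big _ h) (perm_big _ h') //.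
by rewrite addrC.
Qed.

(** The entries of the exchange matrix are -1, 0 or 1, so the exponents in the mutation rule are
    indicators and the two products run over [eps_pos] and [eps_neg]. *)
Lemma mutate_realize st (k : 'I_3) : st \in states ->
  mutate k (realize st) = realize (mut st k).
Proof.
move=> hst; have hk := ltn_ord k.
have /and3P [/allP small _ _] : exchange_ok st k.
  by have /allP := allP states_exchange_ok _ hst; apply; rewrite mem_iota.
have {}small (j : 'I_6) : eps st k j \in [:: -1; 0; 1] by apply: small; rewrite mem_iota ltn_ord.
rewrite /mutate /=.
have -> : mutate_exchange k (\matrix_(i, j) eps st i j) = \matrix_(i, j) eps (mut st k) i j.
  by apply/matrixP => i j; rewrite !mxE eps_mutE.
congr (Seed _ _).
apply/ffunP => j; rewrite !ffunE label_mut -(inj_eq val_inj j) /=.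
case: ifP => // _.
rewrite (eq_bigr (fun j : 'I_6 => var R (label st j) ^ (if eps st k j == 1 then 1 else 0 : int))); last first.
  by move=> i _; rewrite ffunE mxE; move: (small i); rewrite !inE => /or3P [] /eqP ->.
rewrite (eq_bigr (fun j : 'I_6 => var R (label st j) ^ (if - eps st k j == 1 then 1 else 0 : int)) (F1
    := fun j => _ ^ Num.max (- _) _)); last first.
  by move=> i _; rewrite ffunE mxE; move: (small i); rewrite !inE => /or3P [] /eqP ->.
rewrite (prod_var_pow st (fun j => eps st k j)) (prod_var_pow st (fun j => - eps st k j)).
have -> : [seq label st j | j <- iota 0 6 & eps st k (inord j : 'I_6) == 1] = eps_pos st k.
  by congr map; apply: eq_in_filter => i; rewrite mem_iota => hi; rewrite inordK.
have -> : [seq label st j | j <- iota 0 6 & - eps st k (inord j : 'I_6) == 1] = eps_neg st k.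
  by congr map; apply: eq_in_filter => i; rewrite mem_iota => hi; rewrite inordK // eqr_oppLR.
by rewrite -exchange_product // mulKf // var_neq0.
Qed.

Lemma reachable_state (s : seed R) : reachable s -> exists2 st, st \in states & s = realize st.
Proof.
elim=> [|k {}s _ [st hst ->]].
  by exists initial_state; rewrite ?initial_in_states ?initial_seedE.
by exists (mut st k); rewrite ?mutate_realize // mut_in_states.
Qed.

Lemma state_reachable st : st \in states -> reachable (realize st).
Proof.
move: st; apply: states_ind => [|st k hst hk rs].
  by rewrite -initial_seedE; exact: reachable_initial.
by rewrite -(mutate_realize (Ordinal hk)) //; exact: reachable_mutate.
Qed.

Lemma prod_label_eps (S : comNzRingType) (F : nat -> S) st k e :
  \prod_(j < 6 | eps st k j == e) F (label st j)
  = \prod_(z <- [seq label st j | j <- iota 0 6 & eps st k j == e]) F z.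
Proof.
by rewrite big_map big_filter -[iota 0 6]val_enum_ord big_map big_enum_cond.
Qed.

(** Where D_2, D_23 and D_3 do not vanish, the six initial variables can take arbitrary values: the
    equations for x32, x42 and x43 are solved one after the other. A polynomial in these variables
    that vanishes on U^- therefore vanishes at all such values. *)
Lemma free_initial : algebraically_free (cluster (realize initial_state)).
Proof.
move=> P P0.
have X0 (j : 'I_6) : mpolyX R[i] (mnm1 j) != 0 by rewrite -msupp_eq0 msuppX.
pose o n : 'I_6 := inord n.
have [a] : exists a : 'I_6 -> R[i],
    meval a (P * mpolyX _ (mnm1 (o 0%N)) * mpolyX _ (mnm1 (o 1%N)) * mpolyX _ (mnm1 (o 2%N))) != 0.
  by apply: mpoly_nonvanishing; rewrite !mulf_neq0.
rewrite !mevalM !mevalXU !mulf_eq0 !negb_or => /andP [/andP [/andP [Pa a0] a1] a2].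
pose x32 := (a (o 1%N) + a (o 2%N)) / a (o 0%N).
pose x42 := (a (o 4%N) + x32 * a (o 5%N)) / a (o 2%N).
pose x43 := (a (o 3%N) + a (o 0%N) * x42 - a (o 5%N)) / a (o 1%N).
pose u (j : 'I_6) := nth 0 [:: a (o 0%N); a (o 2%N); x32; a (o 5%N); x42; x43] j.
have e j : (j < 6)%N -> meval u (ucoord R j) = nth 0 [:: a (o 0%N); a (o 2%N); x32; a (o 5%N); x42; x43] j.
  by move=> hj; rewrite mevalXU /u inordK.
have -> : mmap (@scalarK R) (cluster (realize initial_state)) P
    = mmap (@scalarK R) (fun j : 'I_6 => tofrac (varP R (label initial_state j))) P.
  by rewrite /mmap; apply: eq_bigr => m _; congr (_ * _); apply: mmap1_eq => j; rewrite ffunE.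
rewrite mmap_meval tofrac_eq0.
apply: contra Pa => /eqP /(congr1 (meval u)); rewrite meval0 meval_mmap => <-.
apply/eqP/meval_eq => -[j hj].
have -> : Ordinal hj = o j by apply: val_inj; rewrite /= inordK.
rewrite inordK //.
case: j hj => [|[|[|[|[|[|j]]]]]] hj //; rewrite /= ?(mevalB, mevalM) ?e //= /x43 /x42 /x32; field.
all: rewrite ?a0 ?a1 ?a2 //.
Qed.

Lemma free_state st : st \in states -> algebraically_free (cluster (realize st)).
Proof.
suff H (s : seed R) : reachable s -> algebraically_free (cluster s) by move/state_reachable/H.
move=> rs; elim: rs => {st s} [|k s rs fs]; first by rewrite initial_seedE; exact: free_initial.
have [st hst es] := reachable_state rs; rewrite es in fs *; rewrite (mutate_realize k hst).
have hk := ltn_ord k.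
pose M : mpoly 6 R[i] := \prod_(j < 6 | eps st k j == 1) mpolyX _ (mnm1 j)
                       + \prod_(j < 6 | eps st k j == -1) mpolyX _ (mnm1 j).
have evM v : meval v M = \prod_(j < 6 | eps st k j == 1) v j + \prod_(j < 6 | eps st k j == -1) v j.
  by rewrite mevalD !rmorph_prod /=; congr (_ + _); apply: eq_bigr => j _; rewrite mevalXU.
have ek : eps st k k = 0.
  have /allP := allP states_exchange_ok _ hst; move=> /(_ k).
  by rewrite mem_iota => /(_ hk) /and3P [_ /eqP].
apply: (@free_mutation _ (cluster (realize st)) _ (uf k) M) => //.
(* Both exchange monomials are 1 at the point with all coordinates 1, so M takes the value 2. *)
- have : meval (fun=> 1) M != 0 by rewrite evM !big1 // -[1 + 1]/(2%:R) pnatr_eq0.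
  by apply: contraNneq => ->; rewrite meval0.
- move=> v v' h; rewrite !evM; congr (_ + _); apply: eq_bigr => j /eqP hj; apply: h;
  by apply: contra_eq_neq hj => ->; rewrite /= ek.
- by move=> j; rewrite !ffunE label_mut -val_eqE /= => /negPf ->.
- rewrite !ffunE label_mut eqxx /= exchange_product // rmorphD !rmorph_prod /=.
  by congr (_ + _); rewrite -(prod_label_eps (var R)); apply: eq_bigr => j _; rewrite mmapX mmap1U ffunE.
Qed.

Lemma states_gvec_size : all (fun s => size s.2 == 12) states.
Proof. by vm_compute. Qed.

(** * Values of cluster monomials *)

Definition grow (st : state) (x : nat) : 'rV[int]_6 := \row_j gvec st x j.

Lemma grow_fixed st x : st \in states -> (12 <= x)%N -> grow st x = 0.
Proof.
move=> hst hx; apply/rowP => j; rewrite !mxE /gvec /entry.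
have /eqP h : size st.2 == 12 by exact: (allP states_gvec_size).
by rewrite [nth [::] _ _]nth_default ?h // nth_nil.
Qed.

Lemma weightE st m j : weight st m j = \sum_(z <- m) gvec st z j.
Proof. by elim: m => [|z m IH]; rewrite ?big_nil //= big_cons -IH. Qed.

Section VarValuation.
Variables (st : state) (hst : st \in states) (le : rel 'rV[int]_6).
Hypothesis hle : refining_order (exchange (realize st)) le.
Local Notation V := (seed_valuation le (realize st)).
Let fst := free_state hst.

Lemma val_one : V 1 0.
Proof.
rewrite -[1](rmorph1 (mmap (@scalarK R) (cluster (realize st)))).
apply: val_poly => //; rewrite ?oner_neq0 //.
have e0 : exponent (@mnm0 6) = 0 by apply/rowP => j; rewrite !mxE mnm0E.
case: hle => -[hr _ _ _] _ _.
split=> [|m]; rewrite msupp1; first by exists (@mnm0 6); rewrite ?inE ?e0.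
by rewrite inE => /eqP ->; rewrite e0.
Qed.

Lemma val_scalar c : c != 0 -> V (scalarK c) 0.
Proof.
move=> c0; have -> : scalarK c = mmap (@scalarK R) (cluster (realize st)) (mpolyC 6 c) by rewrite mmapC.
apply: val_poly => //; rewrite ?mpolyC_eq0 //.
have e0 : exponent (@mnm0 6) = 0 by apply/rowP => j; rewrite !mxE mnm0E.
case: hle => -[hr _ _ _] _ _.
split=> [|m]; rewrite msuppC (negPf c0); first by exists (@mnm0 6); rewrite ?inE ?e0.
by rewrite inE => /eqP ->; rewrite e0.
Qed.

Lemma val_prod (I : Type) (m : seq I) (F : I -> function_field R) g :
  (forall z, V (F z) (g z)) -> V (\prod_(z <- m) F z) (\sum_(z <- m) g z).
Proof.
move=> h; elim: m => [|z m IH]; rewrite ?big_nil ?big_cons; first exact: val_one.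
exact: val_mul.
Qed.

Lemma val_prod_seq (m : seq nat) :
  (forall z, z \in m -> V (var R z) (grow st z)) ->
  V (\prod_(z <- m) var R z) (\sum_(z <- m) grow st z).
Proof.
elim: m => [|z m IH] h; rewrite ?big_nil ?big_cons; first exact: val_one.
apply: val_mul => //; first by apply: h; rewrite inE eqxx.
by apply: IH => y hy; apply: h; rewrite inE hy orbT.
Qed.

Lemma val_label j : (j < 6)%N -> V (var R (label st j)) (grow st (label st j)).
Proof.
move=> hj; have -> : var R (label st j)
    = mmap (@scalarK R) (cluster (realize st)) (mpolyX _ (mnm1 (Ordinal hj))).
  by rewrite mmapX mmap1U ffunE.
apply: val_poly => //; first by rewrite -msupp_eq0 msuppX.
have e0 : grow st (label st j) = exponent (mnm1 (Ordinal hj)).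
  apply/rowP => i; rewrite !mxE mnm1E -val_eqE /=.
  have /and5P [_ _ _ _ /allP h] := allP states_labels _ hst.
  have := h j; rewrite mem_iota => /(_ hj) /allP /(_ i).
  by rewrite mem_iota ltn_ord => /(_ isT) /eqP.
case: hle => -[hr _ _ _] _ _.
split=> [|m]; rewrite msuppX; first by exists (mnm1 (Ordinal hj)); rewrite ?inE.
by rewrite inE => /eqP ->; rewrite e0.
Qed.

(** The two monomials have different values and the dominated one is lower for every refining order,
    so x y has the value of [m]; subtracting the value of x gives that of y. *)
Lemma val_exchange x y m m' :
  var R x * var R y = \prod_(z <- m) var R z + \prod_(z <- m') var R z ->
  relation_oriented st x y m m' ->
  (forall z, z \in m ++ m' -> V (var R z) (grow st z)) ->
  V (var R x) (grow st x) -> V (var R y) (grow st y).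
Proof.
move=> e /and3P [/allP hxy ne /hasP [u u_in /allP hu]] hm hx.
have hW j : (j < 6)%N -> (j \in iota 0 6) by rewrite mem_iota.
have rowW (n : seq nat) (j : 'I_6) : (\sum_(z <- n) grow st z) 0 j = weight st n j.
  by rewrite weightE summxE; apply: eq_bigr => z _; rewrite mxE.
have hm1 : V (\prod_(z <- m) var R z) (\sum_(z <- m) grow st z).
  by apply: val_prod_seq => z hz; apply: hm; rewrite mem_cat hz.
have hm2 : V (\prod_(z <- m') var R z) (\sum_(z <- m') grow st z).
  by apply: val_prod_seq => z hz; apply: hm; rewrite mem_cat hz orbT.
have {hm1 hm2}hs : V (var R x * var R y) (\sum_(z <- m) grow st z).
  rewrite e; apply: (val_add hle fst hm1 hm2).
    (* Dominance is witnessed by the multiplicities of the rows listed in [u]; the refining order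
       reverses it, so [m] has the lower value. *)
    case: hle => _ _; apply; exists (\row_i (count_mem (i : nat) u)%:Z); split=> [i|].
      by rewrite mxE.
    apply/rowP => j; rewrite mxE !rowW (eqP (hu j (hW _ (ltn_ord j)))); congr (_ + _).
    have u3 : all (fun i => i < 3)%N u.
      by apply: (allP (_ : all (all (fun i => i < 3)%N) _) u u_in).
    rewrite mxE /shift; elim: (u) u3 => [|i v IH] /=.
      by rewrite big1 // => i _; rewrite !mxE /= mul0r.
    case/andP => i3 /IH ->; rewrite -[eps st i j]mul1r.
    rewrite [RHS](eq_bigr (fun k : 'I_3 => (i == k)%:Z * eps st k j
      + (\row_i0 (count_mem (i0 : nat) v)%:Z) 0 k * (\matrix_(i, j) eps st i j) k j)).
      rewrite big_split /=; congr (_ + _).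
      rewrite (bigD1 (Ordinal i3)) //= eqxx big1 ?addr0 // => k.
      by rewrite -val_eqE /= eq_sym => /negPf ->; rewrite mul0r.
    by move=> k _; rewrite !mxE PoszD mulrDl.
  move=> ew; case/negP: ne; apply/allP => j; rewrite mem_iota => hj.
  by rewrite -(rowW m (Ordinal hj)) -(rowW m' (Ordinal hj)) ew.
have -> : var R y = (var R x * var R y) * (var R x)^-1 by rewrite mulrAC mulfV ?mul1r // var_neq0.
have -> : grow st y = \sum_(z <- m) grow st z - grow st x.
  apply/rowP => j; rewrite mxE [RHS]mxE rowW 2![in RHS]mxE -(eqP (hxy j (hW _ (ltn_ord j)))).
  by rewrite addrC addKr.
by apply: val_mul => //; apply: val_inv.
Qed.

End VarValuation.

Definition degrees : seq (seq nat) :=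
  [:: [:: 1; 0; 0]; [:: 0; 1; 0]; [:: 1; 0; 0]; [:: 0; 1; 0]; [:: 1; 0; 1];
      [:: 0; 1; 0]; [:: 0; 0; 1]; [:: 0; 1; 0]; [:: 0; 0; 1]; [:: 0; 0; 1];
      [:: 0; 1; 0]; [:: 1; 0; 0]; [:: 1; 0; 0]; [:: 0; 1; 0]; [:: 0; 0; 1]]%N.

Definition deg (x i : nat) : nat := nth 0%N (nth [::] degrees x) i.

(* A monomial in the fifteen variables is the sequence c of its exponents. *)
Definition degree (c : seq nat) (i : nat) : nat := (\sum_(x < 15) nth 0 c x * deg x i)%N.

Definition supported (c : seq nat) (s : state) : bool :=
  all (fun x => (nth 0 c x == 0)%N || (x \in s.1.1)) (iota 0 9).

Definition cluster_monomial (c : seq nat) : bool :=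
  (size c == 15) && has (supported c) states.

Lemma states_labels_compatible :
  all (fun s => all (fun x => all (fun y => ~~ incompatible x y) s.1.1) s.1.1) states.
Proof. by vm_compute. Qed.

Lemma states_mut_involutive :
  all (fun s => all (fun k => mut (mut s k) k == s) (iota 0 3)) states.
Proof. by vm_compute. Qed.

Lemma states_labels_cover :
  all (fun s => all (fun x => (x \in s.1.1) || (x < 9) || (11 < x))%N (iota 0 15)) states.
Proof. by vm_compute. Qed.

Definition gmon (st : state) (c : seq nat) : 'rV[int]_6 := \sum_(x < 15) grow st x *+ nth 0%N c x.

Lemma gmonE st c j : gmon st c 0 j = \sum_(x < 15) gvec st x j *+ nth 0%N c x.
Proof. by rewrite /gmon summxE; apply: eq_bigr => x _; rewrite mulmxnE mxE. Qed.

Lemma posz_sum (I : finType) (a : I -> int) :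
  (forall x y, 0 <= a x * a y) -> posz (\sum_x a x) = \sum_x posz (a x).
Proof.
move=> h; case: (pickP (fun x => 0 < a x)) => [x hx|hn].
  have pos y : 0 <= a y by rewrite -(pmulr_rge0 _ hx).
  have e (n : int) : 0 <= n -> posz n = n by case: n.
  by rewrite e ?sumr_ge0 //; apply: eq_bigr => y _; rewrite e.
have neg y : a y <= 0 by rewrite leNgt hn.
have e (n : int) : n <= 0 -> posz n = 0 by case: n => [[]|].
by rewrite e ?sumr_le0 // big1 // => y _; rewrite e.
Qed.

Lemma posz_mulrn (a : int) n : posz (a *+ n) = posz a *+ n.
Proof. by rewrite !poszE -[a *+ n]mulr_natr -[_ *+ n in RHS]mulr_natr maxr_pMl // mul0r. Qed.

Lemma gvec_mut st k x j : st \in states -> (x < 12)%N -> (j < 6)%N ->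
  gvec (mut st k) x j = trop k (eps st) (gvec st x) j.
Proof.
move=> hst hx hj; have /eqP hs : size st.2 == 12 by exact: (allP states_gvec_size).
by rewrite /gvec /entry /= (nth_map [::]) ?hs // nth_mkseq.
Qed.

Lemma gvec_fixed st x j : st \in states -> (12 <= x)%N -> gvec st x j = 0.
Proof.
move=> hst hx; rewrite /gvec /entry.
have /eqP h : size st.2 == 12 by exact: (allP states_gvec_size).
by rewrite [nth [::] _ _]nth_default ?h // nth_nil.
Qed.

(** Two variables that occur in c share a seed, hence are compatible, and sign coherence applies to
    them at every seed. *)
Lemma cluster_monomial_coherent c st (i : nat) : cluster_monomial c -> st \in states -> (i < 3)%N ->
  forall x y : 'I_15, 0 <= (gvec st x i *+ nth 0%N c x) * (gvec st y i *+ nth 0%N c y).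
Proof.
move=> /andP [_ /hasP [t ht /all_iota sup]] hst hi x y.
case: (eqVneq (nth 0%N c x) 0%N) => [->|cx]; first by rewrite mulr0n mul0r.
case: (eqVneq (nth 0%N c y) 0%N) => [->|cy]; first by rewrite mulr0n mulr0.
case: (leqP 12 x) => hx; first by rewrite gvec_fixed // mul0rn mul0r.
case: (leqP 12 y) => hy; first by rewrite [gvec _ y _]gvec_fixed // mul0rn mulr0.
have in_lab (z : 'I_15) : (z < 12)%N -> nth 0%N c z != 0%N -> nat_of_ord z \in t.1.1.
  move=> hz cz; case: (ltnP z 9) => h; first by have := sup z h; rewrite (negPf cz).
  have /all_iota /(_ z (ltn_ord z)) := allP states_labels_cover _ ht.
  by case/orP => [/orP [//|]|]; lia.
rewrite mulrnAl mulrnAr !mulrn_wge0 //.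
have /all_iota /(_ x hx) /all_iota /(_ y hy) := allP states_sign_coherent _ hst.
have /allP /(_ _ (in_lab x hx cx)) /allP /(_ _ (in_lab y hy cy)) :=
  allP states_labels_compatible _ ht.
by move=> /negPf ->; rewrite orFb => /all_iota; apply.
Qed.

Definition trop_row (k : nat) (e : nat -> nat -> int) (g : 'rV[int]_6) : 'rV[int]_6 :=
  \row_j trop k e (fun i => g 0 (inord i)) j.

(* The i-th coordinates of the g-vectors of compatible variables have the same
   sign, so that the piecewise linear map is linear on them. *)
Lemma gmon_mut st k c : st \in states -> (k < 3)%N -> cluster_monomial c ->
  gmon (mut st k) c = trop_row k (eps st) (gmon st c).
Proof.
move=> hst hk hc; apply/rowP => j; rewrite mxE gmonE /trop !gmonE !inordK ?ltn_ord //; last lia.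
have hm x : gvec (mut st k) x j = trop k (eps st) (gvec st x) j.
  case: (ltnP x 12) => hx; first exact: gvec_mut.
  rewrite gvec_fixed ?mut_in_states // /trop !gvec_fixed // oppr0 mulr0 addr0 mulr0.
  by rewrite addr0; case: ifP.
rewrite (eq_bigr (fun x : 'I_15 => trop k (eps st) (gvec st x) j *+ nth 0%N c x)); last by move=> x _;
    rewrite hm.
rewrite /trop; case: ifP => _; first by rewrite -sumrN; apply: eq_bigr => x _; rewrite mulNrn.
rewrite posz_sum; last exact: cluster_monomial_coherent.
rewrite !mulr_sumr -!big_split /=; apply: eq_bigr => x _.
by rewrite posz_mulrn !mulrnDl !mulrnAr.
Qed.

Lemma labelP st x : st \in states -> x \in st.1.1 -> exists2 j, (j < 6)%N & x = label st j.
Proof.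
move=> hst hx; exists (index x st.1.1); last by rewrite /label nth_index.
have e : size st.1.1 = 6%N by exact: states_size.
by rewrite -e index_mem.
Qed.

Lemma gmon_label st c (j : 'I_6) : st \in states -> supported c st ->
  gmon st c 0 j = (nth 0%N c (label st j))%:Z.
Proof.
move=> hst /all_iota sup; rewrite gmonE.
have hz : (label st j < 12)%N.
  have /and5P [_ _ /allP h /allP h' _] := allP states_labels _ hst.
  case: (ltnP j 3) => hj; first by have := h j; rewrite mem_iota => /(_ hj); lia.
  by rewrite states_label ?hj ?ltn_ord //; have := ltn_ord j; lia.
have hl i l : (i < 6)%N -> (l < 6)%N -> gvec st (label st i) l = (i == l)%:Z.
  move=> hi hl; have /and5P [_ _ _ _ /all_iota h] := allP states_labels _ hst.
  by have /all_iota/(_ l hl)/eqP := h i hi.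
have hz' : (label st j < 15)%N by lia.
rewrite (bigD1 (Ordinal hz')) //= hl // eqxx big1 ?addr0; first by rewrite -mulr_natr mul1r natz.
move=> x; rewrite -val_eqE /= => nx.
case: (eqVneq (nth 0%N c x) 0%N) => [->|cx]; first by rewrite mulr0n.
case: (ltnP x 12) => hx; last by rewrite gvec_fixed // mul0rn.
have : nat_of_ord x \in st.1.1.
  case: (ltnP x 9) => h; first by have := sup x h; rewrite (negPf cx).
  have /all_iota /(_ x (ltn_ord x)) := allP states_labels_cover _ hst.
  by case/orP => [/orP [//|]|]; lia.
case/(labelP hst) => i hi ex; rewrite ex hl //; case: eqP => [e|]; last by rewrite mul0rn.
by move: nx; rewrite ex e eqxx.
Qed.

(* At a seed containing the variables of c the mutable part of gmon is nonnegative,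
   whereas every mutable variable outside that seed has a g-vector with a
   negative mutable coordinate; hence c' is supported on the same seed. *)
Lemma gmon_inj st c c' : st \in states -> cluster_monomial c -> cluster_monomial c' ->
  (forall i, (i < 3)%N -> degree c i = degree c' i) -> gmon st c = gmon st c' -> c = c'.
Proof.
move=> hst hc hc' hdeg e.
(* The piecewise linear maps are invertible, as mutating twice in one direction gives the seed back;
   so g-vectors that agree at one seed agree at all. *)
have indep t : t \in states -> gmon t c = gmon t c' <-> gmon initial_state c = gmon initial_state c'.
  move: t; apply: states_ind => // t k ht hk <-; split=> h; last by rewrite !gmon_mut // h.
  have /all_iota /(_ k hk) /eqP inv := allP states_mut_involutive _ ht.
  have back d : cluster_monomial d ->
      gmon t d = trop_row k (eps (mut t k)) (gmon (mut t k) d).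
    by move=> hd; rewrite -gmon_mut ?inv ?mut_in_states.
  by rewrite (back _ hc) (back _ hc') h.
case/andP: (hc) => /eqP sc /hasP [t ht sup].
have {}e : gmon t c = gmon t c' by apply/indep => //; apply/(indep st).
have sup' : supported c' t.
  apply/all_iota => x hx; apply/negPn/negP; rewrite negb_or => /andP [cx nx].
  have /all_iota /(_ x hx) := allP states_negative_outside _ ht.
  rewrite (negPf nx) orFb; case/hasP => i; rewrite mem_iota => hi neg.
  have hi6 : (i < 6)%N by lia.
  have hx15 : (x < 15)%N by lia.
  have := gmon_label (Ordinal hi6) ht sup; rewrite e gmonE /= => pos.
  have : \sum_(y < 15) gvec t y i *+ nth 0%N c' y < 0.
    rewrite (bigD1 (Ordinal hx15)) //= ltr_wnDr // ?mulrn_wlt0 ?lt0n //.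
    apply: sumr_le0 => y _.
    have := cluster_monomial_coherent hc' ht hi (Ordinal hx15) y => /=.
    by rewrite nmulr_rge0 // mulrn_wlt0 // lt0n.
  by rewrite pos; lia.
have lab j : (j < 6)%N -> nth 0%N c (label t j) = nth 0%N c' (label t j).
  move=> hj; have := gmon_label (Ordinal hj) ht sup.
  by rewrite e (gmon_label _ ht sup') /= => -[].
have low x : (x < 12)%N -> nth 0%N c x = nth 0%N c' x.
  move=> hx; case: (boolP (x \in t.1.1)) => [/(labelP ht) [i hi ->]|nx].
    exact: lab.
  case: (ltnP x 9) => h.
    have /all_iota/(_ x h) := sup; have /all_iota/(_ x h) := sup'.
    by rewrite (negPf nx) !orbF => /eqP -> /eqP ->.
  have hx15 : (x < 15)%N by lia.
  have /all_iota /(_ x hx15) := allP states_labels_cover _ ht.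
  by rewrite (negPf nx) /=; lia.
case/andP: (hc') => /eqP sc' _.
apply: (@eq_from_nth _ 0%N); rewrite ?sc ?sc' // => x hx.
case: (ltnP x 12) => hx12; first exact: low.
(* The variables 12 to 14 are invisible to g-vectors; their exponents are recovered from the three
   degrees, since variable 12 + i has degree e_i. *)
have hi : (x - 12 < 3)%N by lia.
have := hdeg _ hi; rewrite /degree.
rewrite (bigD1 (Ordinal hx)) //= [RHS](bigD1 (Ordinal hx)) //=.
rewrite (eq_bigr (fun y : 'I_15 => nth 0 c' y * deg y (x - 12)))%N.
  move=> /addIn /eqP; rewrite eqn_pmul2r => [/eqP //|].
  by case: x hx hx12 {hi} => [|[|[|[|[|[|[|[|[|[|[|[|[|[|[|]]]]]]]]]]]]]]].
move=> y; rewrite -val_eqE /= => ne; case: (ltnP y 12) => hy; first by rewrite low.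
have -> : deg y (x - 12) = 0%N.
  have := ltn_ord y; case: (nat_of_ord y) hy ne => [|[|[|[|[|[|[|[|[|[|[|[|[|[|[|]]]]]]]]]]]]]]] //= _;
  by case: x hx hx12 {hi} => [|[|[|[|[|[|[|[|[|[|[|[|[|[|[|]]]]]]]]]]]]]]].
by rewrite !muln0.
Qed.

Section MonomialValuation.
Variables (st : state) (hst : st \in states) (le : rel 'rV[int]_6).
Hypothesis hle : refining_order (exchange (realize st)) le.
Local Notation V := (seed_valuation le (realize st)).

Lemma val_determined known :
  (forall z, z \in known -> V (var R z) (grow st z)) ->
  forall z, z \in determined st known -> V (var R z) (grow st z).
Proof.
move=> hk z; rewrite mem_cat => /orP [/hk //|/flattenP [l /mapP [r hr ->]]] {l}.
have h12 y : (12 <= y)%N -> V (var R y) (grow st y).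
  move=> hy; rewrite grow_fixed // /var -(subnKC hy) /= rmorph1.
  exact: val_one.
case: r hr => [[[x y] m] m'] hr.
have := var_relation R hr; have /allP /(_ _ hr) := allP states_relation_valued _ hst.
rewrite /= => hor e.
case: ifP => // /allP hm.
have hmV w : w \in m ++ m' -> V (var R w) (grow st w) by move=> /hm /orP [/hk|/h12].
have hmV' w : w \in m' ++ m -> V (var R w) (grow st w).
  by rewrite mem_cat orbC -mem_cat; exact: hmV.
have e' : var R x * var R y = \prod_(z <- m') var R z + \prod_(z <- m) var R z by rewrite e addrC.
have oriented_sym a b n n' : relation_oriented st a b n n' -> relation_oriented st b a n n'.
  case/and3P => h1 h2 h3; apply/and3P; split => //.
  by apply/allP => j /(allP h1); rewrite addrC.
case: ifP => [hx|_].
  rewrite mem_seq1 => /eqP ->; case/orP: hor => ho.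
    exact: (val_exchange hst hle e ho hmV (hk _ hx)).
  exact: (val_exchange hst hle e' ho hmV' (hk _ hx)).
case: ifP => // hy; rewrite mem_seq1 => /eqP ->; rewrite mulrC in e e'.
case/orP: hor => /oriented_sym ho.
  exact: (val_exchange hst hle e ho hmV (hk _ hy)).
exact: (val_exchange hst hle e' ho hmV' (hk _ hy)).
Qed.

(** The values at the variables of the seed are unit vectors; three rounds of exchange relations
    propagate them to all the others. *)
Lemma val_var x : V (var R x) (grow st x).
Proof.
case: (ltnP x 12) => hx; last first.
  rewrite grow_fixed // /var -(subnKC hx) /= rmorph1; exact: val_one.
have /all_iota /(_ x hx) := allP states_determined _ hst.
have : forall z, z \in st.1.1 -> V (var R z) (grow st z).
  by move=> z /(labelP hst) [j hj ->]; exact: val_label.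
move: x hx => x _; elim: 3%N st.1.1 => [|n IH] known hk; first by apply: hk.
rewrite iterSr; apply: IH => z; exact: val_determined.
Qed.

Definition cmon (c : seq nat) : function_field R := \prod_(x < 15) var R x ^+ nth 0%N c x.

Lemma val_cmon c : V (cmon c) (gmon st c).
Proof.
apply: val_prod => // x; elim: (nth 0%N c x) => [|n IH].
  by rewrite expr0 mulr0n; exact: val_one.
by rewrite exprS mulrS; apply: val_mul => //; exact: val_var.
Qed.

(** Distinct summands have distinct values, so the lowest term never cancels and each added summand
    leaves the smaller of two values. *)
Lemma val_combination (cs : seq (seq nat)) (a : seq nat -> R[i]) :
  uniq cs -> cs != [::] -> {in cs &, injective (gmon st)} -> {in cs, forall c, a c != 0} ->
  exists2 c, c \in cs & V (\sum_(c <- cs) scalarK (a c) * cmon c) (gmon st c).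
Proof.
elim: cs => // c cs IH /= /andP [nc ucs] _ inj ha.
have hc : V (scalarK (a c) * cmon c) (gmon st c).
  rewrite -[gmon st c]add0r; apply: val_mul => //; last exact: val_cmon.
  by apply: val_scalar => //; apply: ha; rewrite inE eqxx.
case: (eqVneq cs [::]) => [->|ncs].
  by exists c; rewrite ?inE ?eqxx // big_seq1.
have [||c' hc' hV] := IH ucs ncs.
- by move=> x y hx hy; apply: inj; rewrite inE ?hx ?hy orbT.
- by move=> x hx; apply: ha; rewrite inE hx orbT.
have ne : gmon st c <> gmon st c'.
  move=> e; case/negP: nc; rewrite (inj c c') // ?inE ?eqxx // hc' orbT //.
rewrite big_cons; have htot : total le by case: hle => -[].
case/orP: (htot (gmon st c) (gmon st c')) => l.
  exists c; rewrite ?inE ?eqxx //; apply: (val_add hle _ hc hV l ne); exact: free_state.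
exists c'; rewrite ?inE ?hc' ?orbT // addrC.
by apply: (val_add hle _ hV hc l) => // [|e]; [exact: free_state|apply: ne].
Qed.
End MonomialValuation.

End Realization.

(** * Sections and Gelfand-Tsetlin inequalities *)

(** Regularity at infinity bounds the degree. With q = X^N r(1/X), of degree at most N, the
    hypothesis becomes X^N p = X^d q, as both sides agree at all positive integers. *)
Lemma poly_degree_at_infinity (F : numFieldType) (p r : {poly F}) (d : nat) :
  (forall t, t != 0 -> p.[t] = t ^+ d * r.[t^-1]) -> (size p <= d.+1)%N.
Proof.
move=> h; pose N := size r.
pose q : {poly F} := \sum_(i < N) r`_i *: 'X^(N - i).
have e : 'X^N * p = 'X^d * q.
  apply/eqP; rewrite -subr_eq0; apply/negbNE/negP => ne.
  pose rs : seq F := [seq k.+1%:R | k <- iota 0 (size ('X^N * p - 'X^d * q))].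
  suff : (size rs < size ('X^N * p - 'X^d * q)%R)%N by rewrite size_map size_iota ltnn.
  apply: max_poly_roots => //.
    apply/allP => x; case/mapP => k _ ->; rewrite rootE hornerD hornerN !hornerM !hornerXn.
    have k0 : k.+1%:R != 0 :> F by rewrite pnatr_eq0.
    rewrite h // mulrCA -mulrBr mulf_eq0; apply/orP; right.
    rewrite subr_eq0 horner_coef horner_sum mulr_sumr; apply/eqP/eq_bigr => i _.
    rewrite hornerZ hornerXn mulrCA; congr (_ * _).
    by rewrite exprVn -expfB // ltnW.
  by rewrite map_inj_uniq ?iota_uniq // => a b /eqP; rewrite eqr_nat => /eqP [].
have sq : (size q <= N.+1)%N.
  apply: (leq_trans (size_sum _ _ _)); apply/bigmax_leqP => i _.
  by apply: (leq_trans (size_scale_leq _ _)); rewrite size_polyXn ltnS leq_subr.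
case: (eqVneq p 0) => [->|p0]; first by rewrite size_poly0.
have : (size ('X^N * p)%R <= d + N.+1)%N.
  rewrite e; apply: (leq_trans (size_polyMleq _ _)).
  by rewrite size_polyXn /= leq_add2l.
by rewrite mulrC size_mulXn //; lia.
Qed.

Section Sections.
Variable R : realType.
Local Notation C := R[i].
Local Notation MP := (mpoly 6 R[i]).

Definition mat4 (S : pzRingType) (l : seq (seq S)) : 'M[S]_4 :=
  \matrix_(r < 4, c < 4) nth 0 (nth [::] l r) c.

Definition lower_unipotent (S : pzRingType) (u : nat -> S) : 'M[S]_4 :=
  mat4 [:: [:: 1; 0; 0; 0]; [:: u 0%N; 1; 0; 0]; [:: u 1%N; u 2%N; 1; 0];
           [:: u 3%N; u 4%N; u 5%N; 1]].

(** Right multiplication by the i-th lower root subgroup adds t times column i + 1 to column i,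
    columns being numbered from 0; this is the coefficient of t in each coordinate. *)
Definition shift_direction (S : pzRingType) (i : nat) (u : nat -> S) (j : nat) : S :=
  nth 0 (nth [::] [:: [:: 1; u 2%N; 0; u 4%N; 0; 0];
                      [:: 0; 0; 1; 0; u 5%N; 0]; [:: 0; 0; 0; 0; 0; 1]] i) j.

(* In SL_2, the lower unipotent element with entry t is the product of the
   upper one with entry 1/t, of [[0, -1], [1, 0]] and of [[t, 1], [0, 1/t]]. *)
Definition lower_root (i : nat) (t : C) : 'M[C]_4 :=
  mat4 (nth [::] [:: [:: [:: 1; 0; 0; 0]; [:: t; 1; 0; 0]; [:: 0; 0; 1; 0]; [:: 0; 0; 0; 1]];
                     [:: [:: 1; 0; 0; 0]; [:: 0; 1; 0; 0]; [:: 0; t; 1; 0]; [:: 0; 0; 0; 1]];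
                     [:: [:: 1; 0; 0; 0]; [:: 0; 1; 0; 0]; [:: 0; 0; 1; 0]; [:: 0; 0; t; 1]]] i).

Definition borel_part (i : nat) (t : C) : 'M[C]_4 :=
  mat4 (nth [::] [:: [:: [:: t; 1; 0; 0]; [:: 0; t^-1; 0; 0]; [:: 0; 0; 1; 0]; [:: 0; 0; 0; 1]];
                     [:: [:: 1; 0; 0; 0]; [:: 0; t; 1; 0]; [:: 0; 0; t^-1; 0]; [:: 0; 0; 0; 1]];
                     [:: [:: 1; 0; 0; 0]; [:: 0; 1; 0; 0]; [:: 0; 0; t; 1]; [:: 0; 0; 0; t^-1]]] i).

Definition opposite_part (S : pzRingType) (i : nat) (v : S) : 'M[S]_4 :=
  mat4 (nth [::] [:: [:: [:: v; -1; 0; 0]; [:: 1; 0; 0; 0]; [:: 0; 0; 1; 0]; [:: 0; 0; 0; 1]];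
                     [:: [:: 1; 0; 0; 0]; [:: 0; v; -1; 0]; [:: 0; 1; 0; 0]; [:: 0; 0; 0; 1]];
                     [:: [:: 1; 0; 0; 0]; [:: 0; 1; 0; 0]; [:: 0; 0; v; -1]; [:: 0; 0; 1; 0]]] i).

Lemma lower_root_split i t : (i < 3)%N -> t != 0 ->
  lower_root i t = opposite_part i t^-1 *m borel_part i t.
Proof.
by move=> + t0; case: i => [|[|[|i]]] // _; apply/matrixP => -[r hr] [c hc];
rewrite !mxE !big_ord_recl big_ord0 !mxE /=;
case: r hr => [|[|[|[|r]]]] hr //; case: c hc => [|[|[|[|c]]]] hc //=; field.
Qed.

Lemma lower_unipotent_shift (u : nat -> C) i t : (i < 3)%N ->
  lower_unipotent (fun j => u j + shift_direction i u j * t)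
  = lower_unipotent u *m lower_root i t.
Proof.
by case: i => [|[|[|i]]] // _; apply/matrixP => -[r hr] [c hc];
rewrite !mxE !big_ord_recl big_ord0 !mxE /=;
case: r hr => [|[|[|[|r]]]] hr //; case: c hc => [|[|[|[|c]]]] hc //=;
rewrite /shift_direction /=; ring.
Qed.

Lemma det_lower_unipotent (u : nat -> C) : \det (lower_unipotent u) = 1.
Proof.
rewrite det_trig; last by apply/is_trig_mxP => -[r hr] [c hc]; rewrite mxE /=;
  case: r hr => [|[|[|[|r]]]] hr //; case: c hc => [|[|[|[|c]]]] hc.
by rewrite !big_ord_recl big_ord0 !mxE /= !mulr1.
Qed.

Lemma borel_part_borel i t : (i < 3)%N -> t != 0 -> borel (borel_part i t).
Proof.
move=> hi t0; have tri (r c : 'I_4) : (c < r)%N -> borel_part i t r c = 0.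
  rewrite mxE; case: i hi => [|[|[|i]]] // _; case: r => r hr; case: c => c hc /=;
  by case: r hr => [|[|[|[|r]]]] hr //; case: c hc => [|[|[|[|c]]]] hc.
split=> //; rewrite -det_tr det_trig; last by apply/is_trig_mxP => r c h; rewrite mxE tri.
by case: i hi {tri} => [|[|[|i]]] // _; rewrite !big_ord_recl big_ord0 !mxE /=; field.
Qed.

(** The exponent 2 is the pairing of lambda with the i-th simple coroot. *)
Lemma lambda_borel_part i t : (i < 3)%N -> t != 0 -> lambda (borel_part i t) = t ^+ 2.
Proof.
move=> hi t0; rewrite /lambda /fundamental_weight big_nat_recl // big_nat_recl // big_nat1.
do 3 rewrite [\prod_(j < 4 | _) _]big_mkcond !big_ord_recl !big_ord0.
rewrite !mxE /=.
by case: i hi => [|[|[|i]]] // _ /=; field.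
Qed.
End Sections.

Lemma rmorph_mmap (n : nat) (S0 S T : comNzRingType) (f : {rmorphism S0 -> S}) (g : {rmorphism S -> T})
    (h : 'I_n -> S) (P : mpoly n S0) :
  g (mmap f h P) = mmap (g \o f) (g \o h) P.
Proof.
rewrite /mmap rmorph_sum /=; apply: eq_bigr => m _; rewrite rmorphM /=.
by congr (_ * _); rewrite /mmap1 rmorph_prod; apply: eq_bigr => j _; rewrite rmorphXn.
Qed.

Lemma eq_mmap (n : nat) (S T : comNzRingType) (f f' : S -> T) (h h' : 'I_n -> T) (P : mpoly n S) :
  f =1 f' -> h =1 h' -> mmap f h P = mmap f' h' P.
Proof.
by move=> ef eh; rewrite /mmap; apply: eq_bigr => m _; rewrite ef (mmap1_eq _ eh).
Qed.

Section SectionBound.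
Variable R : realType.
Local Notation C := R[i].
Local Notation MP := (mpoly 6 R[i]).

Definition restrictP (F : mpoly (4 * 4) C) : MP :=
  mmap (@mpolyC 6 C) (fun l => mxvec (lower_unipotent (ucoord R)) 0 l) F.

Lemma map_lower_unipotent (S T : pzRingType) (g : {rmorphism S -> T}) (u : nat -> S) (v : nat -> T) :
  (forall j, (j < 6)%N -> g (u j) = v j) ->
  map_mx g (lower_unipotent u) = lower_unipotent v.
Proof.
move=> e; apply/matrixP => -[r hr] [c hc]; rewrite !mxE /=.
by case: r hr => [|[|[|[|r]]]] hr //; case: c hc => [|[|[|[|c]]]] hc //=;
  rewrite ?rmorph0 ?rmorph1 ?e.
Qed.

Lemma generic_unipotent_lower :
  generic_unipotent R = map_mx (@tofrac MP) (lower_unipotent (ucoord R)).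
Proof.
have [b12 b22 b32] : [/\ 'C(1, 2) = 0, 'C(2, 2) = 1 & 'C(3, 2) = 3]%N by [].
apply/matrixP => -[r hr] [c hc]; rewrite !mxE /=.
case: r hr => [|[|[|[|r]]]] hr //; case: c hc => [|[|[|[|c]]]] hc //=;
by rewrite ?b12 ?b22 ?b32 ?rmorph0 ?rmorph1.
Qed.

Lemma restrictUE F : restrictU F = tofrac (restrictP F).
Proof.
rewrite /restrictP rmorph_mmap /restrictU; apply: eq_mmap => // l.
by rewrite generic_unipotent_lower -map_mxvec mxE.
Qed.

Lemma meval_restrictP F (u : 'I_6 -> C) :
  meval u (restrictP F) = evalG F (lower_unipotent (fun j => u (inord j))).
Proof.
rewrite /restrictP /meval (rmorph_mmap _ (meval u)); apply: eq_mmap => [c|l] /=.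
  by rewrite mevalC.
rewrite -(map_lower_unipotent (g := meval u) (u := ucoord R)) => [|j hj]; last by rewrite /= mevalXU.
by rewrite -map_mxvec mxE.
Qed.

(** The translate of f along the i-th simple root direction, as a polynomial in the parameter with
    coefficients in the coordinates of U^-. *)
Definition shifted (i : nat) (f : MP) : {poly MP} :=
  mmap (polyC \o @mpolyC 6 C)
    (fun j : 'I_6 => (ucoord R j)%:P + (shift_direction i (ucoord R) j)%:P * 'X) f.

Lemma map_shift_direction (S T : pzRingType) (g : {rmorphism S -> T}) i (u : nat -> S) j :
  g (shift_direction i u j) = shift_direction i (g \o u) j.
Proof.
rewrite /shift_direction; case: i => [|[|[|i]]] /=; last by rewrite !nth_nil rmorph0.
all: by case: j => [|[|[|[|[|[|j]]]]]] //=; rewrite ?nth_nil ?rmorph0 ?rmorph1.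
Qed.

Lemma horner_shifted i f (u : 'I_6 -> C) t :
  (map_poly (meval u) (shifted i f)).[t]
  = meval (fun j => u j + shift_direction i (fun n => u (inord n)) j * t) f.
Proof.
rewrite /shifted (rmorph_mmap _ (map_poly (meval u))) -[_.[t]]/(horner_eval t _) rmorph_mmap.
apply: eq_mmap => [c|j] /=; first by rewrite map_polyC /= mevalC /horner_eval hornerC.
rewrite rmorphD rmorphM /= !map_polyC /= map_polyX /horner_eval !hornerE.
rewrite mevalXU inord_val map_shift_direction; congr (_ + _ * _).
rewrite /shift_direction /= /ucoord.
by rewrite !mevalXU.
Qed.

Lemma map_opposite_part (S T : pzRingType) (g : {rmorphism S -> T}) i (v : S) : (i < 3)%N ->
  map_mx g (opposite_part i v) = opposite_part i (g v).
Proof.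
move=> hi; apply/matrixP => -[a ha] [b hb]; rewrite !mxE /=.
case: i hi => [|[|[|i]]] //= _; case: a ha => [|[|[|[|a]]]] ha //; case: b hb => [|[|[|[|b]]]] hb //=;
by rewrite ?rmorphN1 ?rmorph0 ?rmorph1.
Qed.

(** For t != 0 the root element is [opposite_part] at 1/t times an element of B on which lambda is
    t^2. So at each point the translate is t^(2k) times a polynomial in 1/t and has degree at most
    2k; a nonzero higher coefficient would be nonzero at some point. *)
Lemma section_shifted_bound k F i m : is_section k F -> (i < 3)%N -> (2 * k < m)%N ->
  (shifted i (restrictP F))`_m = 0.
Proof.
move=> hF hi hm; apply/eqP/negbNE/negP => /mpoly_nonvanishing [u].
rewrite -coef_map => /eqP; apply.
pose L := lower_unipotent (fun j => u (inord j)).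
pose r : {poly C} := mmap polyC
  (fun l => mxvec (map_mx polyC L *m opposite_part i 'X) 0 l) F.
have hr v : r.[v] = evalG F (L *m opposite_part i v).
  rewrite -[r.[v]]/(horner_eval v r) /r rmorph_mmap /evalG /meval; apply: eq_mmap => [c|l] /=.
    by rewrite /horner_eval hornerC.
  have -> : L *m opposite_part i v = map_mx (horner_eval v) (map_mx polyC L *m opposite_part i 'X).
    rewrite map_mxM /=; congr (_ *m _).
      by apply/matrixP => a b; rewrite !mxE /horner_eval hornerC.
    by rewrite map_opposite_part //= /horner_eval hornerX.
  by rewrite -map_mxvec mxE.
apply: nth_default; apply: leq_trans hm.
apply: (@poly_degree_at_infinity _ _ r) => t t0.
rewrite horner_shifted meval_restrictP hr.
rewrite (_ : lower_unipotent _ = L *m lower_root i t); last first.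
  rewrite -lower_unipotent_shift //; congr (mat4 _); rewrite !inordK //.
rewrite lower_root_split // mulmxA hF.
- by rewrite lambda_borel_part // -exprM.
- have [db _] := borel_part_borel hi t0.
  have : \det (L *m opposite_part i t^-1 *m borel_part i t) = 1.
    by rewrite -mulmxA -lower_root_split // -lower_unipotent_shift // det_lower_unipotent.
  by rewrite det_mulmx db mulr1.
- exact: borel_part_borel.
Qed.
End SectionBound.

(** * Coefficients of translates along the simple root directions *)

Lemma prod_ord6 (S : comNzRingType) (F : nat -> S) :
  \prod_(j < 6) F j = F 0%N * (F 1%N * (F 2%N * (F 3%N * (F 4%N * F 5%N)))).
Proof. by rewrite !big_ord_recl big_ord0 mulr1. Qed.

Lemma coef_mmap (n : nat) (S0 S : comNzRingType) (f : {rmorphism S0 -> {poly S}})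
    (h : 'I_n -> {poly S}) (P : mpoly n S0) m :
  (mmap f h P)`_m = \sum_(p <- msupp P) (f (mcoeff p P) * mmap1 h p)`_m.
Proof. by rewrite /mmap coef_sum. Qed.

Lemma expand_shift (S : comNzRingType) (y w : S) n :
  (y%:P + w%:P * 'X) ^+ n = \sum_(h < n.+1) ('C(n, h)%:R * (y ^+ h * w ^+ (n - h)))%:P * 'X^(n - h).
Proof.
rewrite addrC exprDn; apply: eq_bigr => h _.
rewrite exprMn -mulr_natl !rmorphM !rmorphXn /= rmorph_nat; ring.
Qed.

Lemma expand_shift3 (S : comNzRingType) (x0 x1 x2 x3 x4 x5 : S) p0 p1 p2 p3 p4 p5 :
  (x0%:P + 1%:P * 'X) ^+ p0 * ((x1%:P + x2%:P * 'X) ^+ p1 * ((x2%:P + 0%:P * 'X) ^+ p2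
    * ((x3%:P + x4%:P * 'X) ^+ p3 * ((x4%:P + 0%:P * 'X) ^+ p4 * (x5%:P + 0%:P * 'X) ^+ p5))))
  = \sum_(h < p0.+1) \sum_(i < p1.+1) \sum_(j < p3.+1)
      (('C(p0, h) * 'C(p1, i) * 'C(p3, j))%:R
         * (x0 ^+ h * (x1 ^+ i * (x2 ^+ (p2 + (p1 - i)) * (x3 ^+ j * (x4 ^+ (p4 + (p3 - j)) * x5 ^+
             p5))))))%:P
      * 'X^(p0 - h + (p1 - i) + (p3 - j)).
Proof.
rewrite !polyC0 !mul0r !addr0 !expand_shift.
rewrite big_distrl /=; apply: eq_bigr => h _; rewrite big_distrl big_distrr /=.
apply: eq_bigr => i _; rewrite big_distrl !big_distrr /=; apply: eq_bigr => j _.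
rewrite expr1n !exprD !natrM !rmorphM !rmorphXn /=; ring.
Qed.

(** The one-term sum over j keeps the triple sum of direction 0, so that [coef_sum3] and
    [binomial_collapse3] serve all three directions. *)
Lemma expand_shift2 (S : comNzRingType) (x0 x1 x2 x3 x4 x5 : S) p0 p1 p2 p3 p4 p5 :
  (x0%:P + 0%:P * 'X) ^+ p0 * ((x1%:P + 0%:P * 'X) ^+ p1 * ((x2%:P + 1%:P * 'X) ^+ p2
    * ((x3%:P + 0%:P * 'X) ^+ p3 * ((x4%:P + x5%:P * 'X) ^+ p4 * (x5%:P + 0%:P * 'X) ^+ p5))))
  = \sum_(h < p2.+1) \sum_(i < p4.+1) \sum_(j < 1)
      (('C(p2, h) * 'C(p4, i) * 'C(0, j))%:R
         * (x0 ^+ p0 * (x1 ^+ p1 * (x2 ^+ h * (x3 ^+ p3 * (x4 ^+ i * x5 ^+ (p5 + (p4 - i))))))))%:P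
      * 'X^(p2 - h + (p4 - i) + (0 - j)).
Proof.
rewrite !polyC0 !mul0r !addr0 !expand_shift.
rewrite big_distrl !big_distrr /=; apply: eq_bigr => h _; rewrite big_distrl !big_distrr /=.
apply: eq_bigr => i _; rewrite big_ord_recl big_ord0 bin0 muln1 addn0 addr0.
rewrite expr1n !exprD !natrM !rmorphM !rmorphXn /=; ring.
Qed.

Lemma expand_shift1 (S : comNzRingType) (x0 x1 x2 x3 x4 x5 : S) p0 p1 p2 p3 p4 p5 :
  (x0%:P + 0%:P * 'X) ^+ p0 * ((x1%:P + 0%:P * 'X) ^+ p1 * ((x2%:P + 0%:P * 'X) ^+ p2
    * ((x3%:P + 0%:P * 'X) ^+ p3 * ((x4%:P + 0%:P * 'X) ^+ p4 * (x5%:P + 1%:P * 'X) ^+ p5))))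
  = \sum_(h < p5.+1) \sum_(i < 1) \sum_(j < 1)
      (('C(p5, h) * 'C(0, i) * 'C(0, j))%:R
         * (x0 ^+ p0 * (x1 ^+ p1 * (x2 ^+ p2 * (x3 ^+ p3 * (x4 ^+ p4 * x5 ^+ h))))))%:P
      * 'X^(p5 - h + (0 - i) + (0 - j)).
Proof.
rewrite !polyC0 !mul0r !addr0 !expand_shift.
rewrite !big_distrr /=; apply: eq_bigr => h _.
rewrite !big_ord_recl !big_ord0 !bin0 !muln1 !addn0 !addr0.
rewrite expr1n !rmorphM !rmorphXn /=; ring.
Qed.

Lemma coef_sum3 (S : comNzRingType) n0 n1 n2 (c : nat -> nat -> nat -> S) e m :
  (\sum_(h < n0) \sum_(i < n1) \sum_(j < n2) (c h i j)%:P * 'X^(e h i j))`_m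
  = \sum_(h < n0) \sum_(i < n1) \sum_(j < n2) c h i j *+ (m == e h i j :> nat).
Proof.
rewrite coef_sum; apply: eq_bigr => h _; rewrite coef_sum; apply: eq_bigr => i _.
rewrite coef_sum; apply: eq_bigr => j _.
by rewrite coefCM coefXn mulr_natr.
Qed.

Lemma binomial_collapse (n a : nat) (g : nat -> nat) :
  (\sum_(h < n.+1) 'C(n, h) * ((h == a :> nat) * g h) = 'C(n, a) * g a)%N.
Proof.
case: (ltnP a n.+1) => ha.
  rewrite (bigD1 (Ordinal ha)) //= eqxx mul1n big1 ?addn0 // => h.
  by rewrite -val_eqE /= => /negPf ->; rewrite mul0n muln0.
rewrite bin_small // mul0n big1 // => h _.
have -> : (h == a :> nat) = false by have := ltn_ord h; case: eqP => //; lia.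
by rewrite mul0n muln0.
Qed.

Lemma binomial_collapse3 (n0 n1 n2 a b c : nat) (g : nat -> nat -> nat -> nat) :
  (\sum_(h < n0.+1) \sum_(i < n1.+1) \sum_(j < n2.+1)
     'C(n0, h) * 'C(n1, i) * 'C(n2, j) * [&& h == a :> nat, i == b :> nat & j == c :> nat] * g h i j
   = 'C(n0, a) * 'C(n1, b) * 'C(n2, c) * g a b c)%N.
Proof.
transitivity (\sum_(h < n0.+1) 'C(n0, h) * ((h == a :> nat) *
   \sum_(i < n1.+1) 'C(n1, i) * ((i == b :> nat) *
     \sum_(j < n2.+1) 'C(n2, j) * ((j == c :> nat) * g h i j))))%N.
  apply: eq_bigr => h _; rewrite !big_distrr /=; apply: eq_bigr => i _.
  rewrite !big_distrr /=; apply: eq_bigr => j _.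
  by rewrite -!mulnb; lia.
rewrite (binomial_collapse n0 a (fun h => \sum_(i < n1.+1) 'C(n1, i) * ((i == b :> nat) *
     \sum_(j < n2.+1) 'C(n2, j) * ((j == c :> nat) * g h i j)))%N).
rewrite (binomial_collapse n1 b (fun i => \sum_(j < n2.+1) 'C(n2, j) * ((j == c :> nat) * g a i j))%N).
by rewrite (binomial_collapse n2 c (fun j => g a b j)) !mulnA.
Qed.

Section ShiftedCoefficients.
Variable R : realType.
Local Notation C := R[i].
Local Notation MP := (mpoly 6 R[i]).
Local Notation x := (ucoord R).

Definition mnm6 (a b c d e f : nat) : multinom 6 := Multinom [tuple of [:: a; b; c; d; e; f]].

Definition coo (p : multinom 6) (j : nat) : nat := p (inord j).

Lemma mnm6_eta p : p = mnm6 (coo p 0) (coo p 1) (coo p 2) (coo p 3) (coo p 4) (coo p 5).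
Proof.
apply/mnmP => -[j hj]; rewrite /coo [RHS]mnm_tnth (tnth_nth 0%N) /=.
by case: j hj => [|[|[|[|[|[|j]]]]]] hj //=; congr (p _); apply: val_inj; rewrite /= inordK.
Qed.

Lemma mnm6_eqE a b c d e f a' b' c' d' e' f' :
  (mnm6 a b c d e f == mnm6 a' b' c' d' e' f')
  = [&& a == a', b == b', c == c', d == d', e == e' & f == f'].
Proof.
apply/eqP/and5P => [/mnmP h|[/eqP -> /eqP -> /eqP -> /eqP -> /andP [/eqP -> /eqP ->]] //].
have hh j (hj : (j < 6)%N) := h (Ordinal hj).
have := (hh 0%N isT, hh 1%N isT, hh 2%N isT, hh 3%N isT, (hh 4%N isT, hh 5%N isT)).
rewrite !mnm_tnth !(tnth_nth 0%N) /=.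
by case=> -[[[-> ->] ->] ->] [-> ->]; rewrite !eqxx.
Qed.

Lemma mpolyX6 a b c d e f :
  mpolyX C (mnm6 a b c d e f) = x 0 ^+ a * (x 1 ^+ b * (x 2 ^+ c * (x 3 ^+ d * (x 4 ^+ e * x 5 ^+ f)))).
Proof.
rewrite mpolyXE_id.
transitivity (\prod_(j < 6) x j ^+ nth 0%N [:: a; b; c; d; e; f] j).
  by apply: eq_bigr => j _; rewrite /ucoord inord_val mnm_tnth (tnth_nth 0%N).
by rewrite !big_ord_recl big_ord0 mulr1.
Qed.

Lemma shifted_X i p : shifted i (mpolyX C p) =
  \prod_(j < 6) ((x j)%:P + (shift_direction i x j)%:P * 'X) ^+ coo p j.
Proof.
rewrite /shifted mmapX /mmap1; apply: eq_bigr => j _; congr (_ ^+ _).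
by rewrite /coo inord_val.
Qed.

Lemma coef_shifted i f m nu :
  mcoeff nu (shifted i f)`_m = \sum_(p <- msupp f) mcoeff p f * mcoeff nu (shifted i (mpolyX C p))`_m.
Proof.
have e : (shifted i f)`_m = \sum_(p <- msupp f) mpolyC 6 (mcoeff p f) * (shifted i (mpolyX C p))`_m.
  have := @coef_mmap 6 C MP (polyC \o @mpolyC 6 C) (fun j : 'I_6 => (x j)%:P + (shift_direction i x
      j)%:P * 'X) f m.
  move=> H; refine (etrans H _).  apply: eq_bigr => p _.
  rewrite /= coefCM.
  by rewrite /shifted mmapX.
rewrite [LHS](congr1 (mcoeff nu) e) (raddf_sum (mcoeff nu)).
apply: eq_bigr => p _.
exact: mcoeffCM.
Qed.

Lemma shifted0_X p : shifted 0 (mpolyX C p) =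
  \sum_(h < (coo p 0).+1) \sum_(i < (coo p 1).+1) \sum_(j < (coo p 3).+1)
    (('C(coo p 0, h) * 'C(coo p 1, i) * 'C(coo p 3, j))%:R
       * mpolyX C (mnm6 h i (coo p 2 + (coo p 1 - i)) j (coo p 4 + (coo p 3 - j)) (coo p 5)))%:P
      * 'X^(coo p 0 - h + (coo p 1 - i) + (coo p 3 - j)).
Proof.
refine (etrans (shifted_X 0 p) (etrans (prod_ord6 (fun j =>
  ((x j)%:P + (shift_direction 0 x j)%:P * 'X) ^+ coo p j)) _)).
rewrite /shift_direction /=.
move: (coo p 0) (coo p 1) (coo p 2) (coo p 3) (coo p 4) (coo p 5) => p0 p1 p2 p3 p4 p5.
under eq_bigr => h _ do under eq_bigr => i _ do under eq_bigr => j _ do rewrite mpolyX6.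
exact: expand_shift3.
Qed.
(** A factor x21 may become 1, x31 may become x32 and x41 may become x42, each change costing one
    power of the parameter. The equations are this balance, written without truncated
    subtraction. *)
Lemma coef_shifted0 p m n0 n1 n2 n3 n4 n5 :
  mcoeff (mnm6 n0 n1 n2 n3 n4 n5) (shifted 0 (mpolyX C p))`_m =
  ('C(coo p 0, n0) * 'C(coo p 1, n1) * 'C(coo p 3, n3) *
  [&& coo p 1 + coo p 2 == n1 + n2, coo p 3 + coo p 4 == n3 + n4, coo p 5 == n5
    & coo p 0 + coo p 1 + coo p 3 == n0 + n1 + n3 + m])%N%:R.
Proof.
rewrite shifted0_X.
move: (coo p 0) (coo p 1) (coo p 2) (coo p 3) (coo p 4) (coo p 5) => p0 p1 p2 p3 p4 p5.
have H := @coef_sum3 MP p0.+1 p1.+1 p3.+1 (fun h i j => ('C(p0, h) * 'C(p1, i) * 'C(p3, j))%:R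
       * mpolyX C (mnm6 h i (p2 + (p1 - i)) j (p4 + (p3 - j)) p5))
    (fun h i j => p0 - h + (p1 - i) + (p3 - j))%N m.
refine (etrans (congr1 (mcoeff _) H) _) => {H}.
rewrite (raddf_sum (mcoeff _)).
have -> : ('C(p0, n0) * 'C(p1, n1) * 'C(p3, n3) *
   [&& p1 + p2 == n1 + n2, p3 + p4 == n3 + n4, p5 == n5 & p0 + p1 + p3 == n0 + n1 + n3 + m]
  = 'C(p0, n0) * 'C(p1, n1) * 'C(p3, n3) * [&& p2 + (p1 - n1) == n2,
   p4 + (p3 - n3) == n4, p5 == n5 & m == p0 - n0 + (p1 - n1) + (p3 - n3)])%N.
  case: (ltnP p0 n0) => h0; first by rewrite bin_small.
  case: (ltnP p1 n1) => h1; first by rewrite (bin_small h1) muln0.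
  case: (ltnP p3 n3) => h3; first by rewrite (bin_small h3) muln0.
  congr (_ * nat_of_bool _)%N; lia.
rewrite -(binomial_collapse3 p0 p1 p3 n0 n1 n3 (fun h i j => [&& p2 + (p1 - i) == n2,
   p4 + (p3 - j) == n4, p5 == n5 & m == p0 - h + (p1 - i) + (p3 - j)]%N : nat)).
rewrite natr_sum; apply: eq_bigr => h _; rewrite natr_sum (raddf_sum (mcoeff _)).
apply: eq_bigr => i _; rewrite natr_sum (raddf_sum (mcoeff _)); apply: eq_bigr => j _.
rewrite mulr_natl -mulrnA; refine (etrans (mcoeffMn _ _ _) _).
rewrite mcoeffX mnm6_eqE -mulrnA; congr (_%:R).
rewrite mulnCA -[in RHS]mulnA !mulnb; congr (_ * nat_of_bool _)%N.
by do 7 case: eqP => _.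
Qed.

Lemma shifted1_X p : shifted 1 (mpolyX C p) =
  \sum_(h < (coo p 2).+1) \sum_(i < (coo p 4).+1) \sum_(j < 1)
    (('C(coo p 2, h) * 'C(coo p 4, i) * 'C(0, j))%:R
       * mpolyX C (mnm6 (coo p 0) (coo p 1) h (coo p 3) i (coo p 5 + (coo p 4 - i))))%:P
      * 'X^(coo p 2 - h + (coo p 4 - i) + (0 - j)).
Proof.
refine (etrans (shifted_X 1 p) (etrans (prod_ord6 (fun j =>
  ((x j)%:P + (shift_direction 1 x j)%:P * 'X) ^+ coo p j)) _)).
rewrite /shift_direction /=.
move: (coo p 0) (coo p 1) (coo p 2) (coo p 3) (coo p 4) (coo p 5) => p0 p1 p2 p3 p4 p5.
under eq_bigr => h _ do under eq_bigr => i _ do under eq_bigr => j _ do rewrite mpolyX6.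
exact: expand_shift2.
Qed.
Lemma coef_shifted1 p m n0 n1 n2 n3 n4 n5 :
  mcoeff (mnm6 n0 n1 n2 n3 n4 n5) (shifted 1 (mpolyX C p))`_m =
  ('C(coo p 2, n2) * 'C(coo p 4, n4) *
  [&& coo p 0 == n0, coo p 1 == n1, coo p 3 == n3, coo p 4 + coo p 5 == n4 + n5
    & coo p 2 + coo p 4 == n2 + n4 + m])%N%:R.
Proof.
rewrite shifted1_X.
move: (coo p 0) (coo p 1) (coo p 2) (coo p 3) (coo p 4) (coo p 5) => p0 p1 p2 p3 p4 p5.
have H := @coef_sum3 MP p2.+1 p4.+1 1 (fun h i j => ('C(p2, h) * 'C(p4, i) * 'C(0, j))%:R
       * mpolyX C (mnm6 p0 p1 h p3 i (p5 + (p4 - i))))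
    (fun h i j => p2 - h + (p4 - i) + (0 - j))%N m.
refine (etrans (congr1 (mcoeff _) H) _) => {H}.
rewrite (raddf_sum (mcoeff _)).
have -> : ('C(p2, n2) * 'C(p4, n4) *
   [&& p0 == n0, p1 == n1, p3 == n3, p4 + p5 == n4 + n5 & p2 + p4 == n2 + n4 + m]
  = 'C(p2, n2) * 'C(p4, n4) * 'C(0, 0) * [&& p0 == n0, p1 == n1, p3 == n3, p5 + (p4 - n4) == n5 & m ==
      p2 - n2 + (p4 - n4) + (0 - 0)])%N.
  case: (ltnP p2 n2) => h0; first by rewrite bin_small.
  case: (ltnP p4 n4) => h1; first by rewrite (bin_small h1) muln0.
  rewrite bin0 muln1; congr (_ * nat_of_bool _)%N; lia.
rewrite -(binomial_collapse3 p2 p4 0 n2 n4 0 (fun h i j => [&& p0 == n0, p1 == n1, p3 == n3, p5 + (p4 -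
    i) == n5 & m == p2 - h + (p4 - i) + (0 - j)]%N : nat)).
rewrite natr_sum; apply: eq_bigr => h _; rewrite natr_sum (raddf_sum (mcoeff _)).
apply: eq_bigr => i _; rewrite natr_sum (raddf_sum (mcoeff _)); apply: eq_bigr => j _.
rewrite mulr_natl -mulrnA; refine (etrans (mcoeffMn _ _ _) _).
rewrite mcoeffX mnm6_eqE -mulrnA; congr (_%:R).
rewrite mulnCA -[in RHS]mulnA !mulnb; congr (_ * nat_of_bool _)%N.
by have := ltn_ord j; rewrite ltnS leqn0 => /eqP ->; do 7 case: eqP => _.
Qed.

Lemma shifted2_X p : shifted 2 (mpolyX C p) =
  \sum_(h < (coo p 5).+1) \sum_(i < 1) \sum_(j < 1)
    (('C(coo p 5, h) * 'C(0, i) * 'C(0, j))%:R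
       * mpolyX C (mnm6 (coo p 0) (coo p 1) (coo p 2) (coo p 3) (coo p 4) h))%:P
      * 'X^(coo p 5 - h + (0 - i) + (0 - j)).
Proof.
refine (etrans (shifted_X 2 p) (etrans (prod_ord6 (fun j =>
  ((x j)%:P + (shift_direction 2 x j)%:P * 'X) ^+ coo p j)) _)).
rewrite /shift_direction /=.
move: (coo p 0) (coo p 1) (coo p 2) (coo p 3) (coo p 4) (coo p 5) => p0 p1 p2 p3 p4 p5.
under eq_bigr => h _ do under eq_bigr => i _ do under eq_bigr => j _ do rewrite mpolyX6.
exact: expand_shift1.
Qed.
Lemma coef_shifted2 p m n0 n1 n2 n3 n4 n5 :
  mcoeff (mnm6 n0 n1 n2 n3 n4 n5) (shifted 2 (mpolyX C p))`_m =
  ('C(coo p 5, n5) *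
  [&& coo p 0 == n0, coo p 1 == n1, coo p 2 == n2, coo p 3 == n3, coo p 4 == n4
    & coo p 5 == n5 + m])%N%:R.
Proof.
rewrite shifted2_X.
move: (coo p 0) (coo p 1) (coo p 2) (coo p 3) (coo p 4) (coo p 5) => p0 p1 p2 p3 p4 p5.
have H := @coef_sum3 MP p5.+1 1 1 (fun h i j => ('C(p5, h) * 'C(0, i) * 'C(0, j))%:R
       * mpolyX C (mnm6 p0 p1 p2 p3 p4 h))
    (fun h i j => p5 - h + (0 - i) + (0 - j))%N m.
refine (etrans (congr1 (mcoeff _) H) _) => {H}.
rewrite (raddf_sum (mcoeff _)).
have -> : ('C(p5, n5) *
   [&& p0 == n0, p1 == n1, p2 == n2, p3 == n3, p4 == n4 & p5 == n5 + m]
  = 'C(p5, n5) * 'C(0, 0) * 'C(0, 0) * [&& p0 == n0, p1 == n1, p2 == n2, p3 == n3, p4 == n4 & m == p5 -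
      n5 + (0 - 0) + (0 - 0)])%N.
  case: (ltnP p5 n5) => h0; first by rewrite bin_small.
  rewrite bin0 !muln1; congr (_ * nat_of_bool _)%N; lia.
rewrite -(binomial_collapse3 p5 0 0 n5 0 0 (fun h i j => [&& p0 == n0, p1 == n1, p2 == n2, p3 == n3, p4
    == n4 & m == p5 - h + (0 - i) + (0 - j)]%N : nat)).
rewrite natr_sum; apply: eq_bigr => h _; rewrite natr_sum (raddf_sum (mcoeff _)).
apply: eq_bigr => i _; rewrite natr_sum (raddf_sum (mcoeff _)); apply: eq_bigr => j _.
rewrite mulr_natl -mulrnA; refine (etrans (mcoeffMn _ _ _) _).
rewrite mcoeffX mnm6_eqE -mulrnA; congr (_%:R).
rewrite mulnCA -[in RHS]mulnA !mulnb; congr (_ * nat_of_bool _)%N.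
by have := ltn_ord j; have := ltn_ord i; rewrite !ltnS !leqn0 => /eqP -> /eqP ->; do 7 case: eqP => _.
Qed.

End ShiftedCoefficients.

(** The sum of w p (1 + X)^(k p) is (1 + X)^k0 times a polynomial of degree at most c. The
    hypothesis makes it divisible by X^(c+1), which is coprime to 1 + X, so the second factor is
    zero. *)
Lemma binomial_inversion (F : fieldType) (T : eqType) (s : seq T) (w : T -> F) (k : T -> nat)
    (k0 c : nat) :
  (forall p, p \in s -> w p != 0 -> (k0 <= k p <= k0 + c)%N) ->
  (forall j, (j <= c)%N -> \sum_(p <- s) w p * ('C(k p, j))%:R = 0) ->
  forall q, \sum_(p <- s | k p == q) w p = 0.
Proof.
move=> hk hj q.
pose g : {poly F} := \sum_(p <- s) w p *: ('X + 1) ^+ k p.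
pose g1 : {poly F} := \sum_(p <- s) w p *: ('X + 1) ^+ (k p - k0).
have eg : g = ('X + 1) ^+ k0 * g1.
  rewrite /g /g1 mulr_sumr !big_seq; apply: eq_bigr => p ps.
  case: (eqVneq (w p) 0) => [->|wp]; first by rewrite !scale0r mulr0.
  have /andP [h _] := hk p ps wp.
  by rewrite -scalerAr -exprD subnKC.
have coef_pow n j : (('X + 1 : {poly F}) ^+ n)`_j = 'C(n, j)%:R.
  rewrite addrC exprDn coef_sum (eq_bigr (fun i : 'I_n.+1 => (nat_of_ord i == j)%:R * 'C(n, j)%:R)).
    case: (ltnP j n.+1) => h.
      rewrite (bigD1 (Ordinal h)) //= eqxx mul1r big1 ?addr0 // => i.
      by rewrite -val_eqE /= => /negPf ->; rewrite mul0r.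
    by rewrite bin_small // big1 // => i _; rewrite mulr0.
  move=> i _; rewrite expr1n mul1r coefMn coefXn.
  by rewrite [(nat_of_ord i == j)]eq_sym; case: eqP => [->|_]; rewrite ?mul1r ?mul0r ?mul0rn.
have dvd : ('X^(c.+1) : {poly F}) %| g1.
  rewrite -(@Gauss_dvdpr _ _ (('X + 1) ^+ k0)) -?eg.
    rewrite -[g](poly_take_drop c.+1) dvdp_add ?dvdp_mulIr //.
    rewrite (_ : take_poly _ _ = 0) ?dvdp0 //; apply/polyP => j.
    rewrite coef_take_poly coef0; case: ltnP => // hjc.
    rewrite /g coef_sum -[RHS](hj j hjc); apply: eq_bigr => p _.
    by rewrite coefZ coef_pow.
  apply: coprimep_expl; apply: coprimep_expr.
  rewrite coprimep_sym (_ : 'X = 'X - 0%:P); last by rewrite polyC0 subr0.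
  by rewrite coprimep_XsubC rootE polyC0 subr0 !hornerE oner_neq0.
have g10 : g1 = 0.
  apply/eqP/negbNE/negP => ne; have := dvdp_leq ne dvd; rewrite size_polyXn.
  apply/negP; rewrite -ltnNge ltnS /g1 big_seq; apply: (leq_trans (size_sum _ _ _)).
  apply/bigmax_leqP_seq => p ps _.
  case: (eqVneq (w p) 0) => [->|wp]; first by rewrite scale0r size_poly0.
  have /andP [h h'] := hk p ps wp.
  apply: (leq_trans (size_scale_leq _ _)).
  apply: (leq_trans (size_poly_exp_leq _ _)); rewrite -polyC1 size_XaddC /= mul1n; lia.
(* Substituting X - 1 for X turns the powers of 1 + X into monomials, whose coefficients are the
   sums sought. *)
have := congr1 (fun r : {poly F} => (r \Po ('X - 1))`_(q - k0)) g10.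
rewrite comp_poly0 coef0 /g1 raddf_sum coef_sum /= => h0.
case: (leqP k0 q) => hq; last first.
  rewrite big_seq_cond big1 // => p /andP [ps /eqP kp]; apply/eqP/negbNE/negP => wp.
  by have := hk p ps wp; lia.
rewrite -[RHS]h0 big_mkcond !big_seq; apply: eq_bigr => p ps.
rewrite comp_polyZ coefZ rmorphXn rmorphD /= comp_polyX rmorph1 subrK coefXn.
case: (eqVneq (w p) 0) => [->|wp]; first by rewrite mul0r; case: ifP.
have /andP [h _] := hk p ps wp.
by rewrite (_ : (q - k0 == k p - k0)%N = (k p == q)); [case: ifP; rewrite ?mulr1 ?mulr0|lia].
Qed.

Section GelfandTsetlin.
Variables (R : realType) (l : nat) (f : mpoly 6 R[i]) (a : multinom 6).
Hypothesis bound : forall i m, (i < 3)%N -> (l < m)%N -> (shifted i f)`_m = 0.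
Hypothesis fa : mcoeff a f != 0.
(* a is the largest exponent for the lexicographic order that compares x43
   first, then x42, x41 and x32. *)
Hypothesis top5 : forall p, p \in msupp f -> (coo p 5 <= coo a 5)%N.
Hypothesis top4 : forall p, p \in msupp f -> coo p 5 = coo a 5 -> (coo p 4 <= coo a 4)%N.
Hypothesis top2 : forall p, p \in msupp f -> coo p 5 = coo a 5 -> coo p 4 = coo a 4 ->
  coo p 3 = coo a 3 -> (coo p 2 <= coo a 2)%N.

Let a_supp : a \in msupp f. Proof. by rewrite mcoeff_msupp. Qed.

(** The contradiction behind each inequality below: if it failed, the degree bound would annihilate
    a combination of coefficients of f to which only a contributes. *)
Lemma single_exponent (N : multinom 6 -> nat) :
  (forall p, p \in msupp f -> N p != 0%N ->
     forall j, (j < 6)%N -> coo p j = coo a j) -> N a != 0%N ->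
  \sum_(p <- msupp f) mcoeff p f * (N p)%:R != 0.
Proof.
move=> h Na; rewrite (bigD1_seq a) ?msupp_uniq //= big1_seq ?addr0.
  by rewrite mulf_neq0 ?pnatr_eq0.
move=> p /andP [ne pf]; case: (eqVneq (N p) 0%N) => [->|Np]; first by rewrite mulr0.
case/eqP: ne; rewrite (mnm6_eta p) (mnm6_eta a).
by rewrite !(h p pf Np).
Qed.

Let coef0 m n0 n1 n2 n3 n4 n5 : (l < m)%N ->
  \sum_(p <- msupp f) mcoeff p f * ('C(coo p 0, n0) * 'C(coo p 1, n1) * 'C(coo p 3, n3) *
  [&& coo p 1 + coo p 2 == n1 + n2, coo p 3 + coo p 4 == n3 + n4, coo p 5 == n5
    & coo p 0 + coo p 1 + coo p 3 == n0 + n1 + n3 + m])%N%:R = 0.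
Proof.
move=> hm; refine (etrans _ (etrans (congr1 (mcoeff (mnm6 n0 n1 n2 n3 n4 n5))
  (@bound 0 m isT hm)) (mcoeff0 _ _))).
refine (etrans _ (esym (coef_shifted 0 f m _))).
by apply: eq_bigr => p _; rewrite coef_shifted0.
Qed.

Let coef1 m n0 n1 n2 n3 n4 n5 : (l < m)%N ->
  \sum_(p <- msupp f) mcoeff p f * ('C(coo p 2, n2) * 'C(coo p 4, n4) *
  [&& coo p 0 == n0, coo p 1 == n1, coo p 3 == n3, coo p 4 + coo p 5 == n4 + n5
    & coo p 2 + coo p 4 == n2 + n4 + m])%N%:R = 0.
Proof.
move=> hm; refine (etrans _ (etrans (congr1 (mcoeff (mnm6 n0 n1 n2 n3 n4 n5))
  (@bound 1 m isT hm)) (mcoeff0 _ _))).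
refine (etrans _ (esym (coef_shifted 1 f m _))).
by apply: eq_bigr => p _; rewrite coef_shifted1.
Qed.

Let coef2 m n0 n1 n2 n3 n4 n5 : (l < m)%N ->
  \sum_(p <- msupp f) mcoeff p f * ('C(coo p 5, n5) *
  [&& coo p 0 == n0, coo p 1 == n1, coo p 2 == n2, coo p 3 == n3, coo p 4 == n4
    & coo p 5 == n5 + m])%N%:R = 0.
Proof.
move=> hm; refine (etrans _ (etrans (congr1 (mcoeff (mnm6 n0 n1 n2 n3 n4 n5))
  (@bound 2 m isT hm)) (mcoeff0 _ _))).
refine (etrans _ (esym (coef_shifted 2 f m _))).
by apply: eq_bigr => p _; rewrite coef_shifted2.
Qed.

Let bin_pos n m : 'C(n, m) != 0%N -> (m <= n)%N.
Proof. by rewrite -lt0n bin_gt0. Qed.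

Let ext6 p : coo p 0 = coo a 0 -> coo p 1 = coo a 1 -> coo p 2 = coo a 2 ->
  coo p 3 = coo a 3 -> coo p 4 = coo a 4 -> coo p 5 = coo a 5 ->
  forall j, (j < 6)%N -> coo p j = coo a j.
Proof. by move=> ? ? ? ? ? ? [|[|[|[|[|[|]]]]]]. Qed.

Lemma GT_x43 : (coo a 5 <= l)%N.
Proof.
rewrite leqNgt; apply/negP => h.
have /eqP := coef2 (coo a 0) (coo a 1) (coo a 2) (coo a 3) (coo a 4) 0 h.
apply/negP/single_exponent; last by rewrite bin0 !eqxx.
move=> p pf; rewrite bin0 mul1n eqb0 negbK => hp.
by apply: ext6; lia.
Qed.

(** The binomial coefficient forces p2 >= a2, hence p4 <= a4 by the balance, while p5 <= a5 gives p4
    >= a4; only p = a remains. *)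
Lemma GT_x42 : (coo a 4 <= l)%N.
Proof.
rewrite leqNgt; apply/negP => h.
have /eqP := coef1 (coo a 0) (coo a 1) (coo a 2) (coo a 3) 0 (coo a 4 + coo a 5) h.
apply/negP/single_exponent; last by rewrite bin0 binn !eqxx addn0 eqxx.
move=> p pf; rewrite bin0 muln1 muln_eq0 negb_or => /andP [/bin_pos h2].
case: and5P => // -[/eqP ? /eqP ? /eqP ? /eqP h45 /eqP h24] _.
have := top5 pf => h5.
by apply: ext6 => //; lia.
Qed.

Lemma GT_x41 : (coo a 3 <= l)%N.
Proof.
rewrite leqNgt; apply/negP => h.
have /eqP := coef0 (coo a 0) (coo a 1) (coo a 2) 0 (coo a 3 + coo a 4) (coo a 5) h.
apply/negP/single_exponent; last by rewrite bin0 !binn !eqxx addn0 eqxx.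
move=> p pf; rewrite bin0 muln1 !muln_eq0 !negb_or => /andP [/andP [/bin_pos h0 /bin_pos h1]].
case: and4P => // -[/eqP h12 /eqP h34 /eqP h5 /eqP h013] _.
have := top4 pf h5 => h4.
by apply: ext6 => //; lia.
Qed.

(** Here several exponents share the balance, with p4 between a4 and a4 + a5 because p5 <= a5. If
    the inequality failed, the coefficients of order a2 + a4 - j would vanish for all j <= a5, just
    enough relations for [binomial_inversion] to isolate p4 = a4. *)
Lemma GT_x32 : (coo a 2 + coo a 4 <= l + coo a 5)%N.
Proof.
rewrite leqNgt; apply/negP => h.
pose N p := [&& coo p 0 == coo a 0, coo p 1 == coo a 1, coo p 3 == coo a 3,
  coo p 4 + coo p 5 == coo a 4 + coo a 5 & coo p 2 + coo p 4 == coo a 2 + coo a 4]%N.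
have : \sum_(p <- msupp f | coo p 4 == coo a 4) mcoeff p f * (N p)%:R = 0.
  apply: (@binomial_inversion _ _ _ _ _ (coo a 4) (coo a 5)) => [p pf|j hj].
    rewrite /N; case: and5P => [[_ _ _ /eqP h45 _] _|_]; last by rewrite mulr0 eqxx.
    by have := top5 pf; lia.
  have hm : (l < coo a 2 + coo a 4 - j)%N by lia.
  rewrite -[RHS](coef1 (coo a 0) (coo a 1) 0 (coo a 3) j (coo a 4 + coo a 5 - j) hm).
  apply: eq_bigr => p _; rewrite -mulrA -natrM bin0 mul1n mulnC; congr (_ * (_ * nat_of_bool _)%N%:R).
  rewrite /N; lia.
apply/eqP; rewrite big_mkcond /=.
rewrite (eq_bigr (fun p => mcoeff p f * ((coo p 4 == coo a 4) * N p)%N%:R)); last first.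
  by move=> p _; case: eqP => _; rewrite ?mul1n ?mul0n ?mulr0.
apply: single_exponent; last by rewrite /N !eqxx.
move=> p pf; rewrite mulnb eqb0 negbK /N => hp.
by apply: ext6; lia.
Qed.

Lemma GT_x31 : (coo a 1 + coo a 3 <= l + coo a 4)%N.
Proof.
rewrite leqNgt; apply/negP => h.
pose N p := ('C(coo p 0, coo a 0) * [&& coo p 1 + coo p 2 == coo a 1 + coo a 2,
  coo p 3 + coo p 4 == coo a 3 + coo a 4, coo p 5 == coo a 5
  & coo p 0 + coo p 1 + coo p 3 == coo a 0 + coo a 1 + coo a 3])%N.
have : \sum_(p <- msupp f | coo p 3 == coo a 3) mcoeff p f * (N p)%:R = 0.
  apply: (@binomial_inversion _ _ _ _ _ (coo a 3) (coo a 4)) => [p pf|j hj].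
    rewrite /N; case: and4P => [[_ /eqP h34 /eqP h5 _] _|_]; last by rewrite muln0 mulr0 eqxx.
    by have := top4 pf h5; lia.
  have hm : (l < coo a 1 + coo a 3 - j)%N by lia.
  rewrite -[RHS](coef0 (coo a 0) 0 (coo a 1 + coo a 2) j (coo a 3 + coo a 4 - j) (coo a 5) hm).
  apply: eq_bigr => p _; rewrite -mulrA -natrM bin0 muln1 /N; congr (_ * _%:R).
  by rewrite mulnAC; congr (_ * nat_of_bool _)%N; lia.
apply/eqP; rewrite big_mkcond /=.
rewrite (eq_bigr (fun p => mcoeff p f * ((coo p 3 == coo a 3) * N p)%N%:R)); last first.
  by move=> p _; case: eqP => _; rewrite ?mul1n ?mul0n ?mulr0.
apply: single_exponent; last by rewrite /N !eqxx binn.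
move=> p pf; rewrite /N !muln_eq0 !negb_or !eqb0 !negbK => /and3P [/eqP h3 /bin_pos h0 hp].
have h4 : coo p 4 = coo a 4 by lia.
have h5 : coo p 5 = coo a 5 by lia.
have := top2 pf h5 h4 h3 => h2.
by apply: ext6; lia.
Qed.

(** Two inversions in turn: the first isolates p3 = a3 for each i <= a2, and the second, over i,
    isolates p1 = a1. *)
Lemma GT_x21 : (coo a 0 + coo a 1 + coo a 3 <= l + coo a 2 + coo a 4)%N.
Proof.
rewrite leqNgt; apply/negP => h.
pose N p := [&& coo p 1 + coo p 2 == coo a 1 + coo a 2,
  coo p 3 + coo p 4 == coo a 3 + coo a 4, coo p 5 == coo a 5
  & coo p 0 + coo p 1 + coo p 3 == coo a 0 + coo a 1 + coo a 3]%N.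
have inv3 i : (i <= coo a 2)%N ->
    \sum_(p <- msupp f | coo p 3 == coo a 3) mcoeff p f * ('C(coo p 1, i) * N p)%N%:R = 0.
  move=> hi; apply: (@binomial_inversion _ _ _ _ _ (coo a 3) (coo a 4)) => [p pf|j hj].
    rewrite /N; case: and4P => [[_ /eqP h34 /eqP h5 _] _|_]; last by rewrite muln0 mulr0 eqxx.
    by have := top4 pf h5; lia.
  have hm : (l < coo a 0 + coo a 1 + coo a 3 - i - j)%N by lia.
  rewrite -[RHS](coef0 0 i (coo a 1 + coo a 2 - i) j (coo a 3 + coo a 4 - j) (coo a 5) hm).
  apply: eq_bigr => p _; rewrite -mulrA -natrM bin0 mul1n; congr (_ * _%:R).
  by rewrite mulnAC /N; congr (_ * nat_of_bool _)%N; lia.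
have : \sum_(p <- msupp f | coo p 1 == coo a 1) mcoeff p f * ((coo p 3 == coo a 3) * N p)%N%:R = 0.
  apply: (@binomial_inversion _ _ _ _ _ (coo a 1) (coo a 2)) => [p pf|j hj].
    rewrite mulnb mulf_eq0 negb_or pnatr_eq0 eqb0 negbK /N => /andP [_ hp].
    have h3 : coo p 3 = coo a 3 by lia.
    have h5 : coo p 5 = coo a 5 by lia.
    have h4 : coo p 4 = coo a 4 by lia.
    by have := top2 pf h5 h4 h3; lia.
  rewrite -[RHS](inv3 j hj) [RHS]big_mkcond; apply: eq_bigr => p _ /=.
  by case: eqP => _; rewrite ?mul1n ?mul0n ?mulr0 ?mul0r // -mulrA -natrM mulnC.
apply/eqP; rewrite big_mkcond /=.
rewrite (eq_bigr (fun p => mcoeff p f * ((coo p 1 == coo a 1) * ((coo p 3 == coo a 3) * N p))%N%:R));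
    last first.
  by move=> p _; case: eqP => _; rewrite ?mul1n ?mul0n ?mulr0.
apply: single_exponent; last by rewrite /N !eqxx.
move=> p pf; rewrite !mulnb eqb0 negbK /N => hp.
by apply: ext6; lia.
Qed.
End GelfandTsetlin.

(** * Sections attached to monomials in the variables *)

Definition flag_function (S : comNzRingType) (M : 'M[S]_4) (x : nat) : S :=
  let D I := minor M I (iota 1 (size I)) in
  nth 1 [:: D [:: 2]; D [:: 2; 3]; D [:: 3]; D [:: 1; 3];
    (D [:: 3%N] * D [:: 1; 2; 4]%N - D [:: 4%N] * D [:: 1; 2; 3]%N)%R;
    D [:: 2; 4]; D [:: 1; 3; 4]; D [:: 1; 4]; D [:: 1; 2; 4];
    D [:: 2; 3; 4]; D [:: 3; 4]; D [:: 4]; D [:: 1]; D [:: 1; 2]; D [:: 1; 2; 3]]%N x.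

Lemma map_flag_function (S T : comNzRingType) (g : {rmorphism S -> T}) (M : 'M[S]_4) x :
  g (flag_function M x) = flag_function (map_mx g M) x.
Proof.
have D I K : g (minor M I K) = minor (map_mx g M) I K.
  by rewrite /minor -det_map_mx; congr determinant; apply/matrixP => r c; rewrite !mxE.
do 15? [case: x => [|x]]; rewrite /flag_function /= ?rmorphB ?rmorphM ?D //.
by rewrite !nth_nil rmorph1.
Qed.

Lemma flag_function_unipotent (S : comNzRingType) (u : nat -> S) x :
  flag_function (lower_unipotent u) x
  = nth 1 [:: u 0%N; u 0%N * u 2%N - u 1%N; u 1%N; u 2%N; u 1%N * u 5%N - u 3%N;
              u 0%N * u 4%N - u 3%N; u 2%N * u 5%N - u 4%N; u 4%N; u 5%N;
              u 0%N * (u 2%N * u 5%N - u 4%N) - (u 1%N * u 5%N - u 3%N);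
              u 1%N * u 4%N - u 2%N * u 3%N; u 3%N] x.
Proof.
have entry r c : (r < 4)%N -> (c < 4)%N -> lower_unipotent u (inord r) (inord c)
  = nth 0 (nth [::] [:: [:: 1; 0; 0; 0]; [:: u 0%N; 1; 0; 0]; [:: u 1%N; u 2%N; 1; 0];
           [:: u 3%N; u 4%N; u 5%N; 1]] r) c.
  by move=> hr hc; rewrite mxE !inordK.
do 15? [case: x => [|x]]; rewrite /flag_function /= ?minor1 ?minor2 ?minor3 /= ?entry //=; try by ring.
by rewrite !nth_nil.
Qed.

(** Upper triangular b mixes a column only with earlier ones, so a minor on the first columns is
    multiplied by a leading principal minor of b; [deg] records which ones occur. *)
Lemma flag_function_borel (S : comNzRingType) (g b : 'M[S]_4) x : (x < 15)%N ->
  (forall i j : 'I_4, (j < i)%N -> b i j = 0) ->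
  flag_function (g *m b) x
  = (\prod_(i < 3) (\prod_(j < 4 | (j < i.+1)%N) b j j) ^+ deg x i) * flag_function g x.
Proof.
move=> hx tri.
pose o (i : nat) : 'I_4 := inord i.
have oE (i : nat) : (i < 4)%N -> o i = i :> nat by move=> h; rewrite inordK.
have z i j : (i < 4)%N -> (j < i)%N -> b (o i) (o j) = 0.
  by move=> hi hj; apply: tri; rewrite !oE //; lia.
have o_id (j : 'I_4) : o j = j by exact: inord_val.
have mul r c : (g *m b) r c = g r (o 0%N) * b (o 0%N) c + g r (o 1%N) * b (o 1%N) c
    + g r (o 2%N) * b (o 2%N) c + g r (o 3%N) * b (o 3%N) c.
  rewrite mxE (eq_bigr (fun j : 'I_4 => g r (o j) * b (o j) c)) => [|j _]; last by rewrite o_id.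
  by rewrite !big_ord_recl big_ord0 addr0 !addrA.
have weight i : (i < 3)%N -> \prod_(j < 4 | (j < i.+1)%N) b j j
    = nth 0 [:: b (o 0%N) (o 0%N); b (o 0%N) (o 0%N) * b (o 1%N) (o 1%N);
                b (o 0%N) (o 0%N) * b (o 1%N) (o 1%N) * b (o 2%N) (o 2%N)] i.
  move=> hi; rewrite (eq_bigr (fun j : 'I_4 => b (o j) (o j))) => [|j _]; last by rewrite o_id.
  rewrite big_mkcond !big_ord_recl big_ord0 /=.
  by case: i hi => [|[|[|i]]] //= _; rewrite !mulr1 ?mulrA.
rewrite !big_ord_recl big_ord0 /= !weight //=.
have z10 := z 1%N 0%N isT isT; have z20 := z 2%N 0%N isT isT; have z21 := z 2%N 1%N isT isT.
have z30 := z 3%N 0%N isT isT; have z31 := z 3%N 1%N isT isT; have z32 := z 3%N 2%N isT isT.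
move: x hx => [|[|[|[|[|[|[|[|[|[|[|[|[|[|[|x]]]]]]]]]]]]]]] //= _;
rewrite /flag_function /deg /= ?minor1 ?minor2 ?minor3 /= -?/(o _) !mul ?(z10, z20, z21, z30, z31, z32); ring.
Qed.

Section ExplicitSections.
Variable R : realType.
Local Notation C := R[i].
Local Notation GP := (mpoly (4 * 4) R[i]).

Definition generic_matrix : 'M[GP]_4 := vec_mx (\row_l mpolyX C (mnm1 l)).

Definition monomial_section (c : seq nat) : GP :=
  \prod_(x < 15) flag_function generic_matrix x ^+ nth 0%N c x.

Definition cmonP (c : seq nat) : mpoly 6 C := \prod_(x < 15) varP R x ^+ nth 0%N c x.

Lemma map_generic_matrix (S : comNzRingType) (f : {rmorphism C -> S}) (M : 'M[S]_4) :
  map_mx (mmap f (fun l => mxvec M 0 l)) generic_matrix = M.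
Proof.
rewrite /generic_matrix map_vec_mx; apply: (can_inj mxvecK); rewrite vec_mxK.
by apply/rowP => l; rewrite !mxE mmapX mmap1U.
Qed.

Lemma mmap_monomial_section (S : comNzRingType) (f : {rmorphism C -> S}) (M : 'M[S]_4) c :
  mmap f (fun l => mxvec M 0 l) (monomial_section c)
  = \prod_(x < 15) flag_function M x ^+ nth 0%N c x.
Proof.
rewrite /monomial_section rmorph_prod; apply: eq_bigr => x _.
by rewrite rmorphXn map_flag_function map_generic_matrix.
Qed.

Lemma evalG_monomial_section c g :
  evalG (monomial_section c) g = \prod_(x < 15) flag_function g x ^+ nth 0%N c x.
Proof. exact: mmap_monomial_section. Qed.

Lemma restrictP_monomial_section c : restrictP (monomial_section c) = cmonP c.
Proof.
rewrite /restrictP mmap_monomial_section; apply: eq_bigr => x _; congr (_ ^+ _).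
rewrite flag_function_unipotent; case: x => x /=.
by do 15? [case: x => [|x]].
Qed.

Lemma monomial_section_nonzero c : nonzero_on_G (monomial_section c).
Proof.
exists (lower_unipotent (fun j => totally_positive_point R (inord j))).
  exact: det_lower_unipotent.
rewrite -meval_restrictP restrictP_monomial_section rmorph_prod; apply/prodf_neq0 => x _.
by rewrite rmorphXn expf_neq0 // varP_totally_positive.
Qed.

Lemma monomial_section_is_section k c : (forall i, (i < 3)%N -> degree c i = (2 * k)%N) ->
  is_section k (monomial_section c).
Proof.
move=> hc g b _ [_ tri]; rewrite !evalG_monomial_section.
pose w i := \prod_(j < 4 | (j < i.+1)%N) b j j.
have -> : lambda b ^+ k = \prod_(x < 15) (\prod_(i < 3) w i ^+ deg x i) ^+ nth 0%N c x.
  transitivity (\prod_(i < 3) w i ^+ degree c i).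
    rewrite /lambda big_add1 big_mkord /= -prodrXl; apply: eq_bigr => i _.
    by rewrite hc // exprM.
  under [RHS]eq_bigr => x _ do rewrite -prodrXl.
  rewrite exchange_big /=; apply: eq_bigr => i _.
  rewrite /degree (big_morph _ (exprD (w i)) (expr0 (w i))); apply: eq_bigr => x _.
  by rewrite mulnC exprM.
rewrite -big_split /=; apply: eq_bigr => x _.
by rewrite flag_function_borel // exprMn.
Qed.

Lemma is_section_sub k (F G : GP) (a : C) :
  is_section k F -> is_section k G -> is_section k (F - a *: G).
Proof.
move=> hF hG g b hg hb.
have e h : evalG (F - a *: G) h = evalG F h - a * evalG G h by rewrite /evalG mevalB mevalZ.
by rewrite !e hF // hG // mulrBr mulrCA.
Qed.

Lemma restrictP_sub (F G : GP) (a : C) :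
  restrictP (F - a *: G) = restrictP F - a *: restrictP G.
Proof.
have mB : restrictP (F - a *: G) = restrictP F - restrictP (a *: G) by exact: rmorphB.
rewrite mB; congr (_ - _); rewrite /restrictP mmapZ.
by rewrite -mul_mpolyC.
Qed.
End ExplicitSections.

(** Exponents of the highest monomials of the restrictions to U^-, as [lowest_varP] proves. Missing
    rows read as zero, which suits the constant 1. *)
Definition leads : seq (seq nat) :=
  [:: [:: 1; 0; 0; 0; 0; 0]; [:: 1; 0; 1; 0; 0; 0]; [:: 0; 1; 0; 0; 0; 0];
      [:: 0; 0; 1; 0; 0; 0]; [:: 0; 1; 0; 0; 0; 1]; [:: 1; 0; 0; 0; 1; 0];
      [:: 0; 0; 1; 0; 0; 1]; [:: 0; 0; 0; 0; 1; 0]; [:: 0; 0; 0; 0; 0; 1];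
      [:: 1; 0; 1; 0; 0; 1]; [:: 0; 1; 0; 0; 1; 0]; [:: 0; 0; 0; 1; 0; 0]]%N.

Definition lead (x j : nat) : nat := nth 0%N (nth [::] leads x) j.

Definition lead_exponent (c : seq nat) (j : nat) : nat := (\sum_(x < 15) nth 0 c x * lead x j)%N.

Lemma cluster_monomial_explicit c ls : size c = 15%N ->
  has (fun s => all (mem s.1.1) ls) states ->
  all (fun x => (nth 0%N c x == 0%N) || (x \in ls)) (iota 0 9) -> cluster_monomial c.
Proof.
move=> hc /hasP [s hs /allP hls] /all_iota h; rewrite /cluster_monomial hc eqxx andTb.
apply/hasP; exists s => //; apply/all_iota => x hx.
by case/orP: (h x hx) => [->//|/hls hxs]; apply/orP; right; exact: hxs.
Qed.

Ltac leaf_check := lazymatch goal with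
  | |- size _ = _ => reflexivity
  | |- is_true (has _ _) => vm_compute; reflexivity
  | |- is_true (all _ _) => rewrite /= ?eqxx ?orbT; reflexivity
  | |- _ => split; rewrite /degree /lead_exponent /deg /lead !big_ord_recl big_ord0 /=; lia
  end.

(** Within one cluster the exponents solve a linear system. The last three, which fill up the
    degrees, are slacks of the inequalities; the mutable ones are the differences whose signs the
    case distinctions fix. *)
Lemma Gelfand_Tsetlin_monomial (l a0 a1 a2 a3 a4 a5 : nat) :
  [&& a5 <= l, a4 <= l, a3 <= l, a2 + a4 <= l + a5, a1 + a3 <= l + a4
    & a0 + a1 + a3 <= l + a2 + a4]%N ->
  exists c, [/\ cluster_monomial c, forall i, (i < 3)%N -> degree c i = l
    & forall j, (j < 6)%N -> lead_exponent c j = nth 0%N [:: a0; a1; a2; a3; a4; a5] j].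
Proof.
move=> h.
have found ls c : size c = 15%N -> has (fun s => all (mem s.1.1) ls) states ->
    all (fun x => (nth 0%N c x == 0%N) || (x \in ls)) (iota 0 9) ->
    [/\ degree c 0 = l, degree c 1 = l & degree c 2 = l] ->
    [/\ lead_exponent c 0 = a0, lead_exponent c 1 = a1 & lead_exponent c 2 = a2] ->
    [/\ lead_exponent c 3 = a3, lead_exponent c 4 = a4 & lead_exponent c 5 = a5] ->
    exists c, [/\ cluster_monomial c, forall i, (i < 3)%N -> degree c i = l
      & forall j, (j < 6)%N -> lead_exponent c j = nth 0%N [:: a0; a1; a2; a3; a4; a5] j].
  move=> h1 h2 h3 [d0 d1 d2] [e0 e1 e2] [e3 e4 e5]; exists c; split.
  - exact: (cluster_monomial_explicit h1 h2 h3).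
  - by case=> [|[|[|]]].
  - by case=> [|[|[|[|[|[|]]]]]].
(* The cases are the fourteen clusters: the cones of the lead exponents of
   their monomials subdivide the Gelfand-Tsetlin cone. *)
case: (leqP a4 a1) => h41; case: (leqP a5 a2) => h52.
- case: (leqP a5 a0) => h50; last (apply: (found [:: 2; 3; 6] [:: 0; 0; a1 - a4; a2 - a5; 0; 0;
    a5 - a0; 0; 0; a0; a4; a3; l + a4 - (a1 + a3); l + a5 - (a2 + a4); l - a5])%N; leaf_check).
  case: (leqP a2 a0) => h20; last (apply: (found [:: 1; 2; 3] [:: 0; a0 - a5; a1 - a4; a2 - a0; 0; 0;
      0; 0; 0; a5; a4; a3; l + a4 - (a1 + a3); l + a5 - (a2 + a4); l - a5])%N; leaf_check).
  (apply: (found [:: 0; 1; 2] [:: a0 - a2; a2 - a5; a1 - a4; 0; 0; 0; 0; 0; 0; a5; a4; a3;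
      l + a2 + a4 - (a0 + a1 + a3); l + a5 - (a2 + a4); l - a5])%N; leaf_check).
- case: (leqP a2 a0) => h20; case: (leqP (a4 + a5) (a1 + a2)) => h1245.
  + (apply: (found [:: 0; 2; 4] [:: a0 - a2; 0; a1 + a2 - (a4 + a5); 0; a5 - a2; 0; 0; 0; 0; a2; a4;
      a3; l + a2 + a4 - (a0 + a1 + a3); l - a4; l - a5])%N; leaf_check).
  + (apply: (found [:: 0; 4; 8] [:: a0 - a2; 0; 0; 0; a1 - a4; 0; 0; 0; a4 + a5 - (a1 + a2); a2; a4;
      a3; l + a2 + a4 - (a0 + a1 + a3); l - a4; l - a5])%N; leaf_check).
  + (apply: (found [:: 2; 4; 6] [:: 0; 0; a1 + a2 - (a4 + a5); 0; a5 - a2; 0; a2 - a0; 0; 0; a0; a4;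
      a3; l + a4 - (a1 + a3); l - a4; l - a5])%N; leaf_check).
  + (apply: (found [:: 4; 6; 8] [:: 0; 0; 0; 0; a1 - a4; 0; a2 - a0; 0; a4 + a5 - (a1 + a2); a0; a4;
      a3; l + a4 - (a1 + a3); l - a4; l - a5])%N; leaf_check).
- case: (leqP a2 a0) => h20.
    case: (leqP (a2 + a4) (a0 + a1)) => h0124; last (apply: (found [:: 1; 5; 7] [:: 0; a2 - a5; 0; 0;
        0; a0 - a2; 0; a2 + a4 - (a0 + a1); 0; a5; a1; a3; l - a3; l + a5 - (a2 + a4); l - a5])%N;
            leaf_check).
    (apply: (found [:: 0; 1; 5] [:: a0 + a1 - (a2 + a4); a2 - a5; 0; 0; 0; a4 - a1; 0; 0; 0; a5; a1;
        a3; l + a2 + a4 - (a0 + a1 + a3); l + a5 - (a2 + a4); l - a5])%N; leaf_check).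
  case: (leqP a5 a0) => h50; last (apply: (found [:: 3; 6; 7] [:: 0; 0; 0; a2 - a5; 0; 0; a5 - a0;
      a4 - a1; 0; a0; a1; a3; l - a3; l + a5 - (a2 + a4); l - a5])%N; leaf_check).
  (apply: (found [:: 1; 3; 7] [:: 0; a0 - a5; 0; a2 - a0; 0; 0; 0; a4 - a1; 0; a5; a1; a3; l - a3;
      l + a5 - (a2 + a4); l - a5])%N; leaf_check).
- case: (leqP a2 a0) => h20; last (apply: (found [:: 6; 7; 8] [:: 0; 0; 0; 0; 0; 0; a2 - a0; a4 - a1;
    a5 - a2; a0; a1; a3; l - a3; l - a4; l - a5])%N; leaf_check).
  case: (leqP (a2 + a4) (a0 + a1)) => h0124; last (apply: (found [:: 5; 7; 8] [:: 0; 0; 0; 0; 0;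
      a0 - a2; 0; a2 + a4 - (a0 + a1); a5 - a2; a2; a1; a3; l - a3; l - a4; l - a5])%N; leaf_check).
  (apply: (found [:: 0; 5; 8] [:: a0 + a1 - (a2 + a4); 0; 0; 0; 0; a4 - a1; 0; 0; a5 - a2; a2; a1; a3;
      l + a2 + a4 - (a0 + a1 + a3); l - a4; l - a5])%N; leaf_check).
Qed.

Section Span.
Variable R : realType.
Local Notation C := R[i].
Local Notation MP := (mpoly 6 R[i]).

Definition rowz (v : nat -> int) : 'rV[int]_6 := \row_j v j.

(* The exponents increase for [lex_le] when they decrease for the
   lexicographic order that compares x43 first, then x42, x41, x32, x31, x21. *)
Definition lex_le (a b : 'rV[int]_6) : bool :=
  let u j := a 0 (inord j) in let v j := b 0 (inord j) in
  [|| v 5%N < u 5%N | (v 5%N == u 5%N) && [|| v 4%N < u 4%N | (v 4%N == u 4%N) && [|| v 3%N < u 3%N |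
      (v 3%N == u 3%N) &&
    [|| v 2%N < u 2%N | (v 2%N == u 2%N) && [|| v 1%N < u 1%N | (v 1%N == u 1%N) && (v 0%N <= u 0%N)]]]]].

Lemma row6P (a b : 'rV[int]_6) :
  (forall j, (j < 6)%N -> a 0 (inord j) = b 0 (inord j)) -> a = b.
Proof. by move=> h; apply/rowP => j; have := h j (ltn_ord j); rewrite inord_val. Qed.

Lemma lex_refl : reflexive lex_le.
Proof. by move=> a; rewrite /lex_le; lia. Qed.

Lemma lex_anti : antisymmetric lex_le.
Proof.
move=> a b h; apply: row6P => j hj; move: h; rewrite /lex_le.
by case: j hj => [|[|[|[|[|[|j]]]]]] // _; lia.
Qed.

Lemma lex_trans : transitive lex_le.
Proof. by move=> b a c; rewrite /lex_le; lia. Qed.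

Lemma lex_total : total lex_le.
Proof. by move=> a b; rewrite /lex_le; lia. Qed.

Lemma lex_add a b c : lex_le a b -> lex_le (a + c) (b + c).
Proof. by rewrite /lex_le !mxE !ltrD2r !lerD2r !(inj_eq (addIr _)). Qed.

Local Notation lowest := (@lowest_exponent R lex_le).

Lemma exponent_coo (m : multinom 6) j : exponent m 0 (inord j) = (coo m j)%:Z.
Proof. by rewrite mxE. Qed.

Lemma GT_lowest (l : nat) (f : MP) a :
  (forall i m, (i < 3)%N -> (l < m)%N -> (shifted i f)`_m = 0) -> lowest f a ->
  exists c, [/\ cluster_monomial c, forall i, (i < 3)%N -> degree c i = l
    & a = rowz (fun j => (lead_exponent c j)%:Z)].
Proof.
move=> bound /(lowest_coef (le := lex_le)) [m [-> fm top]].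
have lex p : p \in msupp f -> lex_le (exponent m) (exponent p) by rewrite mcoeff_msupp => /top.
have top5 p : p \in msupp f -> (coo p 5 <= coo m 5)%N.
  by move=> /lex; rewrite /lex_le !exponent_coo; lia.
have top4 p : p \in msupp f -> coo p 5 = coo m 5 -> (coo p 4 <= coo m 4)%N.
  by move=> /lex; rewrite /lex_le !exponent_coo; lia.
have top2 p : p \in msupp f -> coo p 5 = coo m 5 -> coo p 4 = coo m 4 -> coo p 3 = coo m 3 ->
    (coo p 2 <= coo m 2)%N.
  by move=> /lex; rewrite /lex_le !exponent_coo; lia.
have [|c [hc hd hl]] := @Gelfand_Tsetlin_monomial l (coo m 0) (coo m 1) (coo m 2) (coo m 3) (coo m 4)
    (coo m 5).
  have := GT_x43 bound fm; have := GT_x42 bound fm top5; have := GT_x41 bound fm top4.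
  have := GT_x32 bound fm top5; have := GT_x31 bound fm top4 top2.
  have := GT_x21 bound fm top4 top2; lia.
exists c; split=> //; apply: row6P => j hj; rewrite exponent_coo mxE inordK // hl //.
by case: j hj => [|[|[|[|[|[|j]]]]]].
Qed.

Lemma lowest_varP x : lowest (varP R x) (rowz (fun j => (lead x j)%:Z)).
Proof.
pose ltz (v w : nat -> int) := [|| w 5%N < v 5%N | (w 5%N == v 5%N) && [|| w 4%N < v 4%N | (w 4%N == v 4%N) &&
  [|| w 3%N < v 3%N | (w 3%N == v 3%N) && [|| w 2%N < v 2%N | (w 2%N == v 2%N) &&
  [|| w 1%N < v 1%N | (w 1%N == v 1%N) && (w 0%N < v 0%N)]]]]].
have L n : (n < 6)%N -> lowest (ucoord R n) (rowz (fun j => (j == n)%:Z)).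
  move=> hn; split=> [|m]; rewrite /ucoord msuppX.
    by exists (mnm1 (inord n)); rewrite ?inE //; apply/rowP => j;
        rewrite !mxE mnm1E -val_eqE /= inordK // eq_sym.
  rewrite inE => /eqP ->; rewrite (_ : exponent _ = rowz (fun j => (j == n)%:Z)) ?lex_refl //.
  by apply/rowP => j; rewrite !mxE mnm1E -val_eqE /= inordK // eq_sym.
have mulL P Q v w : lowest P (rowz v) -> lowest Q (rowz w) -> lowest (P * Q) (rowz (fun j => v j + w j)).
  move=> hP hQ; have -> : rowz (fun j => v j + w j) = rowz v + rowz w by apply/rowP => j; rewrite !mxE.
  exact: (lowest_mul lex_anti lex_trans lex_add hP hQ).
have subL P Q v w : lowest P (rowz v) -> lowest Q (rowz w) -> ltz v w -> lowest (P - Q) (rowz v).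
  move=> hP hQ hvw; apply: (lowest_add lex_anti lex_trans hP (b := rowz w)).
  - by case: hQ => -[m hm ->] h; split=> [|m']; rewrite ?(perm_mem (msuppN Q)) //; [exists m;
      rewrite ?(perm_mem (msuppN Q))|exact: h].
  - by move: hvw; rewrite /lex_le /ltz !mxE !inordK //; lia.
  - move=> /rowP e; move: hvw; rewrite /ltz.
    have e' j : (j < 6)%N -> v j = w j by move=> hj; have := e (Ordinal hj); rewrite !mxE.
    by rewrite !e' // !ltxx !andbF !orbF.
have eqL P v w : (forall j, (j < 6)%N -> v j = w j) -> lowest P (rowz v) -> lowest P (rowz w).
  by move=> h; rewrite (_ : rowz v = rowz w) //; apply/rowP => j; rewrite !mxE h.
have l0 := L 0%N isT; have l1 := L 1%N isT; have l2 := L 2%N isT.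
have l3 := L 3%N isT; have l4 := L 4%N isT; have l5 := L 5%N isT.
have l1e : lowest 1 (rowz (fun=> 0)).
  have e0 : exponent (@mnm0 6) = rowz (fun=> 0) by apply/rowP => j; rewrite !mxE mnm0E.
  split=> [|m]; rewrite msupp1; first by exists (@mnm0 6); rewrite ?inE.
  by rewrite inE => /eqP ->; rewrite e0 lex_refl.
do 12? [case: x => [|x]]; rewrite /varP.
- by apply: eqL l0 => -[|[|[|[|[|[|]]]]]].
- by apply: eqL (subL _ _ _ _ (mulL _ _ _ _ l0 l2) l1 isT) => -[|[|[|[|[|[|]]]]]].
- by apply: eqL l1 => -[|[|[|[|[|[|]]]]]].
- by apply: eqL l2 => -[|[|[|[|[|[|]]]]]].
- by apply: eqL (subL _ _ _ _ (mulL _ _ _ _ l1 l5) l3 isT) => -[|[|[|[|[|[|]]]]]].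
- by apply: eqL (subL _ _ _ _ (mulL _ _ _ _ l0 l4) l3 isT) => -[|[|[|[|[|[|]]]]]].
- by apply: eqL (subL _ _ _ _ (mulL _ _ _ _ l2 l5) l4 isT) => -[|[|[|[|[|[|]]]]]].
- by apply: eqL l4 => -[|[|[|[|[|[|]]]]]].
- by apply: eqL l5 => -[|[|[|[|[|[|]]]]]].
- have h := subL _ _ _ _ (mulL _ _ _ _ l2 l5) l4 isT.
  have h' := subL _ _ _ _ (mulL _ _ _ _ l1 l5) l3 isT.
  by apply: eqL (subL _ _ _ _ (mulL _ _ _ _ l0 h) h' isT) => -[|[|[|[|[|[|]]]]]].
- by apply: eqL (subL _ _ _ _ (mulL _ _ _ _ l1 l4) (mulL _ _ _ _ l2 l3) isT) => -[|[|[|[|[|[|]]]]]].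
- by apply: eqL l3 => -[|[|[|[|[|[|]]]]]].
- by apply: eqL l1e => j _; rewrite /lead [nth [::] _ _]nth_default ?nth_nil.
Qed.

Lemma lowest_cmonP c : lowest (cmonP R c) (rowz (fun j => (lead_exponent c j)%:Z)).
Proof.
have e0 : exponent (@mnm0 6) = 0 by apply/rowP => j; rewrite !mxE mnm0E.
have l1 : lowest 1 0.
  split=> [|m]; rewrite msupp1; first by exists (@mnm0 6); rewrite ?inE ?e0.
  by rewrite inE => /eqP ->; rewrite e0 lex_refl.
have mulL P Q a b : lowest P a -> lowest Q b -> lowest (P * Q) (a + b).
  by move=> hP hQ; exact: (lowest_mul lex_anti lex_trans lex_add hP hQ).
have -> : rowz (fun j => (lead_exponent c j)%:Z)
    = \sum_(x < 15) rowz (fun j => (lead x j)%:Z) *+ nth 0%N c x.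
  apply/rowP => j; rewrite mxE summxE /lead_exponent -[Posz _]natz natr_sum; apply: eq_bigr => x _.
  by rewrite mulmxnE mxE natz PoszM -[RHS]mulr_natl natz.
rewrite /cmonP; elim/big_rec2: _ => [//|x P a _ hP]; apply: (mulL _ _ _ _ _ hP).
elim: (nth 0%N c x) => [|n IH]; first by rewrite expr0 mulr0n.
by rewrite exprS mulrS; apply: (mulL _ _ _ _ _ IH); exact: lowest_varP.
Qed.

(** Each leading exponent of a variable is at most its total degree. The resulting box makes the
    reduction in [section_span] terminate. *)
Lemma lead_exponent_bound k c j : (forall i, (i < 3)%N -> degree c i = k) ->
  (lead_exponent c j <= 3 * k)%N.
Proof.
move=> hc; have -> : (3 * k = \sum_(i < 3) degree c i)%N.
  by rewrite (eq_bigr (fun=> k)) ?sum_nat_const ?card_ord // => i _; exact: hc.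
rewrite /lead_exponent /degree exchange_big /= leq_sum // => x _; rewrite -big_distrr /=.
rewrite leq_mul2l; apply/orP; right; rewrite !big_ord_recl big_ord0.
case: x => x /= hx; do 15? [case: x hx => [|x] hx] => //; by case: j => [|[|[|[|[|[|j]]]]]] //;
    rewrite /lead /= nth_nil.
Qed.

(* Each step removes the lowest exponent of the restriction, and these
   exponents stay in a fixed box. *)
Lemma section_span k (F : mpoly (4 * 4) C) : is_section k F ->
  exists cs (a : seq nat -> C), [/\ uniq cs,
    {in cs, forall c, cluster_monomial c /\ forall i, (i < 3)%N -> degree c i = (2 * k)%N},
    {in cs, forall c, a c != 0} & restrictP F = \sum_(c <- cs) a c *: cmonP R c].
Proof.
pose rl c := rowz (fun j => (lead_exponent c j)%:Z).
pose box (e : {ffun 'I_6 -> 'I_(3 * (2 * k)).+1}) : 'rV[int]_6 := \row_j (e j : nat)%:Z.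
pose mu l := #|[set e | lex_le l (box e)]|.
suff main n : forall F, is_section k F -> forall l, lowest (restrictP F) l -> (mu l < n)%N ->
  exists cs (a : seq nat -> C), [/\ uniq cs,
    {in cs, forall c, [/\ cluster_monomial c, forall i, (i < 3)%N -> degree c i = (2 * k)%N
      & lex_le l (rl c)]},
    {in cs, forall c, a c != 0} & restrictP F = \sum_(c <- cs) a c *: cmonP R c].
  move=> hF; case: (eqVneq (restrictP F) 0) => [->|nz].
    by exists [::], (fun=> 0); split=> //; rewrite big_nil.
  have [l hl] := lowest_exists lex_refl lex_trans lex_total nz.
  have [cs [a [u h ha e]]] := main _ F hF l hl (ltnSn _).
  by exists cs, a; split=> // c /h [].
elim: n => // n IH {}F hF l hl hn.
have [c [hc hdeg el]] := GT_lowest (fun i m hi hm => section_shifted_bound hF hi hm) hl.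
have [m [em fm top]] := lowest_coef hl.
have [m1 [em1 gm gtop]] := lowest_coef (lowest_cmonP c).
have emm : m1 = m by apply: exponent_inj; rewrite -em -em1.
rewrite {}emm {m1 em1} in gm.
pose r := mcoeff m (restrictP F) / mcoeff m (cmonP R c).
have r0 : r != 0 by rewrite mulf_neq0 // invr_eq0.
pose F' := F - r *: monomial_section R c.
have hF' : is_section k F' by apply: is_section_sub => //; exact: monomial_section_is_section.
have eF' : restrictP F' = restrictP F - r *: cmonP R c.
  by rewrite restrictP_sub restrictP_monomial_section.
case: (eqVneq (restrictP F') 0) => [e0|nz].
  exists [:: c], (fun=> r); split=> //.
  - by move=> d; rewrite inE => /eqP ->; split=> //; rewrite el lex_refl.
  - by rewrite big_seq1; apply/eqP; rewrite -subr_eq0 -eF' e0.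
have [l' hl'] := lowest_exists lex_refl lex_trans lex_total nz.
have [m' [em' fm' _]] := lowest_coef hl'.
have cF' p : mcoeff p (restrictP F') = mcoeff p (restrictP F) - r * mcoeff p (cmonP R c).
  by rewrite eF' mcoeffB mcoeffZ.
have ll' : lex_le l l'.
  case: (eqVneq (mcoeff m' (restrictP F)) 0) => h0; last by rewrite em'; apply: top.
  case: (eqVneq (mcoeff m' (cmonP R c)) 0) => h1; last by rewrite em' el; apply: gtop.
  by move: fm'; rewrite cF' h0 h1 mulr0 subr0 eqxx.
have nll' : ~~ lex_le l' l.
  apply/negP => h; have e : l = l' by apply: lex_anti; rewrite ll' h.
  have e' : m' = m by apply: exponent_inj; rewrite -em -em' e.
  by move: fm'; rewrite cF' e' /r divfK // subrr eqxx.
have [|cs [a [u h ha e]]] := IH F' hF' l' hl'.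
  apply: (@leq_trans (mu l)); last by rewrite -ltnS.
  apply/proper_card/properP; split.
    by apply/fintype.subsetP => e; rewrite !inE; exact: lex_trans.
  exists [ffun j : 'I_6 => inord (lead_exponent c j)]; rewrite !inE.
    rewrite (_ : box _ = l) ?lex_refl // el; apply/rowP => j.
    by rewrite !mxE ffunE inordK // ltnS lead_exponent_bound.
  rewrite (_ : box _ = l) // el; apply/rowP => j.
  by rewrite !mxE ffunE inordK // ltnS lead_exponent_bound.
(* The later monomials have leading exponents strictly beyond l, so c is not among them. *)
have nc : c \notin cs by apply/negP => /h [_ _]; rewrite /rl -el; apply/negP.
exists (c :: cs), (fun d => if d == c then r else a d); split.
- by rewrite /= nc.
- move=> d; rewrite inE => /orP [/eqP ->|/h [h1 h2 h3]]; split=> //.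
    by rewrite /rl -el lex_refl.
  exact: lex_trans ll' h3.
- by move=> d; rewrite inE; case: eqP => [->|_] //= /ha.
rewrite big_cons eqxx [X in _ + X](eq_big_seq (fun d => a d *: cmonP R d)).
  by rewrite -e eF' addrC subrK.
by move=> d hd; case: eqP => // ed; move: nc; rewrite -ed hd.
Qed.
End Span.

(** * Newton-Okounkov bodies *)

Import numFieldTopology.Exports.
Section Closure.
Local Open Scope classical_set_scope.
Variables (R : realType) (n : nat).

Lemma closureP (S : set 'rV[R]_n) x :
  closure S x <-> forall e : R, 0 < e -> exists2 y, S y & forall j, `|x 0 j - y 0 j| < e.
Proof.
split=> [h e e0|h B /nbhs_ballP [e /= e0 hB]].
  have [y [Sy [_ xy]]] := h _ (nbhsx_ballx x e e0).
  by exists y => // j; exact: xy.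
have [y Sy xy] := h e e0; exists y; split=> //; apply: hB; split=> // i j.
by rewrite ord1; exact: xy.
Qed.

Lemma closure_affine (A : 'M[int]_n) (b : 'rV[int]_n) (S T : set 'rV[R]_n) :
  let f x := x *m map_mx intr A + map_mx intr b in
  (forall x, S x -> T (f x)) -> forall x, closure S x -> closure T (f x).
Proof.
move=> f h x /closureP hx; apply/closureP => e e0.
(* A Lipschitz constant for the linear part; the summand 1 keeps it positive and the final estimate
   strict. *)
pose M : R := 1 + \sum_i \sum_j `|map_mx intr A i j|.
have M0 : 0 < M by rewrite ltr_pwDl // sumr_ge0 // => i _; apply: sumr_ge0 => j _.
have [y Sy hy] := hx (e / M) (divr_gt0 e0 M0).
exists (f y); first exact: h.
move=> j; rewrite /f ![fun_of_matrix (_ + _) _ _]mxE opprD addrACA subrr addr0 !mxE -sumrB.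
apply: (@le_lt_trans _ _ (\sum_i (e / M) * `|map_mx intr A i j : R|)).
  apply: (le_trans (ler_norm_sum _ _ _)); apply: ler_sum => i _.
  by rewrite -mulrBl normrM ler_wpM2r // ltW.
rewrite -mulr_sumr -mulrA gtr_pMr // mulrC ltr_pdivrMr // mul1r /M.
apply: (@le_lt_trans _ _ (\sum_i \sum_j `|map_mx intr A i j : R|)).
  by apply: ler_sum => i _; rewrite (bigD1 j) //= lerDl; apply: sumr_ge0.
by rewrite ltrDr.
Qed.

Lemma closure_linear_le (S : set 'rV[R]_n) (w : 'I_n -> R) (m : R) :
  (forall x, S x -> \sum_j w j * x 0 j <= m) ->
  forall x, closure S x -> \sum_j w j * x 0 j <= m.
Proof.
move=> h x /closureP hx; rewrite leNgt; apply/negP => lt.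
pose M : R := 1 + \sum_j `|w j|.
have M0 : 0 < M by rewrite ltr_pwDl // sumr_ge0.
have d0 : 0 < \sum_j w j * x 0 j - m by rewrite subr_gt0.
have [y Sy hy] := hx _ (divr_gt0 d0 M0).
have := h y Sy; rewrite leNgt => /negP; apply.
have : \sum_j w j * x 0 j - \sum_j w j * y 0 j < \sum_j w j * x 0 j - m; last by rewrite ltrD2l ltrN2.
set d := _ - m in d0 hy *; rewrite -sumrB.
apply: (@le_lt_trans _ _ (\sum_j `|w j| * (d / M))).
  apply: ler_sum => j _; rewrite -mulrBr; apply: (le_trans (ler_norm _)).
  by rewrite normrM ler_wpM2l // ltW.
by rewrite -mulr_suml mulrA ltr_pdivrMr // mulrC ltr_pM2l // /M ltrDr.
Qed.
End Closure.

Definition count_vector (xs : seq nat) : seq nat := mkseq (fun x => count_mem x xs) 15.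

(** A monomial of degree (1, 1, 1) has one factor of degree e_2, and either X, of degree e_1 + e_3,
    or one factor of each of the degrees e_1 and e_3. *)
Definition triples : seq (seq nat) :=
  [seq xs <- [seq y :: xz | y <- [:: 1; 3; 5; 7; 10; 13],
                xz <- [:: 4] :: [seq [:: x; z] | x <- [:: 0; 2; 11; 12], z <- [:: 6; 8; 9; 14]]]
     | all (fun x => all (fun y => ~~ incompatible x y) xs) xs]%N.

Definition point (st : state) (xs : seq nat) : 'rV[int]_6 := \sum_(x <- xs) grow st x.

Lemma triples_lt15 : all (all (fun x => x < 15)%N) triples.
Proof. by vm_compute. Qed.
Lemma triples_degree : all (fun xs => all (fun i => sumn [seq deg x i | x <- xs] == 1%N) (iota 0 3)) triples.
Proof. by vm_compute. Qed.

Lemma sum_count_mem (V : nmodType) (F : nat -> V) xs n : all (fun x => x < n)%N xs ->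
  \sum_(x < n) F x *+ count_mem (x : nat) xs = \sum_(x <- xs) F x.
Proof.
elim: xs => [|y xs IH] /=; first by rewrite big_nil big1.
case/andP => hy /IH e; rewrite big_cons -e -[F y]/(F (Ordinal hy)).
transitivity (\sum_(x < n) ((F x *+ (y == x :> nat)) + F x *+ count_mem (x : nat) xs)).
  by apply: eq_bigr => x _; rewrite mulrnDr.
rewrite big_split /=; congr (_ + _); rewrite (bigD1 (Ordinal hy)) //= eqxx mulr1n big1 ?addr0 //.
by move=> x; rewrite -val_eqE /= eq_sym => /negPf ->.
Qed.

Lemma gmon_count st xs : all (fun x => x < 15)%N xs -> gmon st (count_vector xs) = point st xs.
Proof.
move=> h; rewrite /gmon /point -(sum_count_mem _ h); apply: eq_bigr => x _.
by rewrite nth_mkseq.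
Qed.

Lemma degree_count xs i : all (fun x => x < 15)%N xs ->
  degree (count_vector xs) i = sumn [seq deg x i | x <- xs].
Proof.
move=> h; rewrite /degree sumnE big_map; apply: etrans (sum_count_mem (fun x => deg x i) h).
by apply: eq_bigr => x _; rewrite nth_mkseq // mulnC -[RHS]mulr_natr natn.
Qed.

Lemma triples_flatten_lt15 ps : all (mem triples) ps -> all (fun x => x < 15)%N (flatten ps).
Proof.
move=> hps; apply/allP => x /flattenP [xs hxs hx].
by have /allP /(_ _ hx) := allP triples_lt15 _ (allP hps _ hxs).
Qed.

Lemma degree_triples (ps : seq (seq nat)) i : (i < 3)%N -> all (mem triples) ps ->
  degree (count_vector (flatten ps)) i = size ps.
Proof.
move=> hi hps; rewrite degree_count; last first.
  exact: triples_flatten_lt15.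
elim: ps hps => //= p ps IH /andP [hp /IH e].
rewrite map_cat sumn_cat e; have /all_iota /(_ _ hi) /eqP -> := allP triples_degree _ hp.
by [].
Qed.

Lemma point_flatten st ps : point st (flatten ps) = \sum_(p <- ps) point st p.
Proof. exact: big_flatten. Qed.

Lemma triples_uniq : all uniq triples.
Proof. by vm_compute. Qed.

Lemma incompatible_mutable x y : incompatible x y -> (x < 9)%N && (y < 9)%N.
Proof.
case/hasP => r hr; have /andP [h1 h2] : (r.1.1.1 < 9)%N && (r.1.1.2 < 9)%N.
  by move: r hr; apply/allP; vm_compute.
by case/orP => /andP [/eqP <- /eqP <-]; rewrite h1 h2.
Qed.

(** When all three degrees are positive, c contains a factor of degree e_2 together with X or with
    factors of degrees e_1 and e_3. They lie in one cluster, hence form a triple, and removing it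
    lowers each degree by one. *)
Lemma cluster_monomial_split m c : cluster_monomial c -> (forall i, (i < 3)%N -> degree c i = m) ->
  exists ps, [/\ size ps = m, all (mem triples) ps & c = count_vector (flatten ps)].
Proof.
elim: m c => [|m IH] c hc hdeg.
  exists [::]; split=> //; case/andP: (hc) => /eqP sc _.
  apply: (@eq_from_nth _ 0%N); rewrite ?size_mkseq // sc => x hx; rewrite nth_mkseq //=.
  apply/eqP; apply: contraT => nz.
  have d i : (i < 3)%N -> deg x i = 0%N.
    move=> hi; have /eqP := hdeg i hi; rewrite /degree sum_nat_eq0 => /forallP /(_ (Ordinal hx)) /=.
    by rewrite muln_eq0 (negPf nz) => /eqP.
  by move: (d 0%N isT) (d 1%N isT) (d 2%N isT); move: x hx {nz d}; do 15? [case=> //].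
have part i : (i < 3)%N -> exists x, [/\ (x < 15)%N, nth 0%N c x != 0%N & deg x i != 0%N].
  move=> hi; have : degree c i != 0%N by rewrite hdeg.
  rewrite /degree sum_nat_eq0 negb_forall => /existsP [x]; rewrite implyTb muln_eq0 negb_or.
  by case/andP=> h1 h2; exists x; split=> //; exact: ltn_ord.
have [xs hxs nzs] : exists2 xs, xs \in triples & {in xs, forall x, nth 0%N c x != 0%N}.
  have [y [hy cy dy]] := part 1%N isT.
  have hy1 : y \in [:: 1; 3; 5; 7; 10; 13]%N.
    by move: dy; move: y hy {cy}; do 15? [case=> //].
  have [xz hxz nzxz] : exists2 xz, xz \in [:: 4] :: [seq [:: x; z] | x <- [:: 0; 2; 11;
      12], z <- [:: 6; 8; 9; 14]]
      & {in xz, forall x, nth 0 c x != 0}%N.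
    case: (eqVneq (nth 0%N c 4) 0%N) => [c4|c4]; last first.
      by exists [:: 4%N] => // x; rewrite mem_seq1 => /eqP ->.
    have [x [hx cx dx]] := part 0%N isT; have [z [hz cz dz]] := part 2%N isT.
    exists [:: x; z]; last by move=> v; rewrite !inE => /orP [] /eqP ->.
    rewrite inE; apply/orP; right; apply/allpairsP; exists (x, z); split=> //=.
      by move: dx cx; move: x hx; do 15? [case=> //]; rewrite c4.
    by move: dz cz; move: z hz; do 15? [case=> //]; rewrite c4.
  exists (y :: xz); last by move=> v; rewrite inE => /orP [/eqP ->|/nzxz].
  rewrite mem_filter; apply/andP; split; last first.
    by apply/allpairsP; exists (y, xz).
  have nz v : v \in y :: xz -> nth 0%N c v != 0%N by rewrite inE => /orP [/eqP ->|/nzxz].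
  apply/allP => u /nz hu; apply/allP => v /nz hv; apply/negP => huv.
  have /andP [u9 v9] := incompatible_mutable huv.
  case/andP: (hc) => _ /hasP [t ht /all_iota sup].
  have := sup u u9; rewrite (negPf hu) orFb => ut.
  have := sup v v9; rewrite (negPf hv) orFb => vt.
  have /allP /(_ _ ut) /allP /(_ _ vt) := allP states_labels_compatible _ ht.
  by rewrite huv.
have h15 := allP triples_lt15 _ hxs.
pose c' : seq nat := mkseq (fun x => nth 0 c x - count_mem x xs)%N 15.
have le x : (count_mem x xs <= nth 0%N c x)%N.
  have u : uniq xs by exact: (allP triples_uniq).
  by rewrite count_uniq_mem //; case: (boolP (x \in xs)) => // /nzs; rewrite lt0n.
have hc' : cluster_monomial c'.
  case/andP: (hc) => _ /hasP [t ht /all_iota sup].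
  rewrite /cluster_monomial size_mkseq eqxx andTb; apply/hasP; exists t => //.
  apply/all_iota => x hx; rewrite nth_mkseq; last by lia.
  by case/orP: (sup x hx) => [/eqP ->|->]; rewrite ?sub0n ?eqxx ?orbT.
have hd' i : (i < 3)%N -> degree c' i = m.
  move=> hi; apply/eqP; rewrite -(eqn_add2r 1) [(m + 1)%N]addn1 -(hdeg i hi) /degree; apply/eqP.
  rewrite -[X in (_ + X)%N](degree_triples (ps := [:: xs]) hi) ?/= ?hxs // cats0 /degree -big_split /=.
  by apply: eq_bigr => x _; rewrite !nth_mkseq // -mulnDl subnK.
have [ps [h1 h2 h3]] := IH c' hc' hd'.
exists (xs :: ps); split=> /=; rewrite ?h1 ?h2 ?hxs //.
case/andP: (hc) => /eqP sc _.
apply: (@eq_from_nth _ 0%N); rewrite ?size_mkseq // sc => x hx; rewrite nth_mkseq // count_cat.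
have := congr1 (fun d => nth 0%N d x) h3; rewrite !nth_mkseq // => <-.
by rewrite addnC subnK.
Qed.

Section Body.
Variable R : realType.
Local Open Scope classical_set_scope.

Definition sums (st : state) : set 'rV[R]_6 :=
  [set x | exists k ps, [/\ (0 < k)%N, size ps = (2 * k)%N, all (mem triples) ps
    & x = k%:R^-1 *: map_mx intr (\sum_(p <- ps) point st p)]].

Lemma tau_lambda1 : tau_lambda R = 1.
Proof.
have unip (S : comNzRingType) (g : 'M[S]_4) n : (n <= 4)%N ->
    (forall i j : 'I_4, (i < j)%N -> g i j = 0) -> (forall i, g i i = 1) ->
    minor g (iota 1 n) (iota 1 n) = 1.
  move=> hn h0 h1; rewrite /minor.
  have lt (i : 'I_(size (iota 1 n))) : (i < n)%N.
    by apply: (leq_trans (ltn_ord i)); rewrite size_iota.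
  rewrite det_trig.
    by rewrite big1 // => i _; rewrite mxE !nth_iota //= h1.
  apply/is_trig_mxP => i j hij; rewrite mxE; apply: h0.
  have hi := lt i; have hj := lt j.
  by rewrite !nth_iota //= !inordK //; lia.
rewrite /tau_lambda big1_seq // => i /=; rewrite mem_index_iota => hi.
rewrite unip ?expr1n //; first by lia.
- by move=> u v huv; rewrite mxE ltnNge (ltnW huv) /= -val_eqE /= ltn_eqF.
- by move=> u; rewrite mxE ltnn eqxx.
Qed.

Lemma cmonE c : cmon R c = tofrac (cmonP R c).
Proof.
rewrite /cmon /cmonP rmorph_prod; apply: eq_bigr => x _.
by rewrite rmorphXn.
Qed.

Lemma sum_cmon cs (a : seq nat -> R[i]) :
  tofrac (\sum_(c <- cs) a c *: cmonP R c) = \sum_(c <- cs) scalarK (a c) * cmon R c.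
Proof.
rewrite raddf_sum; apply: eq_bigr => c _.
by rewrite -mul_mpolyC cmonE /scalarK; exact: rmorphM.
Qed.

(** A section has the value of one of its cluster monomials, which splits into triples. Conversely
    the triples in a sum may be mutually incompatible: their product is still a section, and values
    add up. *)
Lemma Delta_sums (ord : seed R -> rel 'rV[int]_6) st : st \in states ->
  refining_order (exchange (realize R st)) (ord (realize R st)) ->
  Delta ord (realize R st) = closure (sums st).
Proof.
move=> hst hle; rewrite /Delta /Newton_Okounkov_body; congr closure.
apply/seteqP; split=> x.
  case=> k [F [a [k0 hF _ hv ->]]]; rewrite tau_lambda1 expr1n divr1 restrictUE in hv.
  have [cs [b [u hcs hb e]]] := section_span hF.
  rewrite e sum_cmon in hv.
  have ncs : cs != [::].
    apply/eqP => e0; move: hv; rewrite e0 big_nil => /val_neq0 /eqP; apply => //.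
    exact: free_state.
  have inj : {in cs &, injective (gmon st)}.
    move=> c c' /hcs [hc hd] /hcs [hc' hd']; apply: gmon_inj => // i hi.
    by rewrite hd ?hd'.
  have [c hc hV] := val_combination hst hle u ncs inj hb.
  have [hc1 hc2] := hcs c hc.
  have [ps [hs1 hs2 ec]] := cluster_monomial_split hc1 hc2.
  exists k, ps; split=> //; rewrite (val_uniq hle (@free_state R st hst) hv hV) ec.
  by rewrite gmon_count ?point_flatten // triples_flatten_lt15.
case=> k [ps [k0 hs hps ->]]; pose c := count_vector (flatten ps).
have hd i : (i < 3)%N -> degree c i = (2 * k)%N by move=> hi; rewrite degree_triples ?hs.
exists k, (monomial_section R c), (gmon st c); split=> //.
- exact: monomial_section_is_section.
- exact: monomial_section_nonzero.
- rewrite tau_lambda1 expr1n divr1 restrictUE restrictP_monomial_section.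
  by rewrite -cmonE; exact: val_cmon.
- by rewrite gmon_count ?point_flatten // triples_flatten_lt15.
Qed.
End Body.

(** * Unimodular equivalences *)

Section UnimodularEquivalence.
Local Open Scope classical_set_scope.
Variables (R : realType) (n : nat).
Implicit Types P Q : set 'rV[R]_n.

Definition affine (A : 'M[int]_n) (b : 'rV[int]_n) (x : 'rV[R]_n) : 'rV[R]_n :=
  x *m map_mx intr A + map_mx intr b.

Lemma affine_comp A b A' b' x :
  affine A' b' (affine A b x) = affine (A *m A') (b *m A' + b') x.
Proof.
by rewrite /affine !(map_mxM, map_mxD) mulmxDl addrA mulmxA.
Qed.

Lemma affine_id x : affine 1%:M 0 x = x.
Proof. by rewrite /affine map_mx1 map_mx0 mulmx1 addr0. Qed.

Lemma affineK A A' b x : A *m A' = 1%:M -> affine A' (- (b *m A')) (affine A b x) = x.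
Proof. by move=> h; rewrite affine_comp h subrr affine_id. Qed.

Lemma unimodular_trans P Q T :
  unimodular_equiv P Q -> unimodular_equiv Q T -> unimodular_equiv P T.
Proof.
move=> [A [b [hA ->]]] [A' [b' [hA' ->]]].
exists (A *m A'), (b *m A' + b'); split; first by rewrite unitmx_mul hA.
by rewrite image_comp; apply: eq_imagel => x _; exact: (affine_comp A b A' b' x).
Qed.

Lemma unimodular_sym P Q : unimodular_equiv P Q -> unimodular_equiv Q P.
Proof.
move=> [A [b [hA ->]]]; exists (invmx A), (- (b *m invmx A)); split; first by rewrite unitmx_inv.
rewrite image_comp -[LHS]image_id; apply: eq_imagel => x _.
by rewrite -{1}(@affineK A (invmx A) b x) // mulmxV.
Qed.

Lemma unimodular_closure A A' b P Q : A *m A' = 1%:M ->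
  (forall x, P x -> Q (affine A b x)) ->
  (forall y, Q y -> P (affine A' (- (b *m A')) y)) ->
  unimodular_equiv (closure P) (closure Q).
Proof.
move=> h hP hQ; have [hA _] := mulmx1_unit h.
have h' : A' *m A = 1%:M by exact: mulmx1C.
exists A, b; split=> //; apply/seteqP; split=> y /=.
  move=> hy; exists (affine A' (- (b *m A')) y); first exact: closure_affine hy.
  by rewrite -/(affine A b _) affine_comp h' mulNmx -mulmxA h' mulmx1 addNr affine_id.
by case=> x hx <-; exact: closure_affine hx.
Qed.
End UnimodularEquivalence.

Definition coords (st : state) (p : seq nat) : seq int :=
  mkseq (fun j => foldr (fun x s => gvec st x j + s) 0 p) 6.

Definition row_of (v : seq int) : 'rV[int]_6 := \row_j v`_j.
Definition mx_of (M : seq (seq int)) : 'M[int]_6 := \matrix_(i, j) entry M i j.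

Definition act (M : seq (seq int)) (d v : seq int) : seq int :=
  mkseq (fun j => foldr (fun i s => v`_i * entry M i j + s) d`_j (iota 0 6)) 6.

Definition mx_inverse (M M' : seq (seq int)) : bool :=
  all (fun i => all (fun j =>
    foldr (fun l s => entry M i l * entry M' l j + s) 0 (iota 0 6) == (i == j)%:Z) (iota 0 6)) (iota 0 6).

Definition affine_points (a b : state) (t : seq (seq int) * seq (seq int) * seq int) : bool :=
  let: (M, M', d) := t in
  let P := [seq act M d (coords a p) | p <- triples] in
  let Q := [seq coords b q | q <- triples] in
  [&& mx_inverse M M', all (mem Q) P & all (mem P) Q].

Lemma point_coords st p : point st p = row_of (coords st p).
Proof.
apply/rowP => j; rewrite summxE mxE nth_mkseq //.
by elim: p => [|x p IH] /=; rewrite ?big_nil // big_cons IH mxE.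
Qed.

Lemma sum_iota (F : nat -> int) n d : \sum_(i < n) F i + d = foldr (fun i s => F i + s) d (iota 0 n).
Proof.
rewrite -[\sum_(i < n) F i](big_mkord xpredT) /index_iota subn0.
by elim: (iota 0 n) => [|i l IH] /=; rewrite ?big_nil ?add0r // big_cons -addrA IH.
Qed.

Lemma actE M d v : row_of (act M d v) = row_of v *m mx_of M + row_of d.
Proof.
apply/rowP => j; rewrite !mxE nth_mkseq // -sum_iota; congr (_ + _).
by apply: eq_bigr => i _; rewrite !mxE.
Qed.

Lemma mx_inverseP M M' : mx_inverse M M' -> mx_of M *m mx_of M' = 1%:M.
Proof.
move=> h; apply/matrixP => i j; rewrite !mxE.
have /all_iota /(_ i (ltn_ord i)) /all_iota /(_ j (ltn_ord j)) /eqP e := h.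
transitivity (i == j :> nat)%:Z; last by rewrite natz.
by rewrite -e -sum_iota addr0; apply: eq_bigr => l _; rewrite !mxE.
Qed.

Section AffineEquivalence.
Variable R : realType.

(** A point of [sums] is 1/k times a sum of 2k vectors, so a translation by d of each vector moves
    it by 2 d. *)
Lemma sums_affine (a b : state) (A : 'M[int]_6) (d : 'rV[int]_6) :
  (forall p, p \in triples -> exists2 q, q \in triples & point b q = point a p *m A + d) ->
  forall x : 'rV[R]_6, @sums R a x -> @sums R b (affine A (d *+ 2) x).
Proof.
move=> h x [k [ps [k0 hs hps ->]]].
have [qs [h1 h2 h3]] : exists qs, [/\ size qs = size ps, all (mem triples) qs
    & \sum_(q <- qs) point b q = (\sum_(p <- ps) point a p) *m A + d *+ size ps].
  elim: ps hps {hs} => [_|p ps IH /= /andP [hp /IH [qs [h1 h2 h3]]]].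
    by exists [::]; rewrite !big_nil mul0mx mulr0n addr0.
  have [q hq eq] := h p hp; exists (q :: qs); split=> /=; rewrite ?h1 ?hq //.
  by rewrite !big_cons h3 eq mulmxDl mulrS addrACA.
exists k, qs; split=> //; first by rewrite h1.
rewrite h3 hs mulrnA /affine !(map_mxM, map_mxD) scalerDr scalemxAl; congr (_ + _).
apply/rowP => j; rewrite [RHS]mxE [in LHS]mxE [in RHS]mxE mulmxnE raddfMn -[X in _ = _ * X]mulr_natl.
have kR : (k%:R : R) != 0 by rewrite pnatr_eq0 -lt0n.
by apply: esym; rewrite mulKf // mulr2n !mxE raddfD.
Qed.

Lemma affine_pointsP a b t : affine_points a b t ->
  unimodular_equiv (closure (@sums R a)) (closure (@sums R b)).
Proof.
case: t => [[M M'] d] /and3P [/mx_inverseP hM /allP hP /allP hQ].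
apply: (unimodular_closure (b := row_of d *+ 2) hM).
  apply: sums_affine => p hp; have /mapP [q hq e] := hP _ (map_f _ hp).
  by exists q; rewrite // !point_coords -e actE.
move=> y; rewrite mulr2n mulmxDl opprD -mulr2n -mulNmx; apply: sums_affine => q hq.
have /mapP [p hp e] := hQ _ (map_f _ hq); exists p => //.
by rewrite !point_coords e actE mulmxDl -mulmxA hM mulmx1 mulNmx addrK.
Qed.
End AffineEquivalence.

(* The clusters are listed by increasing distance from the first one in the
   exchange graph. *)
Definition clusters : seq (seq nat) :=
  [:: [:: 1; 5; 7]; [:: 0; 1; 5]; [:: 5; 7; 8]; [:: 1; 3; 7]; [:: 0; 1; 2];
      [:: 0; 5; 8]; [:: 6; 7; 8]; [:: 1; 2; 3]; [:: 3; 6; 7]; [:: 0; 2; 4];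
      [:: 0; 4; 8]; [:: 4; 6; 8]; [:: 2; 3; 6]; [:: 2; 4; 6]]%N.

Definition cluster_index (st : state) : nat := index (sort leq (take 3 st.1.1)) clusters.

Definition representative (i : nat) : state :=
  nth initial_state states (find (fun s => take 3 s.1.1 == nth [::] clusters i) states).

(** The permutation matrix that moves the coordinate of a variable of a to that of its image in b,
    with its transpose as inverse. *)
Definition relabelling (perm : nat -> nat) (a b : state) : seq (seq int) * seq (seq int) * seq int :=
  (mkseq (fun i => mkseq (fun j => (perm (label a i) == label b j)%:Z) 6) 6,
   mkseq (fun i => mkseq (fun j => (label b i == perm (label a j))%:Z) 6) 6, nseq 6 0).

(* The affine map (g_1, ..., g_6) |-> (- g_1, - g_2, - g_3, 2 - g_6, 2 - g_5, 2 - g_4). *)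
Definition reflection : seq (seq int) * seq (seq int) * seq int :=
  let M := [:: [:: -1; 0; 0; 0; 0; 0]; [:: 0; -1; 0; 0; 0; 0]; [:: 0; 0; -1; 0; 0; 0];
               [:: 0; 0; 0; 0; 0; -1]; [:: 0; 0; 0; 0; -1; 0]; [:: 0; 0; 0; -1; 0; 0]] in
  (M, M, [:: 0; 0; 0; 1; 1; 1]).

(* The automorphism of the Dynkin diagram sends D_I to D_K, where K is the
   complement of w_0(I). *)
Definition dual_variable (x : nat) : nat := nth 0%N [:: 8; 7; 6; 3; 4; 5; 2; 1; 0; 11; 10; 9]%N x.

(** Induced by exchanging D_23 with D_3, X with D_24 and D_134 with D_14: the reflection of the
    hexagon in an axis through two opposite vertices. *)
Definition mirror_cluster (i : nat) : nat := nth 0%N [:: 13; 9; 11; 12; 4; 10; 6; 7; 8; 1; 5; 2; 3; 0]%N i.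
(** Induced by [dual_variable]. It fixes the three long diagonals and so is the half-turn of the
    hexagon. *)
Definition dual_cluster (i : nat) : nat := nth 0%N [:: 0; 2; 1; 3; 6; 5; 4; 8; 7; 11; 10; 9; 12; 13]%N i.

Lemma states_cluster_index : all (fun s => cluster_index s < 14)%N states.
Proof. by vm_compute. Qed.

Lemma representative_in_states : all (fun i => representative i \in states) (iota 0 14).
Proof. by vm_compute. Qed.

Lemma cluster_index_representative :
  all (fun i => cluster_index (representative i) == i) (iota 0 14).
Proof. by vm_compute. Qed.

Lemma states_representative : all (fun s =>
  let r := representative (cluster_index s) in affine_points r s (relabelling id r s)) states.
Proof. by vm_compute. Qed.

Lemma mirror_points : all (fun i => (mirror_cluster i == i)
  || affine_points (representative i) (representative (mirror_cluster i)) reflection) (iota 0 14).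
Proof. by vm_compute. Qed.

Lemma dual_points : all (fun i => (dual_cluster i == i)
  || affine_points (representative i) (representative (dual_cluster i))
       (relabelling dual_variable (representative i) (representative (dual_cluster i)))) (iota 0 14).
Proof. by vm_compute. Qed.

Section ClassBodies.
Variable R : realType.

Definition body (st : state) : set 'rV[R]_6 := closure (sums st).

Lemma unimodular_refl (P : set 'rV[R]_6) : unimodular_equiv P P.
Proof.
exists 1%:M, 0; split; first exact: unitmx1.
rewrite -[LHS]image_id; apply: eq_imagel => x _.
by rewrite map_mx1 map_mx0 mulmx1 addr0.
Qed.

Lemma body_representative st : st \in states ->
  unimodular_equiv (body (representative (cluster_index st))) (body st).
Proof. by move=> hst; exact: affine_pointsP (allP states_representative _ hst). Qed.

Lemma body_mirror i : (i < 14)%N ->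
  unimodular_equiv (body (representative i)) (body (representative (mirror_cluster i))).
Proof.
move=> hi; have /all_iota /(_ i hi) := mirror_points.
by case/orP => [/eqP ->|/affine_pointsP]; [exact: unimodular_refl|apply].
Qed.

Lemma body_dual i : (i < 14)%N ->
  unimodular_equiv (body (representative i)) (body (representative (dual_cluster i))).
Proof.
move=> hi; have /all_iota /(_ i hi) := dual_points.
by case/orP => [/eqP ->|/affine_pointsP]; [exact: unimodular_refl|apply].
Qed.

Lemma sums_linear_le st (w : seq int) (c : int) :
  all (fun p => foldr (fun j s => w`_j * (coords st p)`_j + s) 0 (iota 0 6) <= c) triples ->
  forall x, body st x -> \sum_(j < 6) (w`_j)%:~R * x 0 j <= (c *+ 2)%:~R.
Proof.
move=> /allP h; apply: closure_linear_le => x [k [ps [k0 hs hps ->]]].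
have : \sum_(j < 6) w`_j * (\sum_(p <- ps) point st p) 0 j <= c *+ (2 * k).
  rewrite -hs; elim: ps hps {hs} => [_|p ps IH /= /andP [hp /IH le]].
    by rewrite big_nil mulr0n big1 // => j _; rewrite mxE mulr0.
  have := h p hp; rewrite -sum_iota addr0 => lep.
  rewrite mulrS; apply: le_trans (lerD lep le); rewrite -big_split /=.
  by apply: ler_sum => j _; rewrite big_cons mxE mulrDr point_coords [row_of _ _ _]mxE.
rewrite -(ler_int R) raddf_sum /= => le.
have kR : 0 < (k%:R : R) by rewrite ltr0n.
rewrite -(ler_pM2l kR) mulr_sumr; apply: le_trans (le_trans le _).
  apply: ler_sum => j _; rewrite !mxE mulrCA mulVKf ?gt_eqF //.
  by rewrite rmorphM.
by rewrite mulrnA -[c *+ 2 *+ k]mulr_natl rmorphM /= rmorph_nat.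
Qed.

Lemma body_double st p : p \in triples -> body st (map_mx intr (point st p *+ 2)).
Proof.
move=> hp; apply: subset_closure; exists 1%N, [:: p; p]; split=> //=; rewrite ?hp //.
by rewrite invr1 scale1r !big_cons big_nil addr0 mulr2n.
Qed.
End ClassBodies.

(** * A body equivalent to only one other *)

Definition vertices0 : seq (seq int) := [seq coords (representative 0) p | p <- triples].

(* On the representative of the cluster 0, an integral affine functional with
   values in the interval from 0 to 2 is constant or one of the functions g_m
   and 2 - g_m for m = 4, 5, 6. *)
Lemma width_two_functional (w : nat -> int) (b : int) :
  (forall v, v \in vertices0 -> 0 <= 2 * (\sum_(i < 6) v`_i * w i) + b <= 2) ->
  (forall i, (i < 6)%N -> w i = 0) \/
  exists n s, [/\ (2 < n < 6)%N, forall i, (i < 6)%N -> w i = if i == n then s else 0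
    & (s = 1 /\ b = 0) \/ (s = -1 /\ b = 2)].
Proof.
move=> h; have h6 v : v \in vertices0 ->
    0 <= 2 * (v`_0 * w 0%N + v`_1 * w 1%N + v`_2 * w 2%N + v`_3 * w 3%N + v`_4 * w 4%N + v`_5 * w 5%N)
        + b <= 2.
  by move=> /h; rewrite !big_ord_recl big_ord0 addr0 !addrA.
(* The two points differ by 2 in coordinate 1 only, so the values differ by 4 w1, which must not
   exceed 2 in size. The next two coordinates are similar; then the cube of points with last
   coordinates 0 or 1 leaves at most one nonzero weight. *)
have w1 : w 1%N = 0.
  have := h6 [:: 0; 1; 0; 1; 0; 1] isT; have := h6 [:: 0; -1; 0; 1; 0; 1] isT.
  by rewrite /=; lia.
have w2 : w 2%N = 0.
  have := h6 [:: 0; 0; 1; 1; 0; 1] isT; have := h6 [:: 0; 0; -1; 1; 0; 1] isT.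
  by rewrite /=; lia.
have w0 : w 0%N = 0.
  have := h6 [:: 1; -1; 0; 1; 0; 1] isT; have := h6 [:: -1; 0; 0; 1; 0; 1] isT.
  by rewrite /= w1; lia.
have e (n : nat) (s : int) : (2 < n < 6)%N -> w 3%N = (if 3%N == n then s else 0) ->
    w 4%N = (if 4%N == n then s else 0) -> w 5%N = (if 5%N == n then s else 0) ->
    forall i, (i < 6)%N -> w i = if i == n then s else 0.
  by move=> hn e3 e4 e5; case=> [|[|[|[|[|[|i]]]]]] // _; rewrite ?w0 ?w1 ?w2; case: eqP => // E;
      rewrite -E in hn.
have := h6 [:: 0; 0; 0; 1; 1; 1] isT; have := h6 [:: 0; 0; 0; 1; 1; 0] isT.
have := h6 [:: 0; 0; 0; 1; 0; 1] isT; have := h6 [:: 0; 0; 0; 1; 0; 0] isT.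
have := h6 [:: 0; 0; 0; 0; 1; 1] isT; have := h6 [:: 0; 0; 0; 0; 1; 0] isT.
have := h6 [:: 0; 0; 0; 0; 0; 1] isT; have := h6 [:: 0; 0; 0; 0; 0; 0] isT.
rewrite /= w0 w1 w2 => k0 k1 k2 k3 k4 k5 k6 k7.
case: (eqVneq (w 3%N) 0) => e3; last first.
  by right; exists 3%N, (w 3%N); split=> //; [apply: e => //=; lia|lia].
case: (eqVneq (w 4%N) 0) => e4; last first.
  by right; exists 4%N, (w 4%N); split=> //; [apply: e => //=; lia|lia].
case: (eqVneq (w 5%N) 0) => e5; last first.
  by right; exists 5%N, (w 5%N); split=> //; [apply: e => //=; lia|lia].
by left; case=> [|[|[|[|[|[|i]]]]]].
Qed.

Lemma last_coordinates_bounded : all (fun i => all (fun p => all (fun m =>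
  0 <= (coords (representative i) p)`_m <= 1) [:: 3; 4; 5]%N) triples) (iota 0 14).
Proof. by vm_compute. Qed.

(** Doubled, these points lie on the faces of the body where the last three coordinates are 0 or 2;
    each such face thus has two points, unlike the face in [corner_unique]. *)
Lemma corners_large : all (fun i => (i \in [:: 0; 13]%N) ||
  let V := [seq coords (representative i) p | p <- triples] in
  all (fun x => all (fun y => all (fun z =>
    let W := [seq v <- V | [&& v`_3 == x, v`_4 == y & v`_5 == z]] in
    has (fun v => has (fun v' => v != v') W) W) [:: 0; 1]) [:: 0; 1]) [:: 0; 1]) (iota 0 14).
Proof. by vm_compute. Qed.

Section NonEquivalence.
Variable R : realType.
Local Notation body := (@body R).

Lemma body_coordinate_bounded i (m : 'I_6) y : (i < 14)%N -> (2 < m)%N ->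
  body (representative i) y -> 0 <= y 0 m <= 2.
Proof.
move=> hi hm hy.
have hb p : p \in triples -> 0 <= (coords (representative i) p)`_m <= 1.
  move=> hp; have /all_iota /(_ i hi) /allP /(_ p hp) /allP := last_coordinates_bounded.
  by apply; have := ltn_ord m; rewrite !inE; case: (nat_of_ord m) hm => [|[|[|[|[|[|]]]]]].
have val (s : int) (u : seq int) : foldr (fun j t => (mkseq (fun j => if j == m :> nat then s else 0)
    6)`_j * u`_j + t) 0 (iota 0 6) = s * u`_m.
  rewrite -sum_iota addr0 (bigD1 m) //= nth_mkseq // eqxx big1 ?addr0 // => j.
  by rewrite -val_eqE /= nth_mkseq // => /negPf ->; rewrite mul0r.
have valR (s : int) : \sum_(j < 6) ((mkseq (fun j => if j == m :> nat then s else 0) 6)`_j)%:~R * y 0 j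
    = s%:~R * y 0 m.
  rewrite (bigD1 m) //= nth_mkseq // eqxx big1 ?addr0 // => j.
  by rewrite -val_eqE /= nth_mkseq // => /negPf ->; rewrite mul0r.
have lin s c := @sums_linear_le R (representative i) (mkseq (fun j => if j == m :> nat then s else 0) 6) c.
have := lin 1 1 _ y hy; have := lin (-1) 0 _ y hy; rewrite !valR.
rewrite mulN1r oppr_le0 mul1r => h1 h2; apply/andP; split.
  by apply: h1; apply/allP => p /hb; rewrite val; lia.
by apply: h2; apply/allP => p /hb; rewrite val; lia.
Qed.

Lemma corner_unique x : body (representative 0) x ->
  x 0 (inord 3) = 0 -> x 0 (inord 4) = 2 -> x 0 (inord 5) = 0 ->
  x = \row_j (if j == 4 :> nat then 2 else 0).
Proof.
move=> hx x3 x4 x5.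
have lin w c := @sums_linear_le R (representative 0) w c.
have sum6 (w : seq int) : \sum_(j < 6) (w`_j)%:~R * x 0 j = (w`_0)%:~R * x 0 (inord 0) + (w`_1)%:~R * x
    0 (inord 1)
    + (w`_2)%:~R * x 0 (inord 2) + (w`_3)%:~R * x 0 (inord 3) + (w`_4)%:~R * x 0 (inord 4) + (w`_5)%:~R
        * x 0 (inord 5).
  rewrite !big_ord_recl big_ord0 addr0 !addrA.
  by do !congr (_ + _); congr (_ * x _ _); apply: val_inj; rewrite /= inordK.
have h1 := lin [:: 1; 1; 1; 0; 1; 0] 1 isT x hx.
have h2 := lin [:: 1; 1; 0; 0; 1; 0] 1 isT x hx.
have h3 := lin [:: 0; 1; 1; 0; 1; 0] 1 isT x hx.
have h4 := lin [:: 0; -1; -1; 0; 0; -1] 0 isT x hx.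
have h5 := lin [:: -1; -1; 0; -1; 0; 0] 0 isT x hx.
have h6 := lin [:: 0; 0; -1; 0; 0; -1] 0 isT x hx.
have h7 := lin [:: -1; 0; 0; -1; 0; 0] 0 isT x hx.
move: h1 h2 h3 h4 h5 h6 h7; rewrite !sum6 /= x3 x4 x5 => h1 h2 h3 h4 h5 h6 h7.
(* On this face x0 + x1 = x1 + x2 = 0, while x0 >= 0 and x0 + x1 + x2 <= 0. *)
have [e0 [e1 e2]] : x 0 (inord 0) = 0 /\ x 0 (inord 1) = 0 /\ x 0 (inord 2) = 0 by lra.
apply/rowP => j; rewrite mxE -{1}(inord_val j).
by case: j => [[|[|[|[|[|[|j]]]]]] hj] //=; rewrite ?e0 ?e1 ?e2 ?x3 ?x4 ?x5.
Qed.

(** An equivalence pulls the last three coordinates of body j back to width two functionals on body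
    0, that is, to its own last three coordinates up to order and reflection. The one-point face of
    body 0 is then carried onto a whole face of body j, which has two points. *)
Lemma body_representative0 j : (j < 14)%N -> j \notin [:: 0; 13]%N ->
  ~ unimodular_equiv (body (representative 0)) (body (representative j)).
Proof.
move=> hj nj [A [b [hA e]]].
have double_inj (u u' : int) : u *+ 2 = u' *+ 2 -> u = u' by rewrite !mulr2n; lia.
pose f (x : 'rV[R]_6) := x *m map_mx intr A + map_mx intr b.
have fE x (m : 'I_6) : f x 0 m = \sum_i x 0 i * (A i m)%:~R + (b 0 m)%:~R.
  by rewrite !mxE; congr (_ + _); apply: eq_bigr => i _; rewrite mxE.
have hBA m m' : \sum_i invmx A m i * A i m' = (m == m')%:R.
  by have := congr1 (fun M : 'M_6 => M m m') (mulVmx hA); rewrite !mxE.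
have col (m : 'I_6) : (2 < m)%N -> exists n s, [/\ (2 < nat_of_ord n)%N,
    forall i, A i m = if i == n then s else 0 & (s = 1 /\ b 0 m = 0) \/ (s = -1 /\ b 0 m = 2)].
  move=> hm; have [v /mapP [p hp ->]|w0|[n [s [/andP [n2 n6] hw hs]]]] :=
      @width_two_functional (fun i => A (inord i) m) (b 0 m).
  - have : body (representative j) (f (map_mx intr (point (representative 0) p *+ 2))).
      by rewrite e; exists (map_mx intr (point (representative 0) p *+ 2)) => //; exact: body_double.
    move/(body_coordinate_bounded hj hm); rewrite fE => hv.
    rewrite -!(ler_int R) rmorphD rmorphM /= !raddf_sum /= mulr_sumr.
    rewrite (eq_bigr (fun i => (map_mx intr (point (representative 0) p *+ 2) : 'rV[R]_6) 0 i * (A i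
        m)%:~R)) //.
    move=> i _; rewrite mxE mulmxnE point_coords mxE inord_val rmorphM mulrA; congr (_ * _).
    by rewrite -[_ *+ 2 in RHS]mulr_natl rmorphM.
  - have := hBA m m; rewrite eqxx big1 // => i _.
    by rewrite -(inord_val i) w0 ?mulr0.
  - exists (Ordinal n6), s; split=> // i.
    by rewrite -{1}(inord_val i) hw // -val_eqE.
have c3 : (2 < (inord 3 : 'I_6))%N by rewrite inordK.
have c4 : (2 < (inord 4 : 'I_6))%N by rewrite inordK.
have c5 : (2 < (inord 5 : 'I_6))%N by rewrite inordK.
(* Two columns of A supported in the same row would be proportional, against invertibility. *)
have disj m m' n s s' : m != m' -> (forall i, A i m = if i == n then s else 0) ->
    (forall i, A i m' = if i == n then s' else 0) -> (s' = 1 \/ s' = -1) -> False.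
  move=> ne hm hm' hs'; have := hBA m m; have := hBA m m'.
  rewrite (negPf ne) eqxx (bigD1 n) //= hm' eqxx big1 ?addr0; last first.
    by move=> i /negPf ni; rewrite hm' ni mulr0.
  rewrite (bigD1 n) //= hm eqxx big1 ?addr0; last by move=> i /negPf ni; rewrite hm ni mulr0.
  by case: hs' => ->; rewrite ?mulr1 ?mulrN1 => h; nia.
have [n3 [s3 [n3b h3 b3]]] := col _ c3.
have [n4 [s4 [n4b h4 b4]]] := col _ c4.
have [n5 [s5 [n5b h5 b5]]] := col _ c5.
have ne (m m' : nat) : (m < 6)%N -> (m' < 6)%N -> m != m' -> (inord m : 'I_6) != inord m'.
  by move=> hm hm'; rewrite -val_eqE /= !inordK.
have d34 : n3 != n4.
  apply/eqP => E; rewrite -E in h4; apply: (disj _ _ _ _ _ (ne 3%N 4%N isT isT isT) h3 h4).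
  by case: b4 => -[]; auto.
have d35 : n3 != n5.
  apply/eqP => E; rewrite -E in h5; apply: (disj _ _ _ _ _ (ne 3%N 5%N isT isT isT) h3 h5).
  by case: b5 => -[]; auto.
have d45 : n4 != n5.
  apply/eqP => E; rewrite -E in h5; apply: (disj _ _ _ _ _ (ne 4%N 5%N isT isT isT) h4 h5).
  by case: b5 => -[]; auto.
have fA m n s x : (forall i, A i m = if i == n then s else 0) -> f x 0 m = x 0 n * s%:~R + (b 0 m)%:~R.
  move=> hm; rewrite fE (bigD1 n) //= hm eqxx big1 ?addr0 // => i /negPf ni.
  by rewrite hm ni mulr0.
pose xs : 'rV[R]_6 := \row_j (if j == 4 :> nat then 2 else 0).
have corner m n s : (forall i, A i m = if i == n then s else 0) ->
    (s = 1 /\ b 0 m = 0) \/ (s = -1 /\ b 0 m = 2) ->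
    exists2 t : int, t \in [:: 0; 1] & f xs 0 m = (t *+ 2)%:~R.
  move=> hm hs; rewrite (fA _ _ _ _ hm) mxE.
  case: hs => -[-> ->]; case: ifP => _; [exists 1|exists 0|exists 0|exists 1] => //=; lra.
have [t3 ht3 e3] := corner _ _ _ h3 b3.
have [t4 ht4 e4] := corner _ _ _ h4 b4.
have [t5 ht5 e5] := corner _ _ _ h5 b5.
(* Any listed point on the face of body j has a preimage with the last three coordinates of [xs],
   hence equal to [xs]. *)
have back v : v \in [seq v <- [seq coords (representative j) p | p <- triples] |
    [&& v`_3 == t3, v`_4 == t4 & v`_5 == t5]] -> size v = 6%N /\ map_mx intr (row_of v *+ 2) = f xs.
  rewrite mem_filter => /andP [/and3P [/eqP v3 /eqP v4 /eqP v5] /mapP [p hp ev]].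
  split; first by rewrite ev size_mkseq.
  have : body (representative j) (map_mx intr (row_of v *+ 2)).
    by rewrite ev -point_coords; exact: body_double.
  rewrite e => -[x hx ex]; rewrite -/(f x) in ex; rewrite -ex; congr f.
  have vm m : f x 0 m = (v`_m *+ 2)%:~R by rewrite ex mxE mulmxnE mxE.
  have xn m n s t : (forall i, A i m = if i == n then s else 0) ->
      (s = 1 /\ b 0 m = 0) \/ (s = -1 /\ b 0 m = 2) -> f xs 0 m = (t *+ 2)%:~R ->
      v`_m = t -> x 0 n = xs 0 n.
    move=> hm hs ht hv; have : f x 0 m = f xs 0 m by rewrite vm hv ht.
    by rewrite !(fA _ _ _ _ hm) => /addIr; case: hs => -[-> _]; rewrite ?mulr1 ?mulrN1 // => /oppr_inj.
  have x3 := xn _ _ _ _ h3 b3 e3; rewrite inordK // in x3; have {}x3 := x3 v3.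
  have x4 := xn _ _ _ _ h4 b4 e4; rewrite inordK // in x4; have {}x4 := x4 v4.
  have x5 := xn _ _ _ _ h5 b5 e5; rewrite inordK // in x5; have {}x5 := x5 v5.
  have xall (n : 'I_6) : (2 < n)%N -> x 0 n = xs 0 n.
    move=> hn; have /or3P : [|| n == n3, n == n4 | n == n5].
      move: (ltn_ord n) (ltn_ord n3) (ltn_ord n4) (ltn_ord n5) d34 d35 d45.
      by rewrite -!val_eqE /=; lia.
    by case=> /eqP ->.
  by apply: corner_unique => //; rewrite xall ?mxE inordK.
have /all_iota /(_ j hj) := corners_large; rewrite (negPf nj) orFb.
move=> /allP /(_ _ ht3) /allP /(_ _ ht4) /allP /(_ _ ht5) /hasP [v hv /hasP [v' hv' /eqP]]; apply.
have [sv ev] := back v hv; have [sv' ev'] := back v' hv'.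
apply: (@eq_from_nth _ 0); rewrite ?sv ?sv' // => i hi.
have := congr1 (fun M : 'rV[R]_6 => M 0 (Ordinal hi)) (etrans ev (esym ev')).
rewrite [LHS]mxE [RHS]mxE !mulmxnE ![row_of _ _ _]mxE => /eqP; rewrite eqr_int => /eqP /=.
exact: double_inj.
Qed.
End NonEquivalence.

(** * The exchange graph *)

Definition position (st : state) (x : nat) : nat := index x st.1.1.

Lemma states_uniq : all (fun s => uniq s.1.1) states.
Proof. by vm_compute. Qed.

(** A cluster determines its exchange matrix, so seeds are equivalent as soon as their clusters
    agree as sets. *)
Lemma states_same_cluster : all (fun a => all (fun b => (cluster_index a == cluster_index b) ==>
  perm_eq a.1.1 b.1.1 &&
  all (fun i => all (fun j =>
    eps b (position b (label a i)) (position b (label a j)) == eps a i j) (iota 0 6)) (iota 0 3))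
  states) states.
Proof. by vm_compute. Qed.

Section Vertices.
Variable R : realType.

Lemma var_inj x y : (x < 12)%N -> (y < 12)%N -> var R x = var R y -> x = y.
Proof.
move=> hx hy /eqP; rewrite tofrac_eq => /eqP e.
have := lowest_varP R x; rewrite e => h.
have /rowP hl := lowest_uniq lex_anti h (lowest_varP R y).
apply/eqP; rewrite -(nth_uniq [::] (s := leads)) //; apply/eqP.
have sz z : (z < 12)%N -> size (nth [::] leads z) = 6%N.
  by move=> hz; apply/eqP; apply: (allP (a := fun s => size s == 6%N) (s := leads)) => //; apply: mem_nth.
apply: (@eq_from_nth _ 0%N); rewrite !sz // => j hj.
by have := hl (Ordinal hj); rewrite !mxE /lead /= => -[].
Qed.

Lemma label_lt12 st j : st \in states -> (j < 6)%N -> (label st j < 12)%N.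
Proof.
move=> hst hj; have /and5P [_ _ /allP h _ _] := allP states_labels _ hst.
case: (ltnP j 3) => h3; first by have := h j; rewrite mem_iota => /(_ h3); lia.
by rewrite states_label ?h3 //; lia.
Qed.

Lemma cluster_realize st (j : 'I_6) : cluster (realize R st) j = var R (label st j).
Proof. by rewrite ffunE. Qed.

Lemma exchange_realize st i j : exchange (realize R st) i j = eps st i j.
Proof. by rewrite mxE. Qed.

Lemma seed_equiv_labels a b : a \in states -> b \in states ->
  seed_equiv (realize R a) (realize R b) -> cluster_index a = cluster_index b.
Proof.
move=> ha hb [s [s3 sc _]]; rewrite /cluster_index; congr (index _ _).
have lab j : label b (s j) = label a j.
  by apply: var_inj; rewrite ?label_lt12 // -!cluster_realize.
have low (j : 'I_6) : (j < 3)%N -> (s j < 3)%N.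
  move=> hj; rewrite ltnNge; apply/negP => h.
  by move: hj; rewrite -(perm_inj (s3 _ h)) ltnNge h.
have t3 (c : state) (i : nat) : c \in states -> (i < 3)%N -> nth 0%N (take 3 c.1.1) i = label c i.
  by move=> hc hi; rewrite nth_take.
have st3 c : c \in states -> size (take 3 c.1.1) = 3%N by move=> hc; rewrite size_takel // states_size.
have u3 c : c \in states -> uniq (take 3 c.1.1) by move=> hc; rewrite take_uniq // (allP states_uniq).
have sub : {subset take 3 a.1.1 <= take 3 b.1.1}.
  move=> x /(nthP 0%N) [l]; rewrite st3 // => hi; rewrite t3 // => <-.
  have hi6 : (l < 6)%N by lia.
  have := lab (Ordinal hi6); rewrite /= => <-; rewrite -t3 // ?low //.
  by apply: mem_nth; rewrite st3 // low.
apply/perm_sortP; first exact: leq_total.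
- exact: leq_trans.
- exact: anti_leq.
have [|_ e] := uniq_min_size (u3 a ha) sub; first by rewrite !st3.
by apply: uniq_perm; rewrite ?u3.
Qed.

Lemma labels_seed_equiv a b : a \in states -> b \in states ->
  cluster_index a = cluster_index b -> seed_equiv (realize R a) (realize R b).
Proof.
move=> ha hb e; have := allP (allP states_same_cluster _ ha) _ hb.
rewrite e eqxx implyTb => /andP [pe /all_iota h].
have szb := states_size hb; have sza := states_size ha.
have ub : uniq b.1.1 by exact: (allP states_uniq).
have ua : uniq a.1.1 by exact: (allP states_uniq).
have memb (j : 'I_6) : label a j \in b.1.1.
  by rewrite -(perm_mem pe) /label mem_nth // sza.
have pos6 (j : 'I_6) : (position b (label a j) < 6)%N by have := memb j; rewrite -index_mem szb.
pose s0 (j : 'I_6) : 'I_6 := Ordinal (pos6 j).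
have ls j : label b (s0 j) = label a j by rewrite /label nth_index.
have s0_inj : injective s0.
  move=> i j /(congr1 (fun k : 'I_6 => label b k)); rewrite !ls /label => /eqP.
  by rewrite nth_uniq ?sza ?ltn_ord // => /eqP /val_inj.
exists (perm s0_inj); split.
- move=> j hj; rewrite permE; apply: val_inj => /=.
  rewrite /position (_ : label a j = label b j) ?index_uniq ?szb //.
  by rewrite !states_label // hj ltn_ord.
- by move=> j; rewrite permE !cluster_realize ls.
- move=> i i' j; rewrite permE => hi; rewrite permE !exchange_realize.
  have /all_iota /(_ j (ltn_ord j)) /eqP <- := h i (ltn_ord i).
  by congr (eps b _ _); have := congr1 val hi.
Qed.
End Vertices.

Definition neighbours (i : nat) : seq nat := nth [::]
  [:: [:: 1; 2; 3]; [:: 0; 4; 5]; [:: 0; 5; 6]; [:: 0; 7; 8]; [:: 1; 7; 9];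
      [:: 1; 2; 10]; [:: 2; 8; 11]; [:: 3; 4; 12]; [:: 3; 6; 12]; [:: 4; 10; 13];
      [:: 5; 9; 11]; [:: 6; 10; 13]; [:: 7; 8; 13]; [:: 9; 11; 12]]%N i.

Lemma states_neighbours : all (fun s =>
  perm_eq [seq cluster_index (mut s k) | k <- iota 0 3] (neighbours (cluster_index s))) states.
Proof. by vm_compute. Qed.

Definition is_symmetry (f : nat -> nat) : bool :=
  all (fun i => [&& (f i < 14)%N, f (f i) == i &
    all (fun j => (f j \in neighbours (f i)) == (j \in neighbours i)) (iota 0 14)]) (iota 0 14).

Lemma symmetry_mirror : is_symmetry mirror_cluster. Proof. by vm_compute. Qed.
Lemma symmetry_dual : is_symmetry dual_cluster. Proof. by vm_compute. Qed.

(** Backtracking over the images of the first n vertices, the image of 0 being confined to 0 and 13.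
    In the chosen order each vertex after the first has an earlier neighbour, which keeps the
    branching small. *)
Fixpoint partial_automorphisms (n : nat) : seq (seq nat) :=
  if n is n'.+1 then
    flatten [seq [seq rcons p x | x <- iota 0 14 &
      [&& (n' == 0) ==> (x \in [:: 0; 13]), x \notin p &
        all (fun m => (x \in neighbours (nth 0 p m)) == (n' \in neighbours m)) (iota 0 n')]]
      | p <- partial_automorphisms n']
  else [:: [::]].

Lemma automorphism_table : all (mem [:: iota 0 14; mkseq mirror_cluster 14; mkseq dual_cluster 14;
  mkseq (fun i => mirror_cluster (dual_cluster i)) 14]) (partial_automorphisms 14).
Proof. by vm_compute. Qed.

Lemma mem_partial_automorphisms (p : nat -> nat) n : (n <= 14)%N ->
  p 0%N \in [:: 0; 13]%N -> (forall i, (i < 14)%N -> (p i < 14)%N) ->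
  (forall i j, (i < 14)%N -> (j < 14)%N -> p i = p j -> i = j) ->
  (forall i j, (i < 14)%N -> (j < 14)%N -> (p j \in neighbours (p i)) = (j \in neighbours i)) ->
  mkseq p n \in partial_automorphisms n.
Proof.
move=> hn p0 p14 pinj padj; elim: n hn => // n IH hn.
have hn' : (n <= 14)%N by lia.
apply/flattenP; exists [seq rcons (mkseq p n) x | x <- iota 0 14 &
      [&& (n == 0%N) ==> (x \in [:: 0; 13]%N), x \notin mkseq p n &
        all (fun m => (x \in neighbours (nth 0%N (mkseq p n) m)) == (n \in neighbours m)) (iota 0 n)]].
  by apply/mapP; exists (mkseq p n); rewrite ?IH.
apply/mapP; exists (p n); last by rewrite /mkseq -[in LHS]addn1 iotaD map_cat /= cats1.
rewrite mem_filter; apply/andP; split; last by rewrite mem_iota add0n p14.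
apply/and3P; split.
- by apply/implyP => /eqP ->.
- apply/negP => /mapP [l]; rewrite mem_iota add0n => /andP [_ hl] e.
  have hl14 : (l < 14)%N by lia.
  by have := pinj _ _ hn hl14 e; lia.
- apply/all_iota => m hm; rewrite nth_mkseq // padj //; lia.
Qed.

Section ExchangeGraph.
Variable R : realType.
Local Notation vertex := (vertex R).

Lemma representative_states i : (i < 14)%N -> representative i \in states.
Proof. by move: i; apply/all_iota/representative_in_states. Qed.

Lemma representativeK i : (i < 14)%N -> cluster_index (representative i) = i.
Proof. by move=> hi; have /all_iota /(_ i hi) /eqP := cluster_index_representative. Qed.

Lemma cluster_index_lt st : st \in states -> (cluster_index st < 14)%N.
Proof. by move/(allP states_cluster_index). Qed.

Lemma vertex_ext (X Y : vertex) : (forall s, seed_of X s <-> seed_of Y s) -> X = Y.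
Proof.
case: X Y => [S pS] [T pT] h; apply: eq_exist; apply/seteqP.
by split=> s; apply h.
Qed.

Lemma vertex_exists : exists v : nat -> vertex, forall i s, (i < 14)%N ->
  seed_of (v i) s <-> exists st, [/\ st \in states, cluster_index st = i & s = realize R st].
Proof.
(* [inord] makes the representative a member of [states] for every natural number, so that the map
   to vertices is total. *)
pose r i := representative (inord i : 'I_14).
have rs i : r i \in states := representative_states (ltn_ord (inord i)).
exists (fun i => exist _ [set s' | reachable s' /\ seed_equiv (realize R (r i)) s']%classic
  (ex_intro2 _ _ _ (state_reachable R (rs i)) erefl)) => i s hi.
have ri : cluster_index (r i) = i by rewrite representativeK // inordK.
rewrite /seed_of; split.
  case=> /reachable_state [st hst ->] /(seed_equiv_labels (rs i) hst).
  by rewrite ri => e; exists st.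
case=> st [hst e ->]; split; first exact: state_reachable.
by apply: labels_seed_equiv; rewrite ?ri.
Qed.

Definition vertex_of : nat -> vertex := sval (cid vertex_exists).

Lemma seed_of_vertex i s : (i < 14)%N -> seed_of (vertex_of i) s <->
  exists st, [/\ st \in states, cluster_index st = i & s = realize R st].
Proof. exact: (svalP (cid vertex_exists)). Qed.

Lemma realize_inj st st' : st \in states -> st' \in states ->
  realize R st = realize R st' -> cluster_index st = cluster_index st'.
Proof.
move=> h h' e; apply: (@seed_equiv_labels R) => //.
by rewrite -e; exact: labels_seed_equiv.
Qed.

Lemma vertex_cover (X : vertex) : exists2 i, (i < 14)%N & X = vertex_of i.
Proof.
case: X => S [s rs eS]; have [st hst es] := reachable_state rs.
have lt := cluster_index_lt hst; exists (cluster_index st); first exact: lt.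
apply: vertex_ext => s'; apply: iff_trans (iff_sym (seed_of_vertex s' lt)).
rewrite /seed_of /= eS es; split.
  case=> /reachable_state [st' hst' ->] /(seed_equiv_labels hst hst') e.
  by exists st'.
case=> st' [hst' e ->]; split; first exact: state_reachable.
exact: labels_seed_equiv (esym e).
Qed.

Definition vertex_index (X : vertex) : nat := s2val (cid2 (vertex_cover X)).

Lemma vertex_index_lt X : (vertex_index X < 14)%N.
Proof. exact: s2valP (cid2 (vertex_cover X)). Qed.

Lemma vertex_indexK X : vertex_of (vertex_index X) = X.
Proof. exact: esym (s2valP' (cid2 (vertex_cover X))). Qed.

Lemma vertex_ofK i : (i < 14)%N -> vertex_index (vertex_of i) = i.
Proof.
move=> hi; have hj := vertex_index_lt (vertex_of i); have e := vertex_indexK (vertex_of i).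
move: (vertex_index _) hj e => j hj e.
have sj : seed_of (vertex_of j) (realize R (representative j)).
  apply: (proj2 (seed_of_vertex _ hj)); exists (representative j).
  by split; [exact: representative_states|exact: representativeK|].
rewrite e in sj; have [st [hst ei er]] := proj1 (seed_of_vertex _ hi) sj.
exact: etrans (esym (representativeK hj)) (etrans (realize_inj (representative_states hj) hst er) ei).
Qed.

Lemma adjacent_vertex i j : (i < 14)%N -> (j < 14)%N ->
  adjacent (vertex_of i) (vertex_of j) <-> j \in neighbours i.
Proof.
move=> hi hj; split.
  case=> s [k [/(seed_of_vertex _ hi) [st [hst <- ->]]]].
  rewrite mutate_realize // => /(seed_of_vertex _ hj) [st' [hst' <- e]].
  rewrite -(perm_mem (allP states_neighbours _ hst)); apply/mapP; exists (nat_of_ord k).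
    by rewrite mem_iota; exact: ltn_ord.
  exact: esym (realize_inj (mut_in_states hst (ltn_ord k)) hst' e).
have hst := representative_states hi.
rewrite -{1}(representativeK hi) -(perm_mem (allP states_neighbours _ hst)) => /mapP [k].
rewrite mem_iota add0n => /andP [_ hk] ej.
exists (realize R (representative i)), (Ordinal hk); split.
  by apply: (proj2 (seed_of_vertex _ hi)); exists (representative i); rewrite representativeK.
rewrite mutate_realize //; apply: (proj2 (seed_of_vertex _ hj)).
by exists (mut (representative i) k); rewrite mut_in_states.
Qed.
End ExchangeGraph.

(** * The group of symmetries *)

Lemma Klein_four (T : Type) (f g : T -> T) : involutive f -> involutive g ->
  f \o g = g \o f -> f <> id -> g <> id -> f <> g -> generates_Klein_four f g.
Proof.
move=> ff gg fg f1 g1 nfg.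
have fgx x : f (g x) = g (f x) by exact: (congr1 (fun h => h x) fg).
pose theta (a : 'Z_2 * 'Z_2) := iter a.1 f \o iter a.2 g; exists theta.
have add a b : theta (a + b) = theta a \o theta b.
  apply/funext => x; case: a b => [[[|[|a1]] ha1] [[|[|a2]] ha2]] [[[|[|b1]] hb1] [[|[|b2]] hb2]] //=;
  by rewrite /theta /= ?(fgx, ff, gg).
split=> //.
  have fgn : f \o g <> id.
    move=> e; apply: nfg; apply/funext => x; rewrite -[x in f x]gg.
    exact: (congr1 (fun h => h (g x)) e).
  have key a : theta a = id -> a = 0.
    case: a => [[[|[|a1]] ha1] [[|[|a2]] ha2]] //= e; try by case: (f1 e) || case: (g1 e) || case: (fgn e).
    by congr pair; apply: val_inj.
  move=> a b e; apply/eqP; rewrite -subr_eq0; apply/eqP; apply: key.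
  (* Injectivity is reduced to the kernel, and in Z/2 x Z/2 subtraction is addition. *)
  have nb : - b = b by case: b {e} => [[[|[|b1]] hb1] [[|[|b2]] hb2]] //; congr pair; apply: val_inj.
  by rewrite nb add e -add; case: b {e nb} => [[[|[|b1]] hb1] [[|[|b2]] hb2]] //=.
move=> h; split.
  elim=> {h} [|||h h' _ [a ->] _ [b ->]|h h' _ [a ->] k1 k2].
  - by exists 0.
  - by exists (1, 0).
  - by exists (0, 1).
  - by exists (a + b); rewrite add.
  - exists a; apply/funext => x; have aa : theta a (theta a x) = x.
      by case: a k1 k2 => [[[|[|a1]] ha1] [[|[|a2]] ha2]] //= _ _; rewrite /theta /= ?(fgx, ff, gg).
    by rewrite -{1}aa k1.
case=> -[[[|[|a1]] ha1] [[|[|a2]] ha2]] -> //=.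
- exact: generated_id.
- exact: generated_r.
- exact: generated_l.
- exact: generated_comp (generated_l _ _) (generated_r _ _).
Qed.

Section Symmetries.
Variable R : realType.
Local Notation vertex := (vertex R).

Definition vertex_map (f : nat -> nat) (X : vertex) : vertex := vertex_of R (f (vertex_index X)).

Lemma vertex_map_comp f g : (forall i, (i < 14)%N -> (g i < 14)%N) ->
  vertex_map (fun i => f (g i)) = vertex_map f \o vertex_map g.
Proof.
by move=> hg; apply/funext => X; rewrite /vertex_map /= vertex_ofK // hg // vertex_index_lt.
Qed.

Lemma vertex_map_neq f g i : (i < 14)%N -> (f i < 14)%N -> (g i < 14)%N -> f i != g i -> vertex_map f
    <> vertex_map g.
Proof.
move=> hi hf hg /eqP ne e; apply: ne.
have E h : (h i < 14)%N -> vertex_index (vertex_map h (vertex_of R i)) = h i.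
  by move=> hh; apply: etrans (vertex_ofK R hh) => /=; congr (vertex_index (vertex_of R (h _)));
      exact: vertex_ofK.
by rewrite -(E f hf) -(E g hg) e.
Qed.

Lemma vertex_map_id : vertex_map id = id.
Proof. by apply/funext => X; rewrite /vertex_map vertex_indexK. Qed.

Lemma symmetryP f : is_symmetry f -> [/\ forall i, (i < 14)%N -> (f i < 14)%N,
  forall i, (i < 14)%N -> f (f i) = i
  & forall i j, (i < 14)%N -> (j < 14)%N -> (f j \in neighbours (f i)) = (j \in neighbours i)].
Proof.
move=> /all_iota h; split=> [i hi|i hi|i j hi hj].
- by case/and3P: (h i hi).
- by case/and3P: (h i hi) => _ /eqP.
- by case/and3P: (h i hi) => _ _ /all_iota /(_ j hj) /eqP.
Qed.

Lemma vertex_map_involution f : is_symmetry f -> vertex_map f <> id -> graph_involution (vertex_map f).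
Proof.
move=> /symmetryP [f14 ff adj] ne.
have inv : involutive (vertex_map f).
  by move=> X; rewrite /vertex_map vertex_ofK ?f14 ?vertex_index_lt // ff ?vertex_indexK // vertex_index_lt.
split=> //; split; first by exists (vertex_map f).
move=> X Y; have hX := vertex_index_lt X; have hY := vertex_index_lt Y.
rewrite -{2}(vertex_indexK X) -{2}(vertex_indexK Y) /vertex_map.
have h := adj _ _ hX hY.
split=> /adjacent_vertex a; apply/adjacent_vertex; rewrite ?f14 //.
  by rewrite -h a // f14.
by rewrite h a.
Qed.

Variables (ord : seed R -> rel 'rV[int]_6).
Hypothesis hord : forall s : seed R, reachable s -> refining_order (exchange s) (ord s).

Lemma Delta_body st : st \in states -> Delta ord (realize R st) = body st.
Proof. by move=> hst; apply: Delta_sums => //; exact/hord/state_reachable. Qed.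

Lemma vertex_map_preserves f : (forall i, (i < 14)%N -> (f i < 14)%N) ->
  (forall i, (i < 14)%N -> unimodular_equiv (@body R (representative i)) (body (representative (f i)))) ->
  preserves_Delta ord (vertex_map f).
Proof.
move=> f14 hf X s s' hs hs'; have hX := vertex_index_lt X.
rewrite -(vertex_indexK X) in hs; have [st [hst e ->]] := proj1 (seed_of_vertex _ hX) hs.
have [st' [hst' e' ->]] := proj1 (seed_of_vertex _ (f14 _ hX)) hs'.
rewrite !Delta_body //.
apply: unimodular_trans (unimodular_sym (body_representative R hst)) _.
apply: unimodular_trans (body_representative R hst'); rewrite e e'.
exact: hf.
Qed.

(** The only use of non-equivalence: it confines the image of one vertex, and the finite search over
    automorphisms does the rest. *)
Lemma preserves_first_cluster phi : preserves_Delta ord phi ->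
  vertex_index (phi (vertex_of R 0)) \in [:: 0; 13]%N.
Proof.
move=> h; apply/negPn/negP => nj; have hj := vertex_index_lt (phi (vertex_of R 0)).
apply: (body_representative0 (R := R) hj nj).
have h0 := @representative_states 0%N isT; have hr := representative_states hj.
rewrite -!Delta_body //; apply: h.
  apply: (proj2 (seed_of_vertex _ (isT : (0 < 14)%N))); exists (representative 0).
  by split; [exact: h0|exact: representativeK|].
rewrite -{1}(vertex_indexK (phi _)); apply: (proj2 (seed_of_vertex _ hj)).
exists (representative (vertex_index (phi (vertex_of R 0)))).
by split; [exact: hr|exact: representativeK|].
Qed.

Lemma automorphism_vertex_map phi : graph_automorphism phi -> preserves_Delta ord phi ->
  [\/ phi = id, phi = vertex_map mirror_cluster, phi = vertex_map dual_cluster | phi = vertex_map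
      mirror_cluster \o vertex_map dual_cluster].
Proof.
move=> [bij adj] hphi.
have [p [p14 p0 phiE]] : exists p : nat -> nat, [/\ forall i, (i < 14)%N -> (p i < 14)%N,
    p 0%N \in [:: 0; 13]%N & forall i, phi (vertex_of R i) = vertex_of R (p i)].
  exists (fun i => vertex_index (phi (vertex_of R i))); split=> [i _||i].
  - exact: vertex_index_lt.
  - exact: preserves_first_cluster.
  - by rewrite vertex_indexK.
have tab : mkseq p 14 \in partial_automorphisms 14.
  apply: (mem_partial_automorphisms (leqnn 14) p0 p14) => i j hi hj.
    move=> e.
    have E := etrans (phiE i) (etrans (congr1 (vertex_of R) e) (esym (phiE j))).
    have h := congr1 (@vertex_index R) (bij_inj bij E).
    exact: etrans (esym (vertex_ofK R hi)) (etrans h (vertex_ofK R hj)).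
  have h := adj (vertex_of R i) (vertex_of R j).
  rewrite !phiE in h.
  apply/idP/idP => [/(adjacent_vertex R (p14 i hi) (p14 j hj))/h|].
    by move/(adjacent_vertex R hi hj).
  by move/(adjacent_vertex R hi hj)/h/(adjacent_vertex R (p14 i hi) (p14 j hj)).
have ext f : mkseq p 14 = mkseq f 14 -> phi = vertex_map f.
  move=> e; apply/funext => X; have hX := vertex_index_lt X.
  rewrite -{1}(vertex_indexK X) phiE /vertex_map; congr vertex_of.
  by have := congr1 (fun s => nth 0%N s (vertex_index X)) e; rewrite !nth_mkseq.
have := allP automorphism_table _ tab; rewrite !inE => /or4P [] /eqP e.
- by constructor 1; rewrite -vertex_map_id; apply: ext; rewrite e /mkseq map_id.
- by constructor 2; apply: ext.
- by constructor 3; apply: ext.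
- constructor 4; rewrite -vertex_map_comp; first exact: ext.
  by case: (symmetryP symmetry_dual).
Qed.
End Symmetries.

Theorem theorem3p2 (R : realType) (ord : seed R -> rel 'rV[int]_6)
    (hord : forall s : seed R, reachable s -> refining_order (exchange s) (ord s)) :
  exists iota iota' : vertex R -> vertex R,
    [/\ [/\ graph_involution iota, graph_involution iota' & iota <> iota'],
        generates_Klein_four iota iota',
        preserves_Delta ord iota /\ preserves_Delta ord iota'
      & forall phi : vertex R -> vertex R,
          graph_automorphism phi -> preserves_Delta ord phi ->
          generated iota iota' phi].
Proof.
have im : vertex_map mirror_cluster <> id :> (vertex R -> _) by rewrite -vertex_map_id;
    apply: (@vertex_map_neq R _ _ 0%N).
have id' : vertex_map dual_cluster <> id :> (vertex R -> _) by rewrite -vertex_map_id;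
    apply: (@vertex_map_neq R _ _ 1%N).
have ne : vertex_map mirror_cluster <> vertex_map dual_cluster :> (vertex R -> _) by apply:
    (@vertex_map_neq R _ _ 0%N).
have gm := vertex_map_involution symmetry_mirror im.
have gd := vertex_map_involution symmetry_dual id'.
have [m14 _ _] := symmetryP symmetry_mirror; have [d14 _ _] := symmetryP symmetry_dual.
exists (vertex_map mirror_cluster), (vertex_map dual_cluster); split=> //.
- case: gm => _ mm _; case: gd => _ dd _; apply: Klein_four => //.
  rewrite -!vertex_map_comp //; apply/funext => X; rewrite /vertex_map; congr vertex_of.
  by move: (vertex_index X) (vertex_index_lt X); do 14? [case=> //].
- by split; apply: vertex_map_preserves => //; [exact: body_mirror|exact: body_dual].
move=> phi /automorphism_vertex_map h /(h _ hord) [] ->.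
- exact: generated_id.
- exact: generated_l.
- exact: generated_r.
- exact: generated_comp (generated_l _ _) (generated_r _ _).
Qed.
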